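(* Let $a>0$, $r>0$, $L>0$, and let $b(y,\omega)=X(y,\omega)$, $y\in[0,L]$, be the Ornstein–Uhlenbeck process solving the Itô equation $$dX(y)=-a\,X(y)\,dy+r\,dW(y),\qquad y\in[0,L],$$ where $W(y,\omega)$ is the standard Wiener process and $X(0,\omega)=X_0(\omega)$ is a Gaussian random variable, independent of $W$, with mean zero and variance $\rho=r^2/(2a)$. Then $X$ is stationary, has almost surely continuous sample paths and satisfies $E\big[\|X\|_\infty^6\big]<+\infty$, where $\|X\|_\infty=\sup_{y\in[0,L]}|X(y,\omega)|$. Moreover, the averaged KPP front speed in the channel $\mathbb{R}\times[0,L]$ is given by $$E[c^*(\delta)]=c_0+\frac{c_0\,\delta^2}{2}\,\mathrm{enh}+O(\delta^3),\qquad \delta\ll1 \ (\delta\to0^+),$$ where $$\mathrm{enh}=\frac{r^2}{2a}\left(e^{-aL}\left(\frac{4}{L^2a^4}-\frac{1}{3a^2}\right)+\frac{L}{3a}-\frac{4}{L^2a^4}-\frac{5}{3a^2}+\frac{4}{La^3}\right).$$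
   Context: Here $f(u)=u(1-u)$ (so $f'(0)=1$) and $c_0=2\sqrt{f'(0)}$. For each realization $\omega$ and each $\delta\ge0$, the KPP minimal front speed $c^*(\delta)=c^*(\delta,\omega)$ for the shear $\delta b$ in the two-dimensional channel $\mathbb{R}\times[0,L]$ is $$c^*(\delta,\omega)=\inf_{\lambda>0}\frac{\mu(\lambda)}{\lambda},$$ where $\mu(\lambda)=\mu(\lambda,\delta,\omega)$ is the principal eigenvalue (the one with a positive eigenfunction $\phi>0$) of $$\phi''(y)+[\lambda^2+\lambda\,\delta\,b(y,\omega)+f'(0)]\phi(y)=\mu(\lambda)\phi(y),\quad y\in(0,L),\qquad \phi'(0)=\phi'(L)=0 .$$ *)

(* Defs.v *)
From HB Require Import structures.
From mathcomp Require Import all_boot all_order all_algebra.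
From mathcomp Require Import all_classical all_reals all_analysis.
Set Implicit Arguments.
Unset Strict Implicit.
Unset Printing Implicit Defensive.
Import Order.TTheory GRing.Theory Num.Theory.
Import numFieldNormedType.Exports.
Local Open Scope classical_set_scope.
Local Open Scope ring_scope.

Section KPP.
Context {R : realType}.
Implicit Types (L delta lambda m : R) (b phi : R -> R).

Definition kpp_reaction (u : R) : R := u * (1 - u).

Definition kpp_c0 : R := 2 * Num.sqrt (derive1 kpp_reaction 0).

(* [phi] solves the equation classically on ]0, L[; phi'(0) and phi'(L) are the one-sided
   limits of phi', since [derive1] is a two-sided derivative and [phi] is
   unconstrained outside [0, L]. *)
Definition positive_eigenfunction L b delta lambda m phi : Prop :=
  [/\ {within `[0, L], continuous phi},
      (forall y, 0 <= y <= L -> 0 < phi y),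
      (forall y, 0 < y < L ->
         [/\ derivable phi y 1, derivable (derive1 phi) y 1 &
             derive1n 2 phi y + (lambda ^+ 2 + lambda * delta * b y
                           + derive1 kpp_reaction 0) * phi y = m * phi y]),
      derive1 phi y @[y --> 0^'+] --> (0 : R) &
      derive1 phi y @[y --> L^'-] --> (0 : R)].

(* For continuous [b] there is exactly one such eigenvalue; the default value 0
   is only reached for irregular [b]. *)
Definition principal_eigenvalue L b delta lambda : R :=
  xget 0 [set m | exists phi, positive_eigenfunction L b delta lambda m phi].

Definition kpp_speed L b delta : R :=
  inf [set principal_eigenvalue L b delta lambda / lambda |
         lambda in [set lambda | 0 < lambda]].

End KPP.

Section Processes.
Context {d : measure_display} {T : measurableType d} {R : realType}.
Variable P : probability T R.
Implicit Types (I : set R) (L : R).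

Definition gaussian_rv (X : T -> R) (mean variance : R) : Prop :=
  forall A, measurable A ->
    pushforward P X A = normal_prob mean (Num.sqrt variance) A.

Definition sigma_of_rv (X : T -> R) : set (set T) :=
  preimage_set_system setT X measurable.

Definition sigma_of_process I (X : R -> {RV P >-> R}) : set (set T) :=
  <<s \bigcup_(t in I) sigma_of_rv (X t) >>.

Definition independent_systems (F G : set (set T)) : Prop :=
  forall A B, F A -> G B -> P (A `&` B) = (P A * P B)%E.

Definition wiener_process L (W : R -> {RV P >-> R}) : Prop :=
  [/\ {ae P, forall w, W 0 w = 0},
      (forall s t, 0 <= s -> s < t -> t <= L ->
         gaussian_rv (W t \- W s) 0 (t - s)),
      (forall s t, 0 <= s -> s < t -> t <= L ->
         independent_systems (sigma_of_rv (W t \- W s))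
                             (sigma_of_process `[0, s] W)) &
      {ae P, forall w, {within `[0, L], continuous (fun t => W t w)}}].

(* dX = - a X dy + r dW on [0, L] in integral form: the integrand r of the Ito
   integral is constant, so that integral is r (W y - W 0).  Path continuity is
   not assumed, only the integrability that gives the drift term a meaning. *)
Definition ou_solution L (a r : R) (W : R -> {RV P >-> R}) (X0 : {RV P >-> R})
    (X : R -> {RV P >-> R}) : Prop :=
  {ae P, forall w,
    [/\ X 0 w = X0 w,
        lebesgue_measure.-integrable `[0, L] (fun s => (X s w)%:E) &
        forall y, 0 <= y <= L ->
          X y w = X0 w - a * (\int[lebesgue_measure]_(s in `[0, y]) X s w)
                  + r * (W y w - W 0 w)]}.

Definition stationary_on L (X : R -> {RV P >-> R}) : Prop :=
  forall (n : nat) (t : 'I_n -> R) (h : R),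
    (forall i, 0 <= t i <= L) -> (forall i, 0 <= t i + h <= L) ->
    forall B : set (n.-tuple R), measurable B ->
      P [set w | B [tuple X (t i + h) w | i < n]] =
      P [set w | B [tuple X (t i) w | i < n]].

Definition sup_norm L (X : R -> {RV P >-> R}) (w : T) : \bar R :=
  ereal_sup [set `|X y w|%:E | y in `[0, L]].

(* Integrability with respect to the completion of [P]: path functionals are
   only controlled outside the null set of irregular paths, and [P] is not
   assumed complete.  The library integral of such an [f] is that of any
   integrable [g] equal to it almost everywhere. *)
Definition ae_integrable (f : T -> \bar R) : Prop :=
  exists2 g, P.-integrable setT g & {ae P, forall w, f w = g w}.

End Processes.

Definition ou_enh {R : realType} (a r L : R) : R :=
  r ^+ 2 / (2 * a) *
  (expR (- (a * L)) * (4 / (L ^+ 2 * a ^+ 4) - 1 / (3 * a ^+ 2))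
   + L / (3 * a) - 4 / (L ^+ 2 * a ^+ 4) - 5 / (3 * a ^+ 2)
   + 4 / (L * a ^+ 3)).

(* Main.v *)
Require Import Defs.
From HB Require Import structures.
From mathcomp Require Import all_boot all_order all_algebra.
From mathcomp Require Import ring lra.
From mathcomp Require Import all_classical all_reals all_analysis measurable_realfun.
Import Order.TTheory GRing.Theory Num.Theory.
Import numFieldNormedType.Exports.
Set Implicit Arguments.
Unset Strict Implicit.
Unset Printing Implicit Defensive.
Local Open Scope classical_set_scope.
Local Open Scope ring_scope.

(** The argument has a deterministic half, which expands the front speed of one
channel, and a probabilistic half, which averages the expansion over the
Ornstein-Uhlenbeck paths.

Deterministic half. Write an eigenfunction as [exp P] with [p = P']. The
eigenvalue equation becomes the Riccati equation
[p' + p ^ 2 + lambda * delta * b = mu - lambda ^ 2 - 1], with [p] vanishing at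
both ends. Two such logarithms are compared through the Wronskian of the
exponentials ([neumann_log_compare]), so the extreme values of
[p' + p ^ 2 + lambda * delta * b], for any trial [p] that vanishes at both ends,
are bounds for [mu - lambda ^ 2 - 1]; in particular [mu] is unique. It exists by a
shooting argument on the Riccati equation ([riccati_exists]). Let
[fluct y = mean b * y - prim b y], whose derivative is minus the centred shear,
and let [kappa] be the mean of [fluct ^ 2]. The trial
[p = s * fluct + s ^ 2 * corrector2], with [s = lambda * delta], makes the
expression constant up to third order terms, which gives
[mu = lambda ^ 2 + 1 + s * mean b + s ^ 2 * kappa + O(s ^ 3)]. After division by
[lambda] and minimisation near [lambda = 1],
[c = 2 + delta * mean b + delta ^ 2 * kappa] up to
[speed_const * (delta * sup |b|) ^ 3] ([speed_expansion]). It is the explicit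
cube of the supremum in the remainder that survives averaging.

Probabilistic half. Off a null set the paths of [X] are continuous, since the
drift is the integral of an integrable function, so [X] and [W] are replaced by
versions with everywhere continuous paths ([regular_modification]). The front
speed is Lipschitz in the shear for the sup norm, which makes it measurable
([measurable_functional]) and turns the claim into
[E c = 2 + delta * E (mean X) + delta ^ 2 * E (kappa X) + O(delta ^ 3)] as soon as
the supremum of [|X|] has a third moment. The sixth moment follows from that of
the Wiener path, by dyadic chaining ([integ_sup_abs6]), and from the pathwise bound
[ou_path_le].

Stationarity is obtained without solving the equation in law. The chain
[x (k + 1) = theta * x k + sigma * (increment of W)] started from [X 0] has the
Gaussian law of [X 0] as reversible law when
[sigma ^ 2 * (L / N) = rho * (1 - theta ^ 2)] ([detailed_balance],
[gaussian_invariance]), so its finite-dimensional laws are shift invariant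
([chain_stationary]). For [theta = exp (- a L / N)] it converges pathwise to [X]
([path_chain_cvg]); expectations of products of continuous functions pass to
the limit and determine the laws of tuples ([tuple_law]).

With stationarity, [R t = E (X 0 * X t)] satisfies [R = rho - a * prim R] because
[X 0] is orthogonal to [W], so the covariance is [rho * exp (- a * |s - t|)]
([covariance]). The variance of an integral of [X] over an interval of length
[l] is then [prim_variance l], the covariance of two such integrals follows by
polarisation, and one more integration identifies [E (kappa X)] with [ou_enh]
([expect_kappa]). *)

(** * Primitives of continuous functions *)

Section Calculus.
Context {R : realType}.
Implicit Types (f g F G : R -> R) (x y : R).
Local Notation mu := lebesgue_measure.

Lemma continuous_itv f (a b : R) : continuous f -> {within `[a, b], continuous f}.
Proof. by move=> cf; apply: continuous_subspaceT. Qed.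

Lemma is_derive_continuous F (x l : R) : is_derive x 1 F l -> {for x, continuous F}.
Proof. by move=> h; apply/differentiable_continuous/derivable1_diffP; case: h. Qed.

Lemma der_add F G (a b x : R) : is_derive x 1 F a -> is_derive x 1 G b ->
  is_derive x 1 (fun y => F y + G y) (a + b).
Proof. by move=> hF hG; apply: is_deriveD. Qed.

Lemma der_sub F G (a b x : R) : is_derive x 1 F a -> is_derive x 1 G b ->
  is_derive x 1 (fun y => F y - G y) (a - b).
Proof. by move=> hF hG; apply: is_deriveB. Qed.

Lemma der_mul F G (a b x : R) : is_derive x 1 F a -> is_derive x 1 G b ->
  is_derive x 1 (fun y => F y * G y) (a * G x + F x * b).
Proof.
move=> hF hG; have h := is_deriveM hF hG; apply: (is_derive_eq h).
by rewrite /GRing.scale /=; ring.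
Qed.

Lemma der_scal F (k a x : R) : is_derive x 1 F a ->
  is_derive x 1 (fun y => k * F y) (k * a).
Proof. by move=> hF; apply: is_deriveZ. Qed.

Lemma der_expR F (a x : R) : is_derive x 1 F a ->
  is_derive x 1 (fun y => expR (F y)) (a * expR (F x)).
Proof.
by move=> hF; apply: is_derive_eq; rewrite /GRing.scale /=; ring.
Qed.

Lemma der_cst (c x : R) : is_derive x 1 (fun _ : R => c) 0.
Proof. exact: is_derive_cst. Qed.

Lemma der_lin (k x : R) : is_derive x 1 (fun y : R => k * y) k.
Proof. by rewrite -[X in is_derive _ _ _ X]mulr1; exact: der_scal (is_derive_id _ _). Qed.

Lemma derive_comparison F G f g (a b : R) : a <= b ->
  (forall x, a < x < b -> is_derive x 1 F (f x)) ->
  (forall x, a < x < b -> is_derive x 1 G (g x)) ->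
  {within `[a, b], continuous F} -> {within `[a, b], continuous G} ->
  (forall x, a < x < b -> f x <= g x) ->
  F b - F a <= G b - G a.
Proof.
rewrite le_eqVlt => /predU1P[-> *|ab dF dG cF cG fg]; first by rewrite !subrr.
have [||c cab e] := @MVT R (G \- F) (fun x => g x - f x) a b ab.
  - by move=> x xab; have := dF x xab; have := dG x xab => h1 h2; apply: is_deriveB.
  - by move=> x; apply: cvgB; [exact: cG|exact: cF].
have : 0 <= (G \- F) b - (G \- F) a.
  by rewrite e mulr_ge0 ?subr_ge0 ?(ltW ab)// fg.
by rewrite /=; lra.
Qed.

(** The mean value inequality in the form used throughout: a bound on [f] by the derivative of a
    known function integrates to a bound on the increments of a primitive of [f]. *)
Lemma norm_derive_comparison F G f g (a b : R) : a <= b ->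
  (forall x, a < x < b -> is_derive x 1 F (f x)) ->
  (forall x, a < x < b -> is_derive x 1 G (g x)) ->
  {within `[a, b], continuous F} -> {within `[a, b], continuous G} ->
  (forall x, a < x < b -> `|f x| <= g x) ->
  `|F b - F a| <= G b - G a.
Proof.
move=> ab dF dG cF cG fg; rewrite ler_norml; apply/andP; split; last first.
  apply: (@derive_comparison F G f g a b) => // x xab.
  exact: ler_normlW (fg _ xab).
have := @derive_comparison (fun x => - F x) G (fun x => - f x) g a b ab.
suff H : - F b - - F a <= G b - G a -> - (G b - G a) <= F b - F a.
  move=> h; apply/H/h => //.
  - by move=> x /dF ?; exact: is_deriveN.
  - by move=> x; apply: cvgN; exact: cF.
  - by move=> x xab; rewrite lerNl; exact: lerNnormlW (fg _ xab).
by lra.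
Qed.

(** A primitive on the whole line is glued from the integrals over [[-n, y]]; having it on the whole
    line avoids one-sided derivatives at the ends of [[0, L]]. *)
Lemma primitive_exists f : continuous f ->
  exists F : R -> R, F 0 = 0 /\ forall x : R, is_derive x 1 F (f x).
Proof.
move=> cf.
have itf a b : mu.-integrable `[a, b] (EFin \o f).
  apply: continuous_compact_integrable; first exact: segment_compact.
  exact: continuous_itv.
pose G n (y : R) := \int[mu]_(t in `[- n%:R, y]) f t.
have dG n (y : R) : - n%:R < y -> is_derive y 1 (G n) (f y).
  move=> ny; have [|] := @continuous_FTC1_closed R f (- n%:R) y (y + 1) _ (itf _ _) ny (cf y).
    by rewrite ltrDl.
  by rewrite derive1E => h1 h2; apply: DeriveDef.
have G0 n m (y : R) : (n <= m)%N -> - n%:R <= y -> 0 <= n%:R :> R -> G n y - G n 0 = G m y - G m 0.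
  move=> nm ny n0; have mn : - m%:R <= - n%:R :> R by rewrite lerN2 ler_nat.
  have H (z : R) : - n%:R <= z -> G m z - G n z = G m (- n%:R).
    move=> nz; have := @Rintegral_itvB R f (BLeft (- m%:R)) (BRight z) (- n%:R).
    move=> /(_ (itf _ _)); rewrite !bnd_simp => /(_ mn nz) E.
    have -> : G m (- n%:R) = G m z - (G m z - G m (- n%:R)) by lra.
    rewrite {3 4}/G E Rintegral_itv_obnd_cbnd//.
    apply: integrableS (itf (- n%:R) z) => //.
    by apply: subset_itvr; rewrite bnd_simp.
  have := H _ ny; have := H 0; rewrite oppr_le0 => /(_ n0); lra.
pose N (y : R) := (Num.truncn `|y|).+1.
exists (fun y => G (N y) y - G (N y) 0); split; first by rewrite subrr.
move=> x.
have Nx (y : R) : `|y| < (N y)%:R by rewrite /N truncnS_gt.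
have xM : - (N x).+1%:R < x.
  have := Nx x; have := ler_norm (- x); rewrite normrN -natr1; lra.
suff : is_derive x 1 (fun y => G (N x).+1 y - G (N x).+1 0) (f x).
  apply: near_eq_is_derive.
  near=> y; symmetry.
  have Ny := Nx y; have Nxx := Nx x.
  have [h|h] := leqP (N y) (N x).+1.
    by apply: G0 => //; have := ler_norm (- y); rewrite normrN; lra.
  symmetry; apply: G0 => //; first exact: ltnW.
  suff : `|x - y| < 1.
    have : `|y| <= `|x| + `|x - y| by rewrite (le_trans _ (ler_normB _ _))// opprB addrC subrK.
    have := ler_norm (- y); rewrite normrN -natr1; lra.
  near: y; apply: cvgr_dist_lt => //.
rewrite -[X in is_derive _ _ _ X]subr0.
exact: der_sub (dG _ _ xM) (is_derive_cst _ _ _).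
Unshelve. all: by end_near. Qed.

(** Chosen once and for all on the whole line; for [0 <= y] its value at [y] is the Lebesgue integral
    over [[0, y]] ([Rintegral_prim]). *)
Definition prim f : R -> R :=
  xget (cst 0) [set F | F 0 = 0 /\ forall x : R, is_derive x 1 F (f x)].

Lemma primP f : continuous f ->
  prim f 0 = 0 /\ forall x : R, is_derive x 1 (prim f) (f x).
Proof. by move=> /primitive_exists[F HF]; rewrite /prim; case: xgetP => // /(_ F). Qed.

Lemma prim0 f : continuous f -> prim f 0 = 0.
Proof. by move=> /primP[]. Qed.

Lemma is_derive_prim f (x : R) : continuous f -> is_derive x 1 (prim f) (f x).
Proof. by move=> /primP[]. Qed.

Lemma continuous_derive F f : (forall x : R, is_derive x 1 F (f x)) -> continuous F.
Proof. by move=> h x; exact: is_derive_continuous (h x). Qed.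

Lemma continuous_prim f : continuous f -> continuous (prim f).
Proof. by move=> cf; apply: (@continuous_derive _ f) => x; exact: is_derive_prim. Qed.

Lemma le_prim f g y : continuous f -> continuous g -> 0 <= y ->
  (forall x, 0 < x < y -> f x <= g x) -> prim f y <= prim g y.
Proof.
move=> cf cg y0 fg.
have := @derive_comparison (prim f) (prim g) f g 0 y y0.
rewrite !prim0// !subr0; apply => //.
- by move=> *; exact: is_derive_prim.
- by move=> *; exact: is_derive_prim.
- exact/continuous_itv/continuous_prim.
- exact/continuous_itv/continuous_prim.
Qed.

Lemma prim_unique f F y : 0 <= y -> F 0 = 0 -> continuous f ->
  {within `[0, y], continuous F} ->
  (forall x, 0 < x < y -> is_derive x 1 F (f x)) -> prim f y = F y.
Proof.
move=> y0 F0 cf cF dF; apply/eqP; rewrite eq_le.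
have cP := @continuous_itv _ 0 y (continuous_prim cf).
have dP x : 0 < x < y -> is_derive x 1 (prim f) (f x) by move=> _; exact: is_derive_prim.
have := @derive_comparison (prim f) F f f 0 y y0 dP dF cP cF (fun _ _ => lexx _).
have := @derive_comparison F (prim f) f f 0 y y0 dF dP cF cP (fun _ _ => lexx _).
by rewrite F0 !prim0// !subr0 => -> ->.
Qed.

Lemma Rintegral_prim f y : 0 <= y -> continuous f ->
  \int[mu]_(t in `[0, y]) f t = prim f y.
Proof.
rewrite le_eqVlt => /predU1P[<- cf|y0 cf].
  by rewrite set_itv1 Rintegral_set1 prim0.
have dP := fun x => is_derive_prim x cf.
rewrite /Rintegral (@continuous_FTC2 R f (prim f) 0 y y0 (@continuous_itv _ _ _ cf)).
- by rewrite prim0// sube0.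
- split=> [x _|/=|/=].
  + by case: (dP x).
  + by apply: cvg_at_right_filter; exact: continuous_prim.
  + by apply: cvg_at_left_filter; exact: continuous_prim.
- by move=> x _; rewrite derive1E; apply: derive_val.
Qed.

Lemma eq_prim f g y : 0 <= y -> continuous f -> continuous g ->
  (forall x, 0 < x < y -> f x = g x) -> prim f y = prim g y.
Proof.
by move=> y0 cf cg fg; apply/eqP; rewrite eq_le !le_prim// => x /fg ->.
Qed.

Lemma continuous_bounded (b : R -> R) (A B : R) : continuous b ->
  exists2 M : R, 0 <= M & forall y, A <= y <= B -> `|b y| <= M.
Proof.
move=> cb; have [AB|BA] := leP A B; last by exists 0 => // y /andP[/le_trans h /h]; rewrite leNgt BA.
have c : continuous (fun y => `|b y|) by move=> y; apply: cvg_norm; exact: cb.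
have [m _ hm] := EVT_max AB (continuous_itv (a := A) (b := B) c).
by exists `|b m| => // y yAB; apply: hm; rewrite in_itv.
Qed.

End Calculus.

(** * The Neumann comparison principle *)

Section Barrier.
Context {R : realType}.
Implicit Types (f g F G P p d b phi q : R -> R) (x y L delta lambda m nu K M : R).

(** The logarithm [P] of a positive function with Neumann boundary values. Its derivatives [p] and
    [d] are parameters because they are only determined on the open interval. *)
Definition neumann_log L P p d : Prop :=
  [/\ {within `[0, L], continuous P},
      (forall y, 0 < y < L -> is_derive y 1 P (p y) /\ is_derive y 1 p (d y)),
      p y @[y --> 0^'+] --> (0 : R) & p y @[y --> L^'-] --> (0 : R)].

(** The Wronskian [(p2 - p1) * exp (P1 + P2)] tends to 0 at both ends, so it cannot be strictly
    increasing. This one fact gives the uniqueness of the principal eigenvalue, its comparison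
    with trial functions and its dependence on the shear. *)
Lemma neumann_log_compare L P1 p1 d1 P2 p2 d2 : 0 < L ->
  neumann_log L P1 p1 d1 -> neumann_log L P2 p2 d2 ->
  ~ (forall y, 0 < y < L -> d1 y + p1 y ^+ 2 < d2 y + p2 y ^+ 2).
Proof.
move=> L0 [cP1 dP1 l1 r1] [cP2 dP2 l2 r2] lt12.
(* The derivative of V is (d2 + p2^2 - d1 - p1^2) exp (P1 + P2). *)
pose V y := (p2 y - p1 y) * expR (P1 y + P2 y).
have dV y : 0 < y < L -> is_derive y 1 V
    ((d2 y - d1 y) * expR (P1 y + P2 y) +
     (p2 y - p1 y) * ((p1 y + p2 y) * expR (P1 y + P2 y))).
  move=> y0L; have [dP1y dp1y] := dP1 _ y0L; have [dP2y dp2y] := dP2 _ y0L.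
  exact: (der_mul (der_sub dp2y dp1y) (der_expR (der_add dP1y dP2y))).
have incrV x y : 0 < x -> x < y -> y < L -> V x < V y.
  move=> x0 xy yL.
  have sub z : z \in `[x, y] -> 0 < z < L.
    by rewrite in_itv/= => /andP[xz zy]; rewrite (lt_le_trans x0)//= (le_lt_trans zy).
  apply: (@gtr0_derive1_incr _ V x y) => //.
  - by move=> z zxy; case: (dV z (sub _ (subset_itv_oo_cc zxy))).
  - move=> z zxy; have zL := sub _ (subset_itv_oo_cc zxy).
    rewrite derive1E; have [_ ->] := dV z zL.
    rewrite mulrA -mulrDl mulr_gt0 ?expR_gt0//; have := lt12 _ zL; nra.
  - apply: derivable_within_continuous => z zxy.
    by case: (dV z (sub _ zxy)).
have [_ P1l P1r] := (continuous_within_itvP P1 L0).1 cP1.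
have [_ P2l P2r] := (continuous_within_itvP P2 L0).1 cP2.
have Vl : V y @[y --> 0^'+] --> (0 : R).
  rewrite [X in _ --> X](_ : _ = (0 - 0) * expR (P1 0 + P2 0)); last by rewrite subrr mul0r.
  apply: cvgM; first exact: cvgB.
  apply: (cvg_comp (fun y => P1 y + P2 y) expR); last exact: continuous_expR.
  exact: cvgD.
have Vr : V y @[y --> L^'-] --> (0 : R).
  rewrite [X in _ --> X](_ : _ = (0 - 0) * expR (P1 L + P2 L)); last by rewrite subrr mul0r.
  apply: cvgM; first exact: cvgB.
  apply: (cvg_comp (fun y => P1 y + P2 y) expR); last exact: continuous_expR.
  exact: cvgD.
have V1 : 0 <= V (L / 3).
  apply: (cvgr_to_le Vl).
  near=> y; apply/ltW/incrV.
  - by near: y; exact: nbhs_right_gt.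
  - by near: y; apply: nbhs_right_lt; lra.
  - lra.
have V2 : V (2 * L / 3) <= 0.
  apply: (cvgr_to_ge Vr).
  near=> y; apply/ltW/incrV.
  - lra.
  - by near: y; apply: nbhs_left_gt; lra.
  - by near: y; exact: nbhs_left_lt.
have : V (L / 3) < V (2 * L / 3) by apply: incrV; lra.
lra.
Unshelve. all: by end_near. Qed.

Lemma derive1_kpp_reaction0 : derive1 (@kpp_reaction R) 0 = 1.
Proof.
rewrite derive1E.
have h : is_derive (0 : R) 1 (@kpp_reaction R) (1 * (1 - 0) + 0 * (0 - 1)).
  by apply: der_mul; apply: der_sub.
by case: h => _ ->; lra.
Qed.

Lemma positive_eigenfunction_log L b delta lambda m phi : 0 < L ->
  positive_eigenfunction L b delta lambda m phi ->
  exists P p d, neumann_log L P p d /\ forall y, 0 < y < L ->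
    d y + p y ^+ 2 = m - lambda ^+ 2 - 1 - lambda * delta * b y.
Proof.
move=> L0 [cphi phi0 ode phil phir].
pose p y := derive1 phi y / phi y.
pose d y := (m - lambda ^+ 2 - 1 - lambda * delta * b y) - p y ^+ 2.
have [cphioo cphil cphir] := (continuous_within_itvP phi L0).1 cphi.
have phi00 : 0 < phi 0 by rewrite phi0// lexx ltW.
have phiL0 : 0 < phi L by rewrite phi0// lexx ltW.
exists (fun y => ln (phi y)), p, d; split; last by move=> y _; rewrite /d subrK.
split.
- apply/(continuous_within_itvP _ L0); split.
  + move=> y yL; apply: (continuous_comp (f := phi)); first exact: cphioo.
    apply: continuous_ln; apply: phi0.
    by move: yL; rewrite in_itv/= => /andP[h1 h2]; rewrite !ltW.
  + by apply: (cvg_comp phi (@ln R) cphil); exact: (continuous_ln phi00).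
  + by apply: (cvg_comp phi (@ln R) cphir); exact: (continuous_ln phiL0).
- move=> y yL; have [d1 d2 e] := ode _ yL.
  have py : 0 < phi y by apply: phi0; case/andP: yL => h1 h2; rewrite !ltW.
  have D1 : is_derive y 1 phi (derive1 phi y) by rewrite derive1E; exact: derivableP.
  have D2 : is_derive y 1 (derive1 phi) (derive1n 2 phi y).
    by rewrite derive1nS derive1n1 derive1E; exact: derivableP.
  split.
    have h := is_derive1_comp (is_derive1_ln py) D1.
    by apply: (is_derive_eq h); rewrite /p mulrC.
  have h := der_mul D2 (is_deriveV (lt0r_neq0 py) D1).
  apply: (is_derive_eq h).
  have {}e : derive1n 2 phi y = (m - lambda ^+ 2 - 1 - lambda * delta * b y) * phi y.
    by move: e; rewrite derive1_kpp_reaction0; lra.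
  rewrite /d /p e /GRing.scale /=.
  by field; exact: lt0r_neq0.
- rewrite [X in _ --> X](_ : _ = 0 / phi 0); last by rewrite mul0r.
  by apply: cvgM => //; apply: cvgV => //; exact: lt0r_neq0.
- rewrite [X in _ --> X](_ : _ = 0 / phi L); last by rewrite mul0r.
  by apply: cvgM => //; apply: cvgV => //; exact: lt0r_neq0.
Qed.

Lemma neumann_log_prim L p d : 0 < L -> continuous p -> p 0 = 0 -> p L = 0 ->
  (forall y, 0 < y < L -> is_derive y 1 p (d y)) -> neumann_log L (prim p) p d.
Proof.
move=> L0 cp p0 pL dp; split.
- exact/continuous_itv/continuous_prim.
- by move=> y /dp ?; split => //; exact: is_derive_prim.
- by rewrite -[X in _ --> X]p0; apply: cvg_at_right_filter; exact: cp.
- by rewrite -[X in _ --> X]pL; apply: cvg_at_left_filter; exact: cp.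
Qed.

Lemma eigenvalue_le_super L b delta lambda m phi p d nu : 0 < L ->
  positive_eigenfunction L b delta lambda m phi ->
  continuous p -> p 0 = 0 -> p L = 0 ->
  (forall y, 0 < y < L -> is_derive y 1 p (d y)) ->
  (forall y, 0 < y < L -> d y + p y ^+ 2 + lambda * delta * b y <= nu) ->
  m <= lambda ^+ 2 + 1 + nu.
Proof.
move=> L0 /(positive_eigenfunction_log L0)[P1 [p1 [d1 [nl1 e1]]]] cp p0 pL dp sup.
rewrite leNgt; apply/negP => ltm.
apply: (neumann_log_compare L0 (neumann_log_prim L0 cp p0 pL dp) nl1) => y yL.
by rewrite e1//; have := sup _ yL; lra.
Qed.

Lemma eigenvalue_ge_sub L b delta lambda m phi p d nu : 0 < L ->
  positive_eigenfunction L b delta lambda m phi ->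
  continuous p -> p 0 = 0 -> p L = 0 ->
  (forall y, 0 < y < L -> is_derive y 1 p (d y)) ->
  (forall y, 0 < y < L -> nu <= d y + p y ^+ 2 + lambda * delta * b y) ->
  lambda ^+ 2 + 1 + nu <= m.
Proof.
move=> L0 /(positive_eigenfunction_log L0)[P1 [p1 [d1 [nl1 e1]]]] cp p0 pL dp sup.
rewrite leNgt; apply/negP => ltm.
apply: (neumann_log_compare L0 nl1 (neumann_log_prim L0 cp p0 pL dp)) => y yL.
by rewrite e1//; have := sup _ yL; lra.
Qed.

Lemma eigenvalue_perturb L b1 b2 delta lambda m1 phi1 m2 phi2 (e : R) : 0 < L ->
  positive_eigenfunction L b1 delta lambda m1 phi1 ->
  positive_eigenfunction L b2 delta lambda m2 phi2 ->
  (forall y, 0 < y < L -> lambda * delta * (b1 y - b2 y) <= e) ->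
  m1 <= m2 + e.
Proof.
move=> L0 /(positive_eigenfunction_log L0)[P1 [p1 [d1 [nl1 e1]]]].
move=> /(positive_eigenfunction_log L0)[P2 [p2 [d2 [nl2 e2]]]] b12.
rewrite leNgt; apply/negP => ltm.
apply: (neumann_log_compare L0 nl2 nl1) => y yL.
by rewrite e1// e2//; have := b12 _ yL; lra.
Qed.

End Barrier.

(** * Existence of the principal eigenvalue *)

Section Existence.
Context {R : realType}.
Implicit Types (f g F G P p d b phi q v : R -> R) (u : nat -> R -> R) (x y L delta lambda m nu K M B : R).

Lemma cvg_div_exp2 B : (fun n : nat => B / 2 ^+ n) @ \oo --> (0 : R).
Proof.
rewrite -[X in _ --> X](mulr0 B); apply: cvgM; first exact: cvg_cst.
rewrite (_ : (fun x : nat => 2 ^- x) = (fun n : nat => 2^-1 ^+ n : R)).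
  by apply: cvg_expr; rewrite ger0_norm; lra.
by apply/funext => n; rewrite exprVn.
Qed.

Lemma geometric_cauchy_cvg (u : nat -> R) B : 
  (forall n, `|u n.+1 - u n| <= B / 2 ^+ n) ->
  exists2 l, u @ \oo --> l & forall n, `|u n - l| <= 2 * B / 2 ^+ n.
Proof.
move=> hu.
have B0 : 0 <= B by have := hu 0%N; rewrite expr0 divr1; exact: le_trans.
have step n k : `|u (n + k)%N - u n| <= 2 * B / 2 ^+ n - 2 * B / 2 ^+ (n + k).
  elim: k => [|k IH]; first by rewrite addn0 !subrr normr0.
  rewrite addnS (le_trans (ler_distD (u (n + k)%N) _ _))//.
  apply: (le_trans (lerD (hu _) IH)).
  rewrite exprS invfM; set t := (2 ^+ (n + k))^-1; lra.
have step' n k : `|u (n + k)%N - u n| <= 2 * B / 2 ^+ n.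
  apply: (le_trans (step n k)); rewrite lerBlDr lerDl.
  by rewrite divr_ge0 ?mulr_ge0// exprn_ge0.
have lim0 := cvg_div_exp2 (2 * B).
have cu : cvgn u.
  apply/cauchy_cvgP; apply/cauchy_ballP => e e0; near_simpl.
  have /cvgrPdist_lt/(_ _ (divr_gt0 e0 (@ltr0n R 2))) := lim0.
  move=> [N _ HN].
  exists ([set n | (N <= n)%N], [set n | (N <= n)%N]); first by split; exists N.
  have H n : (N <= n)%N -> `|u n - u N| < e / 2.
    move=> Nn; rewrite -(subnKC Nn); apply: (le_lt_trans (step' _ _)).
    by have := HN N (leqnn N); rewrite sub0r normrN; apply: le_lt_trans; exact: ler_norm.
  move=> [n k] /= [Nn Nk]; rewrite -ball_normE /=.
  rewrite (le_lt_trans (ler_distD (u N) _ _))// (splitr e) ltrD// ?H//.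
  by rewrite distrC H.
exists (limn u) => // n.
rewrite distrC.
have h : (fun k => `|u (n + k)%N - u n|) @ \oo --> `|limn u - u n|.
  apply: cvg_norm; apply: cvgB; last exact: cvg_cst.
  have := cu; rewrite -(cvg_shiftn n).
  by rewrite (_ : (fun n0 : nat => u (n0 + n)%N) = (fun k => u (n + k)%N))//; apply/funext => k; rewrite addnC.
by apply: (cvgr_to_le h); apply: nearW => k; exact: step'.
Qed.

Lemma uniform_cauchy_limit u B : (forall n, continuous (u n)) ->
  (forall n x, `|u n.+1 x - u n x| <= B / 2 ^+ n) ->
  exists2 v, continuous v & forall n x, `|u n x - v x| <= 2 * B / 2 ^+ n.
Proof.
move=> cu hu.
have /choice[v Hv] : forall x, exists l, forall n, `|u n x - l| <= 2 * B / 2 ^+ n.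
  by move=> x; have [l _ Hl] := @geometric_cauchy_cvg (u^~ x) B (hu^~ x); exists l.
exists v => [x|n x]; last exact: Hv.
apply/cvgrPdist_lt => e e0.
have lim0 := cvg_div_exp2 (2 * B).
have e3 : 0 < e / 3 by lra.
have /cvgrPdist_lt/(_ _ e3)[n _ /(_ n (leqnn n))] := lim0.
rewrite sub0r normrN => /(le_lt_trans (ler_norm _)) ltn.
have /cvgrPdist_lt/(_ _ e3) := cu n x.
apply: filterS => y hy.
have h1 := Hv x n; have h2 := Hv y n.
rewrite (le_lt_trans (ler_distD (u n x) _ _))//.
have -> : e = e / 3 + (e / 3 + e / 3) by lra.
rewrite ltrD//; first by rewrite distrC (le_lt_trans h1).
by rewrite (le_lt_trans (ler_distD (u n y) _ _))// ltrD// (le_lt_trans h2).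
Qed.

Definition clamp x y M : R := Num.max x (Num.min y M).

Lemma clamp_itv x y M : x <= y -> x <= clamp x y M <= y.
Proof. by move=> xy; rewrite /clamp le_max lexx/= ge_max xy/= ge_min lexx. Qed.

Lemma clamp_id x y M : x <= M <= y -> clamp x y M = M.
Proof. by move=> /andP[xM My]; rewrite /clamp (min_idPr My) (max_idPr xM). Qed.

Lemma continuous_clamp x y : continuous (clamp x y).
Proof.
move=> z; apply: (@continuous_max _ _ (cst x) (fun M => Num.min y M)); first exact: cvg_cst.
by apply: (@continuous_min _ _ (cst y) id); [exact: cvg_cst|exact: cvg_id].
Qed.

(** The right-hand side is Lipschitz, so the Picard map contracts for a weighted sup norm on
    [[0, L]]; its iterates are clamped to be compared on the whole line. *)
Lemma picard q g K L nu : 0 < K -> 0 <= L -> continuous q -> continuous g ->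
  (forall x y, `|g x - g y| <= K * `|x - y|) ->
  exists p, [/\ continuous p, p 0 = 0 &
    forall y, 0 <= y <= L -> is_derive y 1 p (nu - q y - g (p y))].
Proof.
move=> K0 L0 cq cg lipg.
pose h f := fun s => nu - q s - g (f s).
have ch f : continuous f -> continuous (h f).
  move=> cf x; apply: cvgB; first by apply: cvgB; [exact: cvg_cst|exact: cq].
  by apply: (cvg_comp f g); [exact: cf|exact: cg].
pose T f := prim (h f).
have cT f : continuous f -> continuous (T f) by move=> /ch; exact: continuous_prim.
(* For the weight E the Picard map contracts by the factor 1/2. *)
pose E y := expR (2 * K * y).
have cE : continuous E.
  move=> y; apply: (cvg_comp (fun y => 2 * K * y) expR); last exact: continuous_expR.
  by apply: cvgM; [exact: cvg_cst|exact: cvg_id].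
have primE (C : R) y : prim (fun s => (2 * K * C) * E s) y = C * (E y - 1) \/ y < 0.
  have [y0|] := leP 0 y; [left|by right].
  have cCE : continuous (fun y => C * (E y - 1)).
    by move=> z; apply: cvgM; [exact: cvg_cst|apply: cvgB; [exact: cE|exact: cvg_cst]].
  apply: (@prim_unique _ _ (fun y => C * (E y - 1))) => //.
  - by rewrite /E mulr0 expR0 subrr mulr0.
  - by move=> z; apply: cvgM; [exact: cvg_cst|exact: cE].
  - exact: continuous_itv.
  - move=> x _; have D := der_scal C (der_sub (der_expR (der_lin (2 * K) x)) (der_cst 1 x)).
    by apply: (is_derive_eq D); rewrite /E; ring.
have TT f1 f2 (C : R) : continuous f1 -> continuous f2 -> 0 <= C ->
    (forall y, 0 <= y <= L -> `|f1 y - f2 y| <= C * E y) ->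
    forall y, 0 <= y <= L -> `|T f1 y - T f2 y| <= C / 2 * E y.
  move=> c1 c2 C0 f12 y /andP[y0 yL].
  have hh : forall s, 0 < s < y -> `|h f1 s - h f2 s| <= (2 * K * (C / 2)) * E s.
    move=> s /andP[s0 sy].
    have -> : h f1 s - h f2 s = g (f2 s) - g (f1 s) by rewrite /h; ring.
    rewrite distrC (le_trans (lipg _ _))//.
    have -> : 2 * K * (C / 2) * E s = K * (C * E s) by field.
    rewrite ler_pM2l// f12//; lra.
  have cCE : continuous (fun s => (2 * K * (C / 2)) * E s).
    by move=> z; apply: cvgM; [exact: cvg_cst|exact: cE].
  have [pE|] := primE (C / 2) y; last by lra.
  have dh (z : R) : is_derive z 1 (fun z => T f1 z - T f2 z) (h f1 z - h f2 z).
    by apply: der_sub; apply: is_derive_prim; exact: ch.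
  have T0 : T f1 0 - T f2 0 = 0 by rewrite /T !prim0 ?subrr//; exact: ch.
  have dP (z : R) := is_derive_prim z cCE.
  have cD := continuous_derive dh; have cP := continuous_derive dP.
  have := @norm_derive_comparison _ (fun z => T f1 z - T f2 z) _ _ _ 0 y y0
     (fun z _ => dh z) (fun z _ => dP z) (continuous_itv cD) (continuous_itv cP) hh.
  rewrite T0 prim0// pE !subr0 => /le_trans; apply.
  by rewrite ler_wpM2l ?divr_ge0// lerBlDr lerDl.
pose u n := iter n T (cst 0).
have cu n : continuous (u n).
  by elim: n => [|n IH]; [exact: cst_continuous|exact: cT].
have [C C0 HC] : exists2 C, 0 <= C & forall y, 0 <= y <= L -> `|u 1%N y - u 0%N y| <= C.
  by apply: continuous_bounded => z; apply: cvgB; exact: cu.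
have hu n y : 0 <= y <= L -> `|u n.+1 y - u n y| <= C / 2 ^+ n * E y.
  elim: n y => [|n IH] y yL.
    rewrite expr0 divr1 (le_trans (HC _ yL))// ler_peMr// -expR0 ler_expR.
    by case/andP: yL => y0 _; rewrite !mulr_ge0// ltW.
  have -> : C / 2 ^+ n.+1 = C / 2 ^+ n / 2 by rewrite exprS invfM; ring.
  have Cn0 : 0 <= C / 2 ^+ n by rewrite divr_ge0// exprn_ge0.
  exact: (TT (u n.+1) (u n) _ (cu n.+1) (cu n) Cn0 IH).
pose w n y := u n (clamp 0 L y).
have cw n : continuous (w n).
  move=> z; apply: (cvg_comp (clamp 0 L) (u n)); [exact: continuous_clamp|exact: cu].
have EL y : 0 <= y <= L -> E y <= E L.
  by move=> /andP[y0 yL]; rewrite ler_expR ler_pM2l// mulr_gt0.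
have E0 y : 0 < E y by exact: expR_gt0.
have EL1 : 1 <= E L by rewrite /E -[leLHS]expR0 ler_expR !mulr_ge0// ltW.
have [v cv Hv] : exists2 v, continuous v & forall n x, `|w n x - v x| <= 2 * (C * E L) / 2 ^+ n.
  apply: uniform_cauchy_limit => // n x.
  have cx := clamp_itv x L0.
  rewrite (le_trans (hu n _ cx))// mulrAC ler_pM2r ?invr_gt0 ?exprn_gt0//.
  by rewrite ler_wpM2l// EL.
have fixv y : 0 <= y <= L -> T v y = v y.
  move=> yL; apply/eqP; rewrite -subr_eq0 -normr_le0; apply/ler_addgt0Pr => e e0; rewrite add0r.
  pose D := 2 * (C * E L) * E L.
  have D0 : 0 <= D by rewrite !mulr_ge0// ltW.
  have H n : `|T v y - v y| <= D / 2 ^+ n.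
    rewrite (le_trans (ler_distD (u n.+1 y) _ _))//.
    have -> : D / 2 ^+ n = D / 2 ^+ n / 2 + D / 2 ^+ n / 2 by field; rewrite expf_neq0.
    apply: lerD.
      rewrite distrC.
      apply: (le_trans (@TT (u n) v (2 * (C * E L) / 2 ^+ n) (cu n) cv _ _ y yL)).
      - by rewrite divr_ge0 ?mulr_ge0 ?exprn_ge0// ltW.
      - move=> z zL; have := Hv n z; rewrite /w clamp_id// => /le_trans; apply.
        rewrite ler_peMr//; first by rewrite divr_ge0 ?mulr_ge0 ?exprn_ge0// ltW.
        by rewrite -expR0 ler_expR; case/andP: zL => z0 _; rewrite !mulr_ge0// ltW.
      - rewrite /D; have := EL y yL; set t := (2 ^+ n)^-1 => Ey.
        have t0 : 0 <= t by rewrite invr_ge0 exprn_ge0.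
        have -> : 2 * (C * E L) * t / 2 * E y = (2 * (C * E L) * t / 2) * E y by [].
        have -> : 2 * (C * E L) * E L * t / 2 = (2 * (C * E L) * t / 2) * E L by ring.
        by rewrite ler_wpM2l// !mulr_ge0// ltW.
    have := Hv n.+1 y; rewrite /w clamp_id// => /le_trans; apply.
    rewrite /D exprS invfM; set t := (2 ^+ n)^-1.
    have t0 : 0 <= t by rewrite invr_ge0 exprn_ge0.
    have -> : 2 * (C * E L) * (2^-1 * t) = (2 * (C * E L) * t / 2) * 1 by ring.
    have -> : 2 * (C * E L) * E L * t / 2 = (2 * (C * E L) * t / 2) * E L by ring.
    have A0 : 0 <= 2 * (C * E L) * t / 2 by rewrite !mulr_ge0// ltW.
    exact: ler_wpM2l A0 _ _ EL1.
  have lim0 := cvg_div_exp2 (D).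
  have /cvgrPdist_lt/(_ _ e0)[n _ /(_ n (leqnn n))] := lim0.
  rewrite sub0r normrN => /(le_lt_trans (ler_norm _)) ltn.
  exact: (le_trans (H n) (ltW ltn)).
exists (T v); split; [exact: cT|by apply: prim0; exact: ch|move=> y yL].
rewrite fixv//; exact: (is_derive_prim y (ch _ cv)).
Qed.

(** Stability of the end value; the square makes the difference of two solutions differentiable. *)
Lemma gronwall p1 p2 f1 f2 (e : R) K L : 0 <= K -> 0 <= L ->
  continuous p1 -> continuous p2 -> p1 0 = p2 0 ->
  (forall y, 0 <= y <= L -> is_derive y 1 p1 (f1 y)) ->
  (forall y, 0 <= y <= L -> is_derive y 1 p2 (f2 y)) ->
  (forall y, 0 <= y <= L -> `|f1 y - f2 y| <= `|e| + K * `|p1 y - p2 y|) ->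
  (p1 L - p2 L) ^+ 2 <= e ^+ 2 * (L * expR ((1 + 2 * K) * L)).
Proof.
move=> K0 L0 c1 c2 p0 d1 d2 f12.
(* 2 a u <= 2 |e| |u| + 2 K u^2 <= e^2 + k u^2, so the derivative of D is at most e^2. *)
pose k := 1 + 2 * K.
pose D y := (p1 y - p2 y) * (p1 y - p2 y) * expR (- k * y).
have dD y : 0 <= y <= L -> is_derive y 1 D
    (((f1 y - f2 y) * (p1 y - p2 y) + (p1 y - p2 y) * (f1 y - f2 y)) * expR (- k * y) +
     (p1 y - p2 y) * (p1 y - p2 y) * (- k * expR (- k * y))).
  move=> yL; have d12 := der_sub (d1 _ yL) (d2 _ yL).
  exact: (der_mul (der_mul d12 d12) (der_expR (der_lin (- k) y))).
have cD : continuous D.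
  move=> y; apply: cvgM; first by apply: cvgM; apply: cvgB; [exact: c1|exact: c2|exact: c1|exact: c2].
  apply: (cvg_comp (fun y => - k * y) expR); last exact: continuous_expR.
  by apply: cvgM; [exact: cvg_cst|exact: cvg_id].
have sub y : 0 < y < L -> 0 <= y <= L by move=> /andP[h1 h2]; rewrite !ltW.
have := @derive_comparison R D (fun y => e ^+ 2 * y) _ _ 0 L L0
   (fun y yL => dD y (sub y yL)) (fun y _ => der_lin (e ^+ 2) y) (continuous_itv cD) (continuous_itv _) _.
have -> : D 0 = 0 by rewrite /D p0 subrr !mul0r.
rewrite mulr0 !subr0 => H.
have {H} : D L <= e ^+ 2 * L.
  apply: H; first by move=> y; apply: cvgM; [exact: cvg_cst|exact: cvg_id].
  move=> y /andP[y0 yL].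
  have yL' : 0 <= y <= L by rewrite !ltW.
  have h := f12 y yL'.
  set a := f1 y - f2 y in h *; set u := p1 y - p2 y in h *; set E := expR _.
  have E0 : 0 <= E by exact: expR_ge0.
  have E1 : E <= 1.
    by rewrite /E -expR0 ler_expR mulNr oppr_le0 mulr_ge0 ?ltW// /k; lra.
  have au : a * u <= (`|e| + K * `|u|) * `|u|.
    by rewrite (le_trans (ler_norm _))// normrM ler_wpM2r.
  have uu : `|u| * `|u| = u * u by rewrite -expr2 real_normK ?num_real.
  have ee : `|e| * `|e| = e ^+ 2 by rewrite -expr2 real_normK ?num_real.
  have key : a * u + u * a - k * (u * u) <= e ^+ 2.
    rewrite /k -uu -ee; have := sqr_ge0 (`|e| - `|u|); move: au.
    rewrite (mulrC u a); nra.
  have -> : (a * u + u * a) * E + u * u * (- k * E) = (a * u + u * a - k * (u * u)) * E by ring.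
  have e20 := sqr_ge0 e.
  by rewrite (le_trans (ler_wpM2r E0 key))// ler_piMr.
have EL0 : 0 < expR (- k * L) by exact: expR_gt0.
rewrite /D -ler_pdivlMr// -expr2 => /le_trans; apply.
by rewrite -expRN mulNr opprK mulrA.
Qed.

Lemma lipschitz_sqr_clamp M x y : 0 <= M ->
  `|clamp (- M) M x ^+ 2 - clamp (- M) M y ^+ 2| <= 2 * M * `|x - y|.
Proof.
move=> M0; have MM : - M <= M by lra.
have := clamp_itv x MM; have := clamp_itv y MM => /andP[y1 y2] /andP[x1 x2].
have cl : `|clamp (- M) M x - clamp (- M) M y| <= `|x - y|.
  rewrite /clamp /Num.max /Num.min; repeat case: ifP => /=; move=> *; rewrite ler_norml;
  have := ler_norm (x - y); have := ler_norm (- (x - y)); rewrite normrN; lra.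
rewrite subr_sqr normrM mulrC ler_pM//.
by rewrite ler_norml; apply/andP; split; lra.
Qed.

(** Shooting: the Riccati equation is solved from [p 0 = 0] with its nonlinearity truncated, the
    end value is continuous in [nu] and changes sign, and a zero of it is a solution which the
    maximum principle keeps in the range where the truncation is inactive. *)
Lemma riccati_exists L q : 0 < L -> continuous q ->
  exists nu p, [/\ continuous p, p 0 = 0, p L = 0 &
    forall y, 0 < y < L -> is_derive y 1 p (nu - q y - p y ^+ 2)].
Proof.
move=> L0 cq.
have [Q Q0 HQ] := @continuous_bounded _ q 0 L cq.
(* Where |p| >= M the right-hand side is at most 2 Q - M^2 < 0, which no interior extremum allows. *)
pose M := 2 * Q + 1.
have M0 : 0 < M by rewrite /M; lra.
have MM : - M <= M by lra.
pose c := clamp (- M) M; pose g x := c x ^+ 2.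
have cc : continuous c by exact: continuous_clamp.
have cg : continuous g by move=> x; rewrite /g; under eq_fun do rewrite expr2; apply: cvgM; exact: cc.
have K0 : 0 < 2 * M by lra.
have lipg x y : `|g x - g y| <= 2 * M * `|x - y| by apply: lipschitz_sqr_clamp; lra.
have /choice[p Hp] := fun nu => @picard q g (2 * M) L nu K0 (ltW L0) cq cg lipg.
have pc nu : continuous (p nu) by have [] := Hp nu.
have p0 nu : p nu 0 = 0 by have [] := Hp nu.
have dp nu y : 0 <= y <= L -> is_derive y 1 (p nu) (nu - q y - g (p nu y)) by have [_ _] := Hp nu; exact.
have sub y : 0 < y < L -> 0 <= y <= L by move=> /andP[h1 h2]; rewrite !ltW.
have cpL : continuous (fun nu => p nu L).
  pose C := L * expR ((1 + 2 * (2 * M)) * L).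
  have C0 : 0 <= C by rewrite mulr_ge0 ?expR_ge0// ltW.
  have H nu nu' : (p nu L - p nu' L) ^+ 2 <= (nu - nu') ^+ 2 * C.
    apply: (@gronwall (p nu) (p nu') _ _ (nu - nu') (2 * M) L _ (ltW L0) (pc _) (pc _) _ (dp nu) (dp nu')).
    - lra.
    - by rewrite !p0.
    - move=> y yL; have -> : nu - q y - g (p nu y) - (nu' - q y - g (p nu' y)) =
        (nu - nu') - (g (p nu y) - g (p nu' y)) by ring.
      by rewrite (le_trans (ler_normB _ _))// lerD2l lipg.
  have H' nu nu' : `|p nu L - p nu' L| <= `|nu - nu'| * Num.sqrt C.
    rewrite -ler_sqr ?nnegrE ?mulr_ge0 ?sqrtr_ge0// exprMn sqr_sqrtr//.
    by rewrite !real_normK ?num_real.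
  move=> nu; apply/cvgrPdist_lt => e e0.
  have S0 : 0 < Num.sqrt C + 1 by rewrite ltr_wpDl ?sqrtr_ge0.
  have /cvgrPdist_lt/(_ _ (divr_gt0 e0 S0)) : (id : R -> R) x @[x --> nu] --> nu by exact: cvg_id.
  apply: filterS => nu' h; rewrite (le_lt_trans (H' _ _))//.
  apply: (@le_lt_trans _ _ (`|nu - nu'| * (Num.sqrt C + 1))).
    by rewrite ler_wpM2l// lerDl.
  by rewrite -ltr_pdivlMr.
(* For nu = -Q the right-hand side is nonpositive. *)
have pNQ : p (- Q) L <= 0.
  have := @derive_comparison R (p (- Q)) (cst 0) _ _ 0 L (ltW L0) (fun y yL => dp _ y (sub y yL))
    (fun y _ => der_cst 0 y) (continuous_itv (pc _)) (continuous_itv (@cst_continuous _ _ _)).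
  rewrite /cst p0 !subr0; apply => y yL.
  have := HQ y (sub _ yL); rewrite ler_norml => /andP[? ?].
  by have := sqr_ge0 (c (p (- Q) y)); rewrite /g; lra.
(* For nu = Q the integrating factor expR A, with A' = c (p Q), makes the product nondecreasing. *)
have pQ : 0 <= p Q L.
  pose A := prim (fun y => c (p Q y)).
  have cA : continuous (fun y => c (p Q y)).
    by move=> y; apply: (cvg_comp (p Q) c); [exact: pc|exact: cc].
  have dA y : is_derive y 1 A (c (p Q y)) by exact: is_derive_prim.
  pose V y := p Q y * expR (A y).
  have dV y : 0 < y < L -> is_derive y 1 V
     ((Q - q y - g (p Q y)) * expR (A y) + p Q y * (c (p Q y) * expR (A y))).
    by move=> yL; exact: (der_mul (dp _ y (sub y yL)) (der_expR (dA y))).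
  have cV : continuous V.
    move=> y; apply: cvgM; first exact: pc.
    apply: (cvg_comp A expR); last exact: continuous_expR.
    exact: (is_derive_continuous (dA y)).
  have := @derive_comparison R (cst 0) V _ _ 0 L (ltW L0)
    (fun y _ => der_cst 0 y) dV (continuous_itv (@cst_continuous _ _ _)) (continuous_itv cV).
  rewrite /cst /V p0 mul0r !subr0 pmulr_lge0 ?expR_gt0//; apply => y yL.
  have := HQ y (sub _ yL); rewrite ler_norml => /andP[? ?].
  set E := expR _; have E0 : 0 <= E by exact: expR_ge0.
  have -> : (Q - q y - g (p Q y)) * E + p Q y * (c (p Q y) * E) =
    (Q - q y - g (p Q y) + p Q y * c (p Q y)) * E by ring.
  apply: mulr_ge0 => //.
  suff : g (p Q y) <= p Q y * c (p Q y) by lra.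
  rewrite /g /c /clamp /Num.max /Num.min; repeat case: ifP => /=; move=> *; nra.
have [nu nuQ pnu] : exists2 nu, nu \in `[- Q, Q] & p nu L = 0.
  apply: IVT; [lra|exact: continuous_itv|].
  by rewrite ge_min le_max pNQ pQ orbT.
have {}nuQ : `|nu| <= Q by rewrite ler_norml; move: nuQ; rewrite in_itv.
have gM x : M <= `|x| -> g x = M ^+ 2.
  rewrite ler_normr /g /c /clamp => /orP[h|h].
    by rewrite (min_idPl h) (max_idPr MM).
  have h1 : x <= M by lra.
  by rewrite (min_idPr h1) (max_idPl _) ?sqrrN//; lra.
have neg y : 0 < y < L -> M <= `|p nu y| -> nu - q y - g (p nu y) < 0.
  move=> yL /gM ->; have := HQ y (sub _ yL); move: nuQ; rewrite !ler_norml => /andP[? ?] /andP[? ?].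
  by rewrite /M; nra.
have in0L y : y \in `]0, L[ -> 0 < y < L by rewrite in_itv.
have dpn y : y \in `]0, L[ -> derivable (p nu) y 1 by move=> /in0L/sub/(dp nu)[].
have inter y : y \in `[0, L] -> p nu y != 0 -> 0 < y < L.
  rewrite in_itv/= => /andP[h1 h2] h; rewrite !lt_neqAle h1 h2 !andbT.
  by apply/andP; split; apply: contraNneq h => hc; [rewrite -hc p0|rewrite hc pnu].
have pb y : 0 <= y <= L -> `|p nu y| <= M.
  have [c1 c1L Hc1] := EVT_max (ltW L0) (continuous_itv (pc nu)).
  have [c2 c2L Hc2] := EVT_min (ltW L0) (continuous_itv (pc nu)).
  move=> yL; rewrite ler_norml; apply/andP; split.
    apply: (@le_trans _ _ (p nu c2)); last by apply: Hc2; rewrite in_itv.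
    rewrite leNgt; apply/negP => hM.
    have c2oo : 0 < c2 < L by apply: inter => //; rewrite lt_eqF//; lra.
    have := @derive1_at_min R (p nu) 0 L c2 (ltW L0) dpn.
    rewrite in_itv/= => /(_ c2oo) H.
    have {}H := H (fun t tL => Hc2 t (subset_itv_oo_cc tL)).
    have [_ e1] := H; have [_ e2] := dp nu c2 (sub _ c2oo).
    suff : M <= `|p nu c2| by move=> /(neg c2 c2oo); rewrite -e2 e1 ltxx.
    by rewrite ler_normr; apply/orP; right; lra.
  apply: (@le_trans _ _ (p nu c1)); first by apply: Hc1; rewrite in_itv.
  rewrite leNgt; apply/negP => hM.
  have c1oo : 0 < c1 < L by apply: inter => //; rewrite gt_eqF//; lra.
  have := @derive1_at_max R (p nu) 0 L c1 (ltW L0) dpn.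
  rewrite in_itv/= => /(_ c1oo) H.
  have {}H := H (fun t tL => Hc1 t (subset_itv_oo_cc tL)).
  have [_ e1] := H; have [_ e2] := dp nu c1 (sub _ c1oo).
  suff : M <= `|p nu c1| by move=> /(neg c1 c1oo); rewrite -e2 e1 ltxx.
  by rewrite ler_normr; apply/orP; left; lra.
exists nu, (p nu); split => // y yL.
have := dp nu y (sub _ yL); rewrite /g /c clamp_id//.
by rewrite -ler_norml; exact: pb (sub _ yL).
Qed.

(** The exponential of a primitive of the Riccati solution is an eigenfunction, so the set from
    which the principal eigenvalue is chosen is not empty. *)
Lemma principal_eigenvalueP L b delta lambda : 0 < L -> continuous b ->
  exists phi, positive_eigenfunction L b delta lambda
    (principal_eigenvalue L b delta lambda) phi.
Proof.
move=> L0 cb; rewrite /principal_eigenvalue; case: xgetP => // H.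
exfalso.
have cq : continuous (fun y => lambda * delta * b y).
  by move=> y; apply: cvgM; [exact: cvg_cst|exact: cb].
have [nu [p [cp p0 pL dp]]] := riccati_exists L0 cq.
apply: (H (lambda ^+ 2 + 1 + nu)).
pose phi y := expR (prim p y).
have dphi y : is_derive y 1 phi (p y * phi y).
  by apply: der_expR; exact: is_derive_prim.
have phi1 : derive1 phi = (fun y => p y * phi y).
  by apply/funext => y; rewrite derive1E; have [_ ->] := dphi y.
have cphi : continuous phi by exact: continuous_derive dphi.
have cphi1 : continuous (fun y => p y * phi y).
  by move=> y; apply: cvgM; [exact: cp|exact: cphi].
exists phi; split.
- exact: continuous_itv.
- by move=> y _; exact: expR_gt0.
- move=> y yL; have dphi1 := der_mul (dp _ yL) (dphi y).
  rewrite derive1nS derive1n1 phi1; split.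
  + by case: (dphi y).
  + by case: dphi1.
  + rewrite derive1E; have [_ ->] := dphi1; rewrite derive1_kpp_reaction0; ring.
- rewrite phi1 -[X in _ --> X](mul0r (phi 0)) -[X in X * _]p0.
  by apply: cvg_at_right_filter; exact: cphi1.
- rewrite phi1 -[X in _ --> X](mul0r (phi L)) -[X in X * _]pL.
  by apply: cvg_at_left_filter; exact: cphi1.
Qed.

End Existence.

(** * Expansion of the front speed for a given shear *)

Section Speed.
Context {R : realType}.
Implicit Types (b : R -> R) (x y L delta lambda beta e : R).

Lemma kpp_c0E : @kpp_c0 R = 2.
Proof. by rewrite /kpp_c0 derive1_kpp_reaction0 sqrtr1 mulr1. Qed.

Definition mean L b : R := prim b L / L.
(** The logarithmic derivative of the eigenfunction to first order in [lambda * delta]: it solves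
    [p' = mean b - b] and vanishes at both ends. *)
Definition fluct L b y : R := mean L b * y - prim b y.

(** The second order coefficient of the eigenvalue. *)
Definition kappa L b : R := mean L (fun y => fluct L b y ^+ 2).

Section Bounds.
Variables (L beta : R) (b : R -> R).
Hypotheses (L0 : 0 < L) (cb : continuous b).
Hypothesis bbeta : forall y, 0 <= y <= L -> `|b y| <= beta.

Lemma beta_ge0 : 0 <= beta.
Proof. by apply: (le_trans (normr_ge0 (b 0))); rewrite bbeta// lexx ltW. Qed.

Lemma subitv y : 0 < y < L -> 0 <= y <= L.
Proof. by move=> /andP[h1 h2]; rewrite !ltW. Qed.

Lemma norm_prim_le f B y : continuous f -> (forall y, 0 <= y <= L -> `|f y| <= B) ->
  0 <= y <= L -> `|prim f y| <= B * y.
Proof.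
move=> cf fB /andP[y0 yL].
have := @norm_derive_comparison R (prim f) (fun y => B * y) f (fun=> B) 0 y y0
  (fun x _ => is_derive_prim x cf) (fun x _ => der_lin B x)
  (continuous_itv (continuous_prim cf)) (continuous_itv (continuous_derive (der_lin B))).
rewrite prim0// mulr0 !subr0; apply => x /andP[x0 xy]; apply: fB.
by rewrite ltW//= ltW// (lt_le_trans xy).
Qed.

Lemma mean_le f B : continuous f -> (forall y, 0 <= y <= L -> `|f y| <= B) ->
  `|mean L f| <= B.
Proof.
move=> cf fB; rewrite /mean normrM normfV (gtr0_norm L0) ler_pdivrMr//.
by apply: norm_prim_le => //; rewrite lexx ltW.
Qed.

Lemma is_derive_fluct y : is_derive y 1 (fluct L b) (mean L b - b y).
Proof. by apply: der_sub; [exact: der_lin|exact: is_derive_prim]. Qed.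

Lemma continuous_fluct : continuous (fluct L b).
Proof. exact: (continuous_derive is_derive_fluct). Qed.

Lemma fluct0 : fluct L b 0 = 0.
Proof. by rewrite /fluct mulr0 prim0// subr0. Qed.

Lemma fluctL : fluct L b L = 0.
Proof. by rewrite /fluct /mean divfK ?subrr// gt_eqF. Qed.

Lemma fluct_le y : 0 <= y <= L -> `|fluct L b y| <= 2 * beta * L.
Proof.
move=> yL; rewrite (le_trans (ler_normB _ _))//.
have h1 := norm_prim_le cb bbeta yL; have h2 := mean_le cb bbeta.
case/andP: yL => y0 yL; have b0 := beta_ge0.
have : `|mean L b * y| <= beta * y by rewrite normrM (ger0_norm y0) ler_wpM2r.
nra.
Qed.

Lemma continuous_fluct2 : continuous (fun y => fluct L b y ^+ 2).
Proof.
move=> y; under eq_fun do rewrite expr2.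
by apply: cvgM; exact: continuous_fluct.
Qed.

Lemma fluct2_le y : 0 <= y <= L -> `|fluct L b y ^+ 2| <= 4 * beta ^+ 2 * L ^+ 2.
Proof.
move=> /fluct_le h; rewrite normrX.
have -> : 4 * beta ^+ 2 * L ^+ 2 = (2 * beta * L) ^+ 2 by ring.
by rewrite lerXn2r ?nnegrE// !mulr_ge0// ?beta_ge0// ltW.
Qed.

Lemma kappa_ge0 : 0 <= kappa L b.
Proof.
rewrite /kappa /mean divr_ge0 ?(ltW L0)//.
rewrite -(@Rintegral_prim _ _ L (ltW L0) continuous_fluct2).
by apply: Rintegral_ge0 => x _; exact: sqr_ge0.
Qed.

Lemma kappa_le : kappa L b <= 4 * beta ^+ 2 * L ^+ 2.
Proof. by apply: ler_normlW; apply: mean_le continuous_fluct2 fluct2_le. Qed.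

(** The second order correction of the logarithmic derivative: it solves [p' = kappa - fluct ^ 2],
    where the constant [kappa] makes it vanish at [L]. *)
Definition corrector2 : R -> R := prim (fun y => kappa L b - fluct L b y ^+ 2).

Lemma continuous_corrector2' : continuous (fun y => kappa L b - fluct L b y ^+ 2).
Proof. by move=> y; apply: cvgB; [exact: cvg_cst|exact: continuous_fluct2]. Qed.

Lemma is_derive_corrector2 y : is_derive y 1 corrector2 (kappa L b - fluct L b y ^+ 2).
Proof. exact: is_derive_prim continuous_corrector2'. Qed.

Lemma corrector2_0 : corrector2 0 = 0.
Proof. exact: prim0 continuous_corrector2'. Qed.

Lemma corrector2_L : corrector2 L = 0.
Proof.
have h y : is_derive y 1 (fun y => kappa L b * y - prim (fun y => fluct L b y ^+ 2) y)
   (kappa L b - fluct L b y ^+ 2).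
  by apply: der_sub; [exact: der_lin|exact: is_derive_prim continuous_fluct2].
rewrite /corrector2 (@prim_unique _ _ (fun y => kappa L b * y - prim (fun y => fluct L b y ^+ 2) y)).
- by rewrite /kappa /mean divfK ?subrr// gt_eqF.
- exact: ltW.
- by rewrite mulr0 prim0 ?subr0//; exact: continuous_fluct2.
- exact: continuous_corrector2'.
- exact: continuous_itv (continuous_derive h).
Qed.

Lemma corrector2_le y : 0 <= y <= L -> `|corrector2 y| <= 4 * beta ^+ 2 * L ^+ 3.
Proof.
move=> yL; have b20 : 0 <= 4 * beta ^+ 2 * L ^+ 2 by rewrite !mulr_ge0// ?beta_ge0// ltW.
apply: (le_trans (norm_prim_le continuous_corrector2' (B := 4 * beta ^+ 2 * L ^+ 2) _ yL)).
  move=> z zL; have := fluct2_le zL; rewrite (ger0_norm (sqr_ge0 _)) => h.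
  have h1 := kappa_ge0; have h2 := kappa_le; have h3 := sqr_ge0 (fluct L b z).
  by rewrite ler_norml; apply/andP; split; lra.
rewrite (exprSr L 2) mulrA ler_wpM2l//; by case/andP: yL.
Qed.

Variables (delta lambda : R).
Hypotheses (delta0 : 0 <= delta) (lambda0 : 0 < lambda).
Local Notation mu := (principal_eigenvalue L b delta lambda).
Local Notation s := (lambda * delta).

Lemma eigenvalue_ge_mean : lambda ^+ 2 + 1 + s * mean L b <= mu.
Proof.
have [phi Hphi] := principal_eigenvalueP delta lambda L0 cb.
apply: (eigenvalue_ge_sub (p := fun y => s * fluct L b y)
  (d := fun y => s * (mean L b - b y)) L0 Hphi).
- by move=> y; apply: cvgM; [exact: cvg_cst|exact: continuous_fluct].
- by rewrite fluct0 mulr0.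
- by rewrite fluctL mulr0.
- by move=> y _; apply: der_scal; exact: is_derive_fluct.
- by move=> y _; have := sqr_ge0 (s * fluct L b y); nra.
Qed.

Lemma eigenvalue_le_max : mu <= lambda ^+ 2 + 1 + s * beta.
Proof.
have [phi Hphi] := principal_eigenvalueP delta lambda L0 cb.
apply: (eigenvalue_le_super (p := fun=> 0) (d := fun=> 0) L0 Hphi) => //.
- exact: cst_continuous.
- move=> y yL; rewrite expr0n /= !add0r ler_wpM2l ?mulr_ge0 ?(ltW lambda0)//.
  exact: ler_normlW (bbeta (subitv yL)).
Qed.

Let p y := s * fluct L b y + s ^+ 2 * corrector2 y.
Let d y := s * (mean L b - b y) + s ^+ 2 * (kappa L b - fluct L b y ^+ 2).

Let dp y : is_derive y 1 p (d y).
Proof. by apply: der_add; apply: der_scal; [exact: is_derive_fluct|exact: is_derive_corrector2]. Qed.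

Let pE y : d y + p y ^+ 2 + s * b y = s * mean L b + s ^+ 2 * kappa L b
  + 2 * s ^+ 3 * (fluct L b y * corrector2 y) + s ^+ 4 * corrector2 y ^+ 2.
Proof. by rewrite /d /p; ring. Qed.

Let fs_le y : 0 <= y <= L -> `|fluct L b y * corrector2 y| <= 8 * beta ^+ 3 * L ^+ 4.
Proof.
move=> yL; rewrite normrM.
have -> : 8 * beta ^+ 3 * L ^+ 4 = (2 * beta * L) * (4 * beta ^+ 2 * L ^+ 3) by ring.
by rewrite ler_pM// ?fluct_le// corrector2_le.
Qed.

Lemma eigenvalue_ge_second :
  lambda ^+ 2 + 1 + (s * mean L b + s ^+ 2 * kappa L b - 16 * s ^+ 3 * beta ^+ 3 * L ^+ 4) <= mu.
Proof.
have [phi Hphi] := principal_eigenvalueP delta lambda L0 cb.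
apply: (eigenvalue_ge_sub (p := p) (d := d) L0 Hphi).
- exact: continuous_derive dp.
- by rewrite /p fluct0 corrector2_0 !mulr0 addr0.
- by rewrite /p fluctL corrector2_L !mulr0 addr0.
- by move=> y _; exact: dp.
- move=> y yL; rewrite pE; have := fs_le (subitv yL); rewrite ler_norml => /andP[h _].
  have s3 : 0 <= s ^+ 3 by rewrite exprn_ge0// mulr_ge0// ltW.
  have h4 : 0 <= s ^+ 4 * corrector2 y ^+ 2 by rewrite mulr_ge0 ?sqr_ge0// exprn_ge0// mulr_ge0// ltW.
  have := ler_wpM2l s3 h; lra.
Qed.

Lemma eigenvalue_le_second :
  mu <= lambda ^+ 2 + 1 + (s * mean L b + s ^+ 2 * kappa L b + 16 * s ^+ 3 * beta ^+ 3 * L ^+ 4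
     + 16 * s ^+ 4 * beta ^+ 4 * L ^+ 6).
Proof.
have [phi Hphi] := principal_eigenvalueP delta lambda L0 cb.
apply: (eigenvalue_le_super (p := p) (d := d) L0 Hphi).
- exact: continuous_derive dp.
- by rewrite /p fluct0 corrector2_0 !mulr0 addr0.
- by rewrite /p fluctL corrector2_L !mulr0 addr0.
- by move=> y _; exact: dp.
- move=> y yL; rewrite pE; have := fs_le (subitv yL); rewrite ler_norml => /andP[_ h].
  have s3 : 0 <= s ^+ 3 by rewrite exprn_ge0// mulr_ge0// ltW.
  have s4 : 0 <= s ^+ 4 by rewrite exprn_ge0// mulr_ge0// ltW.
  have h2 : corrector2 y ^+ 2 <= 16 * beta ^+ 4 * L ^+ 6.
    have -> : 16 * beta ^+ 4 * L ^+ 6 = (4 * beta ^+ 2 * L ^+ 3) ^+ 2 by ring.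
    rewrite -[corrector2 y ^+ 2]real_normK ?num_real// lerXn2r ?nnegrE//; last exact/corrector2_le/subitv.
    have b2 := sqr_ge0 beta; have L3 : 0 <= L ^+ 3 by rewrite exprn_ge0// ltW.
    by have := mulr_ge0 b2 L3; lra.
  have := ler_wpM2l s3 h; have := ler_wpM2l s4 h2; lra.
Qed.

End Bounds.

Section SpeedBounds.
Variables (L beta : R) (b : R -> R) (delta : R).
Hypotheses (L0 : 0 < L) (cb : continuous b).
Hypothesis bbeta : forall y, 0 <= y <= L -> `|b y| <= beta.
Hypothesis delta0 : 0 <= delta.
Local Notation c := (kpp_speed L b delta).
Local Notation mu := (principal_eigenvalue L b delta).

Lemma ge2_addV lambda : 0 < lambda -> 2 <= lambda + lambda^-1.
Proof.
move=> l0; rewrite -subr_ge0.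
have -> : lambda + lambda^-1 - 2 = (lambda - 1) ^+ 2 / lambda by field; rewrite gt_eqF.
by rewrite divr_ge0 ?sqr_ge0// ltW.
Qed.

(** The eigenvalue is at least its first order expansion, because the neglected term is a square. *)
Lemma speed_ratio_ge lambda : 0 < lambda -> lambda + lambda^-1 + delta * mean L b <= mu lambda / lambda.
Proof.
move=> l0; rewrite ler_pdivlMr//.
have := @eigenvalue_ge_mean L b L0 cb delta lambda; apply: le_trans.
by rewrite !mulrDl mulVf ?gt_eqF// expr2; lra.
Qed.

Lemma speed_le lambda : 0 < lambda -> c <= mu lambda / lambda.
Proof.
move=> l0; apply: ge_inf; last by exists lambda.
exists (2 + delta * mean L b) => _ [l /= l1 <-].
by apply: le_trans (speed_ratio_ge l1); rewrite lerD2r ge2_addV.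
Qed.

Lemma speed_ge r : (forall lambda, 0 < lambda -> r <= mu lambda / lambda) -> r <= c.
Proof.
move=> h; apply: lb_le_inf; first by exists (mu 1 / 1), 1 => //=; exact: ltr01.
by move=> _ [l /= l1 <-]; exact: h.
Qed.

Lemma speed_ge_mean : 2 + delta * mean L b <= c.
Proof. by apply: speed_ge => l l0; apply: le_trans (speed_ratio_ge l0); rewrite lerD2r ge2_addV. Qed.

Lemma speed_le_max : c <= 2 + delta * beta.
Proof.
apply: (le_trans (speed_le ltr01)); rewrite divr1.
have := @eigenvalue_le_max L beta b L0 cb bbeta delta 1 delta0 ltr01.
rewrite expr1n mul1r; lra.
Qed.

Lemma speed_dist2 : `|c - 2| <= delta * beta.
Proof.
have := speed_ge_mean; have := speed_le_max; have := mean_le L0 cb bbeta.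
rewrite !ler_norml => /andP[h1 h2] h3 h4.
by have := ler_wpM2l delta0 h1; rewrite mulrN => h5; apply/andP; split; lra.
Qed.

Definition speed_const : R := 32 * L ^+ 2 + 16 * L ^+ 3 + 64 * L ^+ 4 + 4 * L ^+ 5.

(** The infimum over [lambda] of [lambda + 1 / lambda + delta * mean b + lambda * delta ^ 2 * kappa]
    is attained near 1, where it is [2 + delta * mean b + delta ^ 2 * kappa] to second order. *)
Lemma speed_expansion :
  `|c - (2 + delta * mean L b + delta ^+ 2 * kappa L b)| <= speed_const * (delta * beta) ^+ 3.
Proof.
have b0 := beta_ge0 L0 bbeta.
pose t := delta * beta.
have t0 : 0 <= t by rewrite mulr_ge0.
have t3 : 0 <= t ^+ 3 by rewrite exprn_ge0.
have k0 := kappa_ge0 L0 cb.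
pose x := delta ^+ 2 * kappa L b.
have x0 : 0 <= x by rewrite mulr_ge0 ?sqr_ge0.
have xt : x <= 4 * t ^+ 2 * L ^+ 2.
  have -> : 4 * t ^+ 2 * L ^+ 2 = delta ^+ 2 * (4 * beta ^+ 2 * L ^+ 2) by rewrite /t; ring.
  by rewrite ler_wpM2l ?sqr_ge0// kappa_le.
have L2 : 0 <= L ^+ 2 by rewrite exprn_ge0// ltW.
have L3 : 0 <= L ^+ 3 by rewrite exprn_ge0// ltW.
have L4 : 0 <= L ^+ 4 by rewrite exprn_ge0// ltW.
have L5 : 0 <= L ^+ 5 by rewrite exprn_ge0// ltW.
have t3L2 := mulr_ge0 t3 L2; have t3L3 := mulr_ge0 t3 L3.
have t3L4 := mulr_ge0 t3 L4; have t3L5 := mulr_ge0 t3 L5.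
have cE : speed_const * (delta * beta) ^+ 3 =
   32 * (t ^+ 3 * L ^+ 2) + 16 * (t ^+ 3 * L ^+ 3) + 64 * (t ^+ 3 * L ^+ 4) + 4 * (t ^+ 3 * L ^+ 5).
  by rewrite /speed_const -/t; ring.
rewrite cE -/x.
(* If 4 t L > 1, the crude bounds on c and kappa are already of third order in t; otherwise the
   remainders of fourth order are, and x <= 1/2. *)
have [small|large] := leP (4 * t * L) 1; last first.
  have h1 := speed_ge_mean; have h2 := speed_le_max.
  have h3 : - beta <= mean L b by have := mean_le L0 cb bbeta; rewrite ler_norml => /andP[].
  have h4 : - t <= delta * mean L b by rewrite /t -mulrN ler_wpM2l.
  have tt : 2 * t <= 32 * (t ^+ 3 * L ^+ 2).
    have -> : 32 * (t ^+ 3 * L ^+ 2) = (2 * t) * (4 * t * L) ^+ 2 by ring.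
    by rewrite ler_peMr ?mulr_ge0// exprn_ege1// ltW.
  have xx : 4 * t ^+ 2 * L ^+ 2 <= 16 * (t ^+ 3 * L ^+ 3).
    have -> : 16 * (t ^+ 3 * L ^+ 3) = (4 * t ^+ 2 * L ^+ 2) * (4 * t * L) by ring.
    by rewrite ler_peMr ?mulr_ge0 ?sqr_ge0// ltW.
  rewrite -/t in h2; rewrite ler_norml; apply/andP; split; lra.
have t4 : 16 * (t ^+ 4 * L ^+ 6) <= 4 * (t ^+ 3 * L ^+ 5).
  have -> : 16 * (t ^+ 4 * L ^+ 6) = 4 * (t ^+ 3 * L ^+ 5) * (4 * t * L) by ring.
  by rewrite ler_piMr// mulr_ge0.
have x2 : x ^+ 2 / 2 <= 2 * (t ^+ 3 * L ^+ 3).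
  apply: (@le_trans _ _ (8 * (t ^+ 4 * L ^+ 4))).
    have -> : 8 * (t ^+ 4 * L ^+ 4) = (4 * t ^+ 2 * L ^+ 2) ^+ 2 / 2 by field.
    by have := mulr_ge0 (sqr_ge0 t) L2 => h0; rewrite ler_pM2r// lerXn2r ?nnegrE//; lra.
  have -> : 8 * (t ^+ 4 * L ^+ 4) = 2 * (t ^+ 3 * L ^+ 3) * (4 * t * L) by ring.
  by rewrite ler_piMr// mulr_ge0.
have x12 : x <= 1 / 2.
  apply: (le_trans xt); have -> : 4 * t ^+ 2 * L ^+ 2 = (4 * t * L) ^+ 2 / 4 by field.
  have : (4 * t * L) ^+ 2 <= 1 by rewrite expr_le1// !mulr_ge0// ltW.
  lra.
rewrite ler_norml; apply/andP; split; last first.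
  have := speed_le ltr01; rewrite divr1.
  have := @eigenvalue_le_second L beta b L0 cb bbeta delta 1 delta0 ltr01.
  rewrite expr1n mul1r -/x.
  have -> : 16 * delta ^+ 3 * beta ^+ 3 * L ^+ 4 = 16 * (t ^+ 3 * L ^+ 4) by rewrite /t; ring.
  have -> : 16 * delta ^+ 4 * beta ^+ 4 * L ^+ 6 = 16 * (t ^+ 4 * L ^+ 6) by rewrite /t; ring.
  lra.
suff : 2 + delta * mean L b + x - 2 * (t ^+ 3 * L ^+ 3) - 64 * (t ^+ 3 * L ^+ 4) <= c by lra.
apply: speed_ge => l l0.
(* The remainder grows with l, but for l > 2 already l + 1/l >= 5/2. *)
have [l2|l2] := leP l 2; last first.
  have := speed_ratio_ge l0.
  have : 5 / 2 <= l + l^-1.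
    rewrite -subr_ge0.
    have -> : l + l^-1 - 5 / 2 = (l - 2) * (l - 1 / 2) / l by field; rewrite gt_eqF.
    by rewrite divr_ge0 ?mulr_ge0//; lra.
  lra.
rewrite ler_pdivlMr//.
have := @eigenvalue_ge_second L beta b L0 cb bbeta delta l delta0 l0.
apply: le_trans.
have -> : 16 * (l * delta) ^+ 3 * beta ^+ 3 * L ^+ 4 = 16 * l ^+ 3 * (t ^+ 3 * L ^+ 4).
  by rewrite /t; ring.
have -> : (l * delta) ^+ 2 * kappa L b = l ^+ 2 * x by rewrite /x; ring.
have l3 : l ^+ 3 * (t ^+ 3 * L ^+ 4) <= l * 4 * (t ^+ 3 * L ^+ 4).
  rewrite ler_wpM2r// exprS ler_pM2l//.
  by have -> : 4 = 2 ^+ 2 :> R by [ring]; rewrite lerXn2r ?nnegrE// ltW.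
(* After division by l this is l + 1/l + l x >= 2 + x - l x^2 / 4. *)
have q : 0 <= (l - 1 + l * x / 2) ^+ 2 := sqr_ge0 _.
have lx : l ^+ 2 * x ^+ 2 <= 2 * l * x ^+ 2.
  by rewrite ler_wpM2r ?sqr_ge0// expr2 ler_pM2r.
have lx2 := ler_wpM2l (ltW l0) x2.
nra.
Qed.

End SpeedBounds.

(** A change of the shear by [e] moves each eigenvalue by at most [lambda * delta * e], hence each
    ratio by [delta * e]. *)
Lemma speed_lipschitz L b1 b2 delta e : 0 < L -> continuous b1 -> continuous b2 ->
  0 <= delta -> (forall y, 0 <= y <= L -> `|b1 y - b2 y| <= e) ->
  `|kpp_speed L b1 delta - kpp_speed L b2 delta| <= delta * e.
Proof.
move=> L0; wlog suff H : b1 b2 / continuous b1 -> continuous b2 ->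
  0 <= delta -> (forall y, 0 <= y <= L -> `|b1 y - b2 y| <= e) ->
  kpp_speed L b1 delta - kpp_speed L b2 delta <= delta * e.
  move=> c1 c2 d0 b12; rewrite ler_norml lerNl opprB; apply/andP; split; apply: H => //.
  by move=> y yL; rewrite distrC; exact: b12.
move=> c1 c2 d0 b12.
rewrite lerBlDr addrC -lerBlDr; apply: (speed_ge) => // l l0.
rewrite lerBlDr; apply: (le_trans (speed_le delta L0 c1 l0)).
have [phi1 H1] := principal_eigenvalueP delta l L0 c1.
have [phi2 H2] := principal_eigenvalueP delta l L0 c2.
rewrite ler_pdivrMr// mulrDl divfK ?gt_eqF//.
apply: (eigenvalue_perturb L0 H1 H2) => y yL.
have -> : delta * e * l = l * delta * e by ring.
by rewrite ler_wpM2l ?mulr_ge0 ?(ltW l0)// (le_trans (ler_norm _))// b12// (subitv yL).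
Qed.

(** The eigenvalue problem only sees the shear on the open interval, so changing the paths
    outside it is harmless. *)
Lemma eq_kpp_speed L b1 b2 delta : (forall y, 0 < y < L -> b1 y = b2 y) ->
  kpp_speed L b1 delta = kpp_speed L b2 delta.
Proof.
move=> b12; rewrite /kpp_speed; congr (inf (_ @` _)).
apply/funext => lambda; congr (_ / _); rewrite /principal_eigenvalue; congr (xget _ _).
apply/seteqP; split => m [phi [h1 h2 h3 h4 h5]]; exists phi; split => // y yL;
  have [H1 H2 H3] := h3 y yL; split => //.
  by rewrite -b12.
by rewrite b12.
Qed.

End Speed.

(** * Measurability of path functionals *)

Section UniformContinuity.
Context {R : realType}.

Lemma uniform_continuity (b : R -> R) (A B e : R) : continuous b -> 0 < e ->
  exists2 r : R, 0 < r & forall x y : R, A <= x <= B -> `|x - y| < r -> `|b x - b y| < e.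
Proof.
move=> cb e0.
pose P (r x : R) := forall y, `|x - y| < r -> `|b x - b y| < e.
have /compact_near_coveringP/(_ R (0^'+) P) := @segment_compact R A B.
move=> H.
have [r [Hr r0]] : exists r : R, (`[A, B] `<=` P r) /\ 0 < r; last first.
  by exists r => // x y xAB xy; apply: Hr => //=; rewrite in_itv.
apply: (@filter_ex _ (0^'+)); apply: filterI; last exact: nbhs_right_gt.
apply: H => x _.
have e2 : 0 < e / 2 by rewrite divr_gt0.
have /cvgrPdist_lt/(_ _ e2) [eta /= eta0 Heta] := cb x.
have eta2 : 0 < eta / 2 by rewrite divr_gt0.
exists (ball x (eta / 2), [set r | r < eta / 2]) => /=.
  by split; [exact: nbhsx_ballx|exact: nbhs_right_lt].
move=> [x' r] /= [+ rlt] y xy; rewrite -ball_normE /= => xx'.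
have h1 : `|b x - b x'| < e / 2 by apply: Heta => /=; lra.
have h2 : `|b x - b y| < e / 2.
  by apply: Heta => /=; apply: (le_lt_trans (ler_distD x' _ _)); lra.
by rewrite (le_lt_trans (ler_distD (b x) _ _))// (splitr e) ltrD// distrC.
Qed.

End UniformContinuity.

Section Interpolation.
Context {R : realType}.
Variable L : R.
Hypothesis L0 : 0 < L.
Implicit Types (b : R -> R) (y : R).

Definition hat (N k : nat) y : R := Num.max 0 (1 - `|y * N%:R / L - k%:R|).

(** The hats are normalised by their sum, so that the interpolant is a weighted mean of the coded
    values. *)
Definition interp (N : nat) (c : {ffun 'I_N.+1 -> int}) y : R :=
  (\sum_(k < N.+1) (c k)%:~R / N%:R * hat N k (clamp 0 L y)) /
  \sum_(k < N.+1) hat N k (clamp 0 L y).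

(** Rounding the sampled values down to multiples of [1 / N] leaves countably many interpolants,
    which is what makes every functional of them measurable. *)
Definition code (N : nat) b : {ffun 'I_N.+1 -> int} :=
  [ffun k : 'I_N.+1 => Num.floor (N%:R * b (k%:R * L / N%:R))].

Lemma hat_ge0 N k y : 0 <= hat N k y.
Proof. by rewrite /hat le_max lexx. Qed.

Lemma continuous_hat N k : continuous (hat N k).
Proof.
move=> y; apply: (@continuous_max _ _ (cst 0) (fun y : R => 1 - `|y * N%:R / L - k%:R|)).
  exact: cvg_cst.
apply: cvgB; first exact: cvg_cst.
apply: cvg_norm; apply: cvgB; last exact: cvg_cst.
by apply: cvgM; last exact: cvg_cst; apply: cvgM; [exact: cvg_id|exact: cvg_cst].
Qed.

Lemma sum_hat_gt0 N y : 0 <= y <= L -> 0 < \sum_(k < N.+1) hat N k y.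
Proof.
move=> /andP[y0 yL].
pose z := y * N%:R / L.
have z0 : 0 <= z by rewrite divr_ge0 ?mulr_ge0// ltW.
have zN : z <= N%:R by rewrite /z ler_pdivrMr// mulrC ler_wpM2l.
have kN : (Num.truncn z < N.+1)%N.
  by rewrite ltnS truncn_le_nat (le_lt_trans zN)// ltr_nat.
rewrite (bigD1 (Ordinal kN))//= ltr_wpDr//; first by rewrite sumr_ge0// => k _; exact: hat_ge0.
rewrite /hat lt_max; apply/orP; right; rewrite subr_gt0.
have /andP[h1 h2] := truncn_itv z0.
by rewrite -/z ger0_norm; [rewrite ltrBlDr -natr1 addrC in h2 *|]; lra.
Qed.

Lemma continuous_interp N c : continuous (@interp N c).
Proof.
have ch k : continuous (fun y => hat N k (clamp 0 L y)).
  move=> y; apply: (cvg_comp (clamp 0 L) (hat N k)); [exact: continuous_clamp|exact: continuous_hat].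
move=> y; apply: cvgM.
  by apply: (cvg_big add_continuous) => k _; apply: cvgM; [exact: cvg_cst|exact: ch].
apply: cvgV; last by apply: (cvg_big add_continuous) => k _; exact: ch.
by rewrite gt_eqF// sum_hat_gt0// clamp_itv// ltW.
Qed.

Lemma interp_approx N b (e y : R) : (0 < N)%N -> 0 <= e -> 0 <= y <= L ->
  (forall z, `|y - z| < L / N%:R -> `|b y - b z| <= e) ->
  `|interp (code N b) y - b y| <= e + N%:R^-1.
Proof.
move=> N0 e0 yL hb; rewrite /interp clamp_id//.
have NR : 0 < N%:R :> R by rewrite ltr0n.
set S := \sum_(k < N.+1) hat N k y; have S0 : 0 < S by exact: sum_hat_gt0.
have -> : b y = (\sum_(k < N.+1) b y * hat N k y) / S.
  by rewrite -mulr_sumr mulfK// gt_eqF.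
rewrite -mulrBl -sumrB normrM normfV (gtr0_norm S0) ler_pdivrMr//.
rewrite mulr_sumr (le_trans (ler_norm_sum _ _ _))//; apply: ler_sum => k _.
rewrite -mulrBl normrM (ger0_norm (hat_ge0 _ _ _)).
have [->|h0] := eqVneq (hat N k y) 0; first by rewrite !mulr0.
rewrite ler_wpM2r ?hat_ge0//.
have hk : `|y - k%:R * L / N%:R| < L / N%:R.
  have : 0 < hat N k y by rewrite lt_neqAle eq_sym h0 hat_ge0.
  rewrite /hat lt_max ltxx/= subr_gt0.
  have -> : y * N%:R / L - k%:R = (y - k%:R * L / N%:R) * (N%:R / L) by field; rewrite !gt_eqF.
  rewrite normrM [`|N%:R / L|]gtr0_norm ?divr_gt0// => h.
  have -> : L / N%:R = (N%:R / L)^-1 by rewrite invf_div.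
  by rewrite -[ltRHS]mul1r ltr_pdivlMr ?divr_gt0.
rewrite (le_trans (ler_distD (b (k%:R * L / N%:R)) _ _))// addrC.
apply: lerD; first by rewrite distrC; exact: hb.
rewrite /code ffunE; set z := b _.
have /andP[h1 h2] := floor_itv (N%:R * z).
rewrite intrD in h2.
have -> : (Num.floor (N%:R * z))%:~R / N%:R - z = ((Num.floor (N%:R * z))%:~R - N%:R * z) / N%:R.
  by rewrite mulrBl mulrAC divff ?mul1r// gt_eqF.
rewrite normrM normfV (gtr0_norm NR) -[leRHS]mul1r ler_pM2r ?invr_gt0//.
by rewrite ler_norml; apply/andP; split; lra.
Qed.

Lemma interp_cvg b (e : R) : continuous b -> 0 < e ->
  \forall N \near \oo, forall y, 0 <= y <= L -> `|interp (code N b) y - b y| <= e.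
Proof.
move=> cb e0; have e2 : 0 < e / 2 by rewrite divr_gt0.
have [r r0 Hr] := uniform_continuity 0 L cb e2.
near=> N.
have N0 : (0 < N)%N by near: N; exact: nbhs_infty_gt.
have NR : 0 < N%:R :> R by rewrite ltr0n.
move=> y yL; rewrite (splitr e).
apply: (@le_trans _ _ (e / 2 + N%:R^-1)).
  apply: interp_approx => //; first exact: ltW.
  move=> z hz; apply/ltW/Hr => //; apply: (lt_le_trans hz).
  rewrite ler_pdivrMr// mulrC -ler_pdivrMr//.
  by near: N; exact: nbhs_infty_ger.
rewrite lerD2l -[e / 2]invrK lef_pV2 ?posrE ?invr_gt0//.
by near: N; exact: nbhs_infty_ger.
Unshelve. all: by end_near. Qed.

Section Measurability.
Context {d : measure_display} {T : measurableType d}.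

Lemma measurable_countable_code (C : countType) (h : T -> C) (f : C -> R) :
  (forall c, measurable (h @^-1` [set c])) -> measurable_fun setT (f \o h).
Proof.
move=> mh _ B mB; rewrite setTI.
have -> : (f \o h) @^-1` B = \bigcup_(c in setT) (h @^-1` ([set c] `&` (f @^-1` B))).
  apply/seteqP; split => [t /= Bt|t [c _ [/= -> //]]].
  by exists (h t).
apply: countable_bigcupT_measurable => // c.
have [Bc|Bc] := pselect (B (f c)).
  by rewrite (_ : _ `&` _ = [set c])//; apply/seteqP; split => [x []//|x /= ->].
by rewrite (_ : _ `&` _ = set0) ?preimage_set0//; apply/seteqP; split => // x /= [->].
Qed.

Variable X : R -> T -> R.
Hypothesis mX : forall y, measurable_fun setT (X y).
Hypothesis cX : forall w, continuous (X^~ w).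

Lemma measurable_code N c : measurable ((fun w => code N (X^~ w)) @^-1` [set c]).
Proof.
have -> : (fun w => code N (X^~ w)) @^-1` [set c] =
    \bigcap_(k in [set: 'I_N.+1]) ((fun w => N%:R * X (k%:R * L / N%:R) w) @^-1` `[(c k)%:~R, (c k + 1)%:~R[).
  apply/seteqP; split => [w /= cw|w].
    move=> k _ /=; rewrite -cw /code ffunE /= in_itv /=; exact: floor_itv.
  move=> H /=; apply/ffunP => k; rewrite ffunE.
  by apply/floor_def; have := H k I; rewrite /= in_itv.
apply: fin_bigcap_measurable => [|k _]; first exact: finite_finset.
 rewrite -[_ @^-1` _]setTI.
have h : measurable_fun setT (fun w => N%:R * X (k%:R * L / N%:R) w).
  by apply: measurable_funM => //; exact: mX.
by apply: h.
Qed.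

(** [F] of a path is the limit of [F] of its coded interpolants, and these take countably many
    values. *)
Lemma measurable_functional (F : (R -> R) -> R) (K : R) :
  (forall b1 b2 (e : R), continuous b1 -> continuous b2 ->
     (forall y, 0 <= y <= L -> `|b1 y - b2 y| <= e) -> `|F b1 - F b2| <= K * e) ->
  measurable_fun setT (fun w => F (X^~ w)).
Proof.
move=> lipF.
apply: (@measurable_fun_cvg _ _ _ _ (fun N w => F (interp (code N (X^~ w))))).
  move=> N; apply: (@measurable_countable_code _ (fun w => code N (X^~ w)) (fun c => F (interp c))).
  exact: measurable_code.
move=> w _; apply/cvgrPdist_le => e e0.
have K0 : 0 < `|K| + 1 by rewrite ltr_wpDl.
have := @interp_cvg (X^~ w) _ (@cX w) (divr_gt0 e0 K0).
apply: filterS => N H; rewrite distrC.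
apply: (le_trans (lipF _ _ _ (@continuous_interp _ _) (@cX w) H)).
rewrite mulrCA ger_pMr// ler_pdivrMr// mul1r (le_trans (ler_norm _))// lerDl//.
Qed.

End Measurability.
End Interpolation.

(** * Real-valued expectations *)

Section Expectation.
Context {d : measure_display} {T : measurableType d} {R : realType}.
Variable P : probability T R.
Implicit Types (f g : T -> R) (k : R).

(** Expectations are real numbers here, so that linear identities can be handled by ring
    reasoning; integrability is carried by [integ]. *)
Definition expect f : R := \int[P]_w f w.
Definition integ f : Prop := P.-integrable setT (EFin \o f).

Lemma integ_measurable f : integ f -> measurable_fun setT f.
Proof. by move=> /measurable_int /measurable_EFinP. Qed.

Lemma integ_le f g : measurable_fun setT f -> (forall w, `|f w| <= g w) -> integ g -> integ f.
Proof.
move=> mf fg ig; apply: (le_integrable _ _ _ ig) => //; first exact/measurable_EFinP.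
by move=> w _ /=; rewrite lee_fin (le_trans (fg w))// ler_norm.
Qed.

Lemma integ_cst k : integ (fun=> k).
Proof. by apply: finite_measure_integrable_cst. Qed.

Lemma integD f g : integ f -> integ g -> integ (fun w => f w + g w).
Proof. by move=> h1 h2; exact: (integrableD measurableT h1 h2). Qed.

Lemma integZ k f : integ f -> integ (fun w => k * f w).
Proof. by move=> h; exact: (integrableZl measurableT k h). Qed.

Lemma integB f g : integ f -> integ g -> integ (fun w => f w - g w).
Proof. by move=> h1 h2; exact: (integrableB measurableT h1 h2). Qed.

Lemma expectE f : integ f -> (expect f)%:E = (\int[P]_w (f w)%:E)%E.
Proof. by move=> h; rewrite /expect /Rintegral fineK// integrable_fin_num. Qed.

Lemma expect_cst k : expect (fun=> k) = k.
Proof. by have := expectation_cst P k; rewrite unlock /expect /Rintegral => ->. Qed.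

Lemma expectD f g : integ f -> integ g -> expect (fun w => f w + g w) = expect f + expect g.
Proof. by move=> h1 h2; apply: RintegralD. Qed.

Lemma expectB f g : integ f -> integ g -> expect (fun w => f w - g w) = expect f - expect g.
Proof. by move=> h1 h2; apply: RintegralB. Qed.

Lemma expectZ k f : integ f -> expect (fun w => k * f w) = k * expect f.
Proof. by move=> h; apply: RintegralZl. Qed.

Lemma expect_sum (I : Type) (s : seq I) (F : I -> T -> R) : (forall i, integ (F i)) ->
  integ (fun w => \sum_(i <- s) F i w) /\
  expect (fun w => \sum_(i <- s) F i w) = \sum_(i <- s) expect (F i).
Proof.
move=> iF; elim: s => [|i s [IH1 IH2]].
  split; last by rewrite big_nil -[RHS](expect_cst 0); apply: eq_Rintegral => w _; rewrite big_nil.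
  by rewrite (_ : (fun w => _) = fun=> 0); [exact: integ_cst|apply/funext => w; rewrite big_nil].
rewrite (_ : (fun w => _) = fun w => F i w + \sum_(i <- s) F i w); last first.
  by apply/funext => w; rewrite big_cons.
by split; [exact: integD|rewrite expectD// IH2 big_cons].
Qed.

Lemma expect_ge0 f : (forall w, 0 <= f w) -> 0 <= expect f.
Proof. by move=> f0; apply: Rintegral_ge0 => w _. Qed.

Lemma expect_le f g : integ f -> integ g -> (forall w, f w <= g w) -> expect f <= expect g.
Proof.
by move=> h1 h2 fg; rewrite -subr_ge0 -expectB//; apply: expect_ge0 => w; rewrite subr_ge0.
Qed.

Lemma expect_norm_le f g : measurable_fun setT f -> integ g -> (forall w, `|f w| <= g w) ->
  `|expect f| <= expect g.
Proof.
move=> mf ig fg; have h := integ_le mf fg ig.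
have eN : - expect g = expect (fun w => -1 * g w) by rewrite expectZ// mulN1r.
rewrite ler_norml eN.
apply/andP; split; apply: expect_le => //; first exact: integZ.
- by move=> w; rewrite mulN1r lerNl (le_trans _ (fg w))// -normrN ler_norm.
- by move=> w; rewrite (le_trans _ (fg w))// ler_norm.
Qed.

Lemma expect_cvg (f_ : nat -> T -> R) f g : (forall n, measurable_fun setT (f_ n)) ->
  (forall w, (f_ n w) @[n --> \oo] --> f w) -> integ g ->
  (forall n w, `|f_ n w| <= g w) ->
  integ f /\ (expect (f_ n)) @[n --> \oo] --> expect f.
Proof.
move=> mf_ cvf ig fg.
have mf : measurable_fun setT f by apply: (measurable_fun_cvg mf_) => w _; exact: cvf.
have [||||h1 _ h3] := @dominated_convergence _ _ _ P setT measurableT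
  (fun n w => (f_ n w)%:E) (EFin \o f) (EFin \o g) _ _ _ ig.
- by move=> n; exact/measurable_EFinP.
- exact/measurable_EFinP.
- by apply: aeW => w _; apply: cvg_EFin; [exact: nearW|exact: cvf].
- by apply: aeW => w n _; rewrite lee_fin.
split => //; rewrite /expect /Rintegral.
apply: fine_cvg; rewrite fineK//; exact: integrable_fin_num.
Qed.

Import HBNNSimple.

(** The integral of a nonnegative function is a supremum over simple functions below it, and a
    simple function may be set to 0 on a null set. This is what allows functionals
    of paths that are only controlled almost everywhere to be integrated. *)
Lemma integral_ae_eq_fun (f g : T -> \bar R) : {ae P, forall w, f w = g w} ->
  (\int[P]_w f w = \int[P]_w g w)%E.
Proof.
wlog suff H : f g / {ae P, forall w, f w = g w} ->
  (forall w, 0 <= f w)%E -> (forall w, 0 <= g w)%E -> (\int[P]_w f w <= \int[P]_w g w)%E.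
  move=> fg.
  have fgp : {ae P, forall w, (f^\+ w = g^\+ w)%E}.
    by apply: filterS fg => w; rewrite !funeposE => ->.
  have fgn : {ae P, forall w, (f^\- w = g^\- w)%E}.
    by apply: filterS fg => w; rewrite !funenegE => ->.
  have s (u v : T -> \bar R) : {ae P, forall w, u w = v w} -> {ae P, forall w, v w = u w}.
    by apply: filterS => w ->.
  rewrite [LHS]integralE [RHS]integralE; congr (_ - _)%E; apply/eqP; rewrite eq_le;
    apply/andP; split; apply: H => //; exact: s.
move=> [N [mN N0 fgN]] f0 g0.
rewrite (ge0_integralTE _ f0) (ge0_integralTE _ g0).
apply: ge_ereal_sup => _ [h /= hf <-].
have sN : sintegral P h = sintegral P (proj_nnsfun h (measurableC mN)).
  rewrite -!integralT_nnsfun; apply: ae_eq_integral => //.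
  - exact/measurable_EFinP.
  - exact/measurable_EFinP.
  - exists N; split => // w /= hw; apply: contrapT => Nw; apply: hw => _.
    by rewrite mindicE mem_set//= mulr1.
rewrite sN; apply: ereal_sup_ubound; exists (proj_nnsfun h (measurableC mN)) => //= w.
rewrite -[X in (X%:E)]/(proj_nnsfun h (measurableC mN) w).
have [Nw|Nw] := pselect (N w).
  by rewrite /= mindicE memNset ?mulr0.
have <- : f w = g w by apply: contrapT => fgw; apply: Nw; exact: fgN.
by rewrite /= mindicE mem_set// mulr1.
Qed.

End Expectation.

(** * Gaussian integrals *)

Section Gaussian.
Context {R : realType}.
Local Notation mu := (@lebesgue_measure R).
Implicit Types (s p q k c x u : R).
Local Open Scope ereal_scope.

Section Affine.
Variables (k c : R).
Hypothesis k0 : (0 < k)%R.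

Let phi (z : measurableTypeR R) : measurableTypeR R := (k * z + c)%R.

Let mphi : measurable_fun setT phi.
Proof. by apply: measurable_funD => //; apply: measurable_funM. Qed.

(** Both sides are measures that agree on intervals. *)
Lemma lebesgue_measure_affine (A : set R) : measurable A ->
  k%:E * mu (phi @^-1` A) = mu A.
Proof.
move=> mA; have := @lebesgue_measure_unique R (mscale (NngNum (ltW k0)) (pushforward mu phi)).
move=> /(_ mphi) H; apply/esym/H => //= _ [[a b]] _ <-.
change (mu `]a, b]%classic = k%:E * mu (phi @^-1` `]a, b]%classic)).
have -> : phi @^-1` `]a, b]%classic = `]((a - c) / k)%R, ((b - c) / k)%R]%classic.
  apply/seteqP; split => z; rewrite /= !in_itv /= /phi.
    by move=> /andP[h1 h2]; rewrite ltr_pdivrMr// ler_pdivlMr// (mulrC z); apply/andP; split; lra.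
  by rewrite ltr_pdivrMr// ler_pdivlMr// (mulrC z) => /andP[h1 h2]; apply/andP; split; lra.
rewrite !lebesgue_measure_itv/= !lte_fin ltr_pM2r ?invr_gt0// ltrD2r.
case: ifP => _; last by rewrite mule0.
by rewrite -!EFinB -EFinM -mulrBl mulrCA divff ?gt_eqF// mulr1; congr (_%:E); ring.
Qed.

Lemma ge0_integral_affine (f : R -> \bar R) : measurable_fun setT f -> (forall x, 0 <= f x) ->
  \int[mu]_x f x = k%:E * \int[mu]_z f (k * z + c)%R.
Proof.
move=> mf f0.
rewrite (eq_measure_integral (mscale (NngNum (ltW k0)) (pushforward mu phi))); last first.
  by move=> A mA _; exact/esym/lebesgue_measure_affine.
rewrite ge0_integral_mscale//= ge0_integral_pushforward//.
Qed.

End Affine.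

Lemma normal_pdf0E s x : s != 0%R ->
  normal_pdf 0 s x = (normal_peak s * expR (- x ^+ 2 / (s ^+ 2 *+ 2)))%R.
Proof. by move=> s0; rewrite normal_pdfE// /normal_fun subr0. Qed.

Lemma normal_pdf_shift s u x : s != 0%R -> normal_pdf 0 s (x - u) = normal_pdf u s x.
Proof. by move=> s0; rewrite normal_pdf0E// normal_pdfE. Qed.

Lemma normal_peak_scale s k : (0 < k)%R -> normal_peak (k * s) = (normal_peak s / k)%R.
Proof.
move=> k0; rewrite /normal_peak exprMn -mulrA -mulrnAr sqrtrM ?sqr_ge0//.
by rewrite sqrtr_sqr (gtr0_norm k0) invfM mulrC.
Qed.

Lemma integral_normal_prob m s (f : R -> \bar R) :
  measurable_fun setT f -> (forall x, 0 <= f x) ->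
  \int[normal_prob m s]_x f x = \int[mu]_x (f x * (normal_pdf m s x)%:E).
Proof.
move=> mf f0.
have dom := @normal_prob_dominates R m s.
rewrite -(Radon_Nikodym_SigmaFinite.change_of_variables dom)//.
apply: ae_eq_integral => //.
- apply: emeasurable_funM => //; apply: (measurable_int mu).
  exact: Radon_Nikodym_SigmaFinite.f_integrable.
- by apply: emeasurable_funM => //; apply/measurable_EFinP; exact: measurable_normal_pdf.
- apply: ae_eqe_mul2l; apply: integral_ae_eq => //.
  + exact: Radon_Nikodym_SigmaFinite.f_integrable.
  + by apply/measurable_EFinP; exact: measurable_normal_pdf.
  + by move=> A _ mA; rewrite -Radon_Nikodym_SigmaFinite.f_integral.
Qed.

Lemma normal_scale s k x : (0 < k)%R -> s != 0%R ->
  normal_pdf 0 (k * s) (k * x) = (normal_pdf 0 s x / k)%R.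
Proof.
move=> k0 s0; have ks0 : (k * s != 0)%R by rewrite mulf_neq0// gt_eqF.
rewrite (normal_pdf0E _ ks0) (normal_pdf0E _ s0) normal_peak_scale//.
rewrite mulrAC; congr (_ * expR _ / _)%R.
by rewrite -(mulr_natr (s ^+ 2) 2) -(mulr_natr ((k * s) ^+ 2) 2); field; rewrite s0 gt_eqF.
Qed.

(** The joint density of the stationary law and of one step of the chain is symmetric: both
    exponents are the same quadratic form in [x] and [u]. *)
Lemma detailed_balance p q theta x u : p != 0%R -> q != 0%R ->
  (q ^+ 2 = p ^+ 2 * (1 - theta ^+ 2))%R ->
  (normal_pdf 0 p x * normal_pdf 0 q (u - theta * x) =
   normal_pdf 0 p u * normal_pdf 0 q (x - theta * u))%R.
Proof.
move=> p0 q0 pq; rewrite !normal_pdf0E//.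
rewrite mulrACA [RHS]mulrACA -!expRD; congr (_ * expR _)%R.
have h : (1 - theta ^+ 2 != 0)%R.
  by apply: contra_neq (q0) => h; apply/eqP; rewrite -sqrf_eq0 pq h mulr0.
have -> : ((p ^+ 2 *+ 2)^-1 = (1 - theta ^+ 2) / (q ^+ 2 *+ 2))%R.
  by rewrite -(mulr_natr (p ^+ 2) 2) -(mulr_natr (q ^+ 2) 2) pq; field; rewrite p0 h.
ring.
Qed.

Lemma measurable_kernel (f : R -> R) p theta sigma : measurable_fun setT f ->
  (forall x, 0 <= f x)%R ->
  measurable_fun setT (fun x => \int[normal_prob 0 p]_z (f (theta * x + sigma * z))%:E).
Proof.
move=> mf f0.
apply: (@measurable_fun_fubini_tonelli_F _ _ _ _ R (normal_prob 0 p)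
  (fun xz => (f (theta * xz.1 + sigma * xz.2))%:E)).
  by apply/measurable_EFinP; apply: measurableT_comp => //; apply: measurable_funD; apply: measurable_funM.
by move=> xz; rewrite /= lee_fin.
Qed.

(** Integrating the detailed balance identity over the starting point: a step of the chain
    preserves the Gaussian law. *)
Lemma gaussian_invariance p h sigma theta (f : R -> R) :
  (0 < p)%R -> (0 < h)%R -> (0 < sigma)%R ->
  ((sigma * h) ^+ 2 = p ^+ 2 * (1 - theta ^+ 2))%R ->
  measurable_fun setT f -> (forall x, 0 <= f x)%R ->
  \int[normal_prob 0 p]_x \int[normal_prob 0 h]_z (f (theta * x + sigma * z))%:E =
  \int[normal_prob 0 p]_x (f x)%:E.
Proof.
move=> p0 h0 s0 E mf f0.
pose q := (sigma * h)%R; have q0 : (0 < q)%R by rewrite mulr_gt0.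
have [pn0 hn0 qn0] : [/\ p != 0%R, h != 0%R & q != 0%R] by rewrite !gt_eqF.
have inner x : \int[normal_prob 0 h]_z (f (theta * x + sigma * z))%:E =
    \int[mu]_u ((f u)%:E * (normal_pdf 0 q (u - theta * x))%:E).
  rewrite integral_normal_prob; last 2 first.
  - by apply/measurable_EFinP; apply: measurableT_comp => //; apply: measurable_funD => //; apply: measurable_funM.
  - by move=> z; rewrite lee_fin.
  rewrite (@ge0_integral_affine sigma (theta * x) s0 (fun u => (f u)%:E * (normal_pdf 0 q (u - theta * x))%:E)); last 2 first.
  - apply: emeasurable_funM; apply/measurable_EFinP => //.
    by apply: measurableT_comp; [exact: measurable_normal_pdf|exact: measurable_funB].
  - by move=> u; rewrite mule_ge0// lee_fin// normal_pdf_ge0.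
  rewrite -ge0_integralZl//; last 3 first.
  - apply: emeasurable_funM; apply/measurable_EFinP => //.
      by apply: measurableT_comp => //; apply: measurable_funD => //; apply: measurable_funM.
    apply: measurableT_comp; first exact: measurable_normal_pdf.
    by apply: measurable_funB => //; apply: measurable_funD => //; apply: measurable_funM.
  - by move=> u _; rewrite mule_ge0// lee_fin// normal_pdf_ge0.
  - by rewrite lee_fin ltW.
  apply: eq_integral => z _; rewrite addrK normal_scale// -!EFinM; congr (_%:E).
  by rewrite [(theta * x + _)%R]addrC; field; rewrite gt_eqF.
rewrite integral_normal_prob; last 2 first.
- exact: measurable_kernel.
- by move=> x; apply: integral_ge0 => z _; rewrite lee_fin.
rewrite integral_normal_prob; last 2 first.
- exact/measurable_EFinP.
- by move=> x; rewrite lee_fin.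
pose F (xu : measurableTypeR R * measurableTypeR R) := ((f xu.2 * (normal_pdf 0 p xu.1 * normal_pdf 0 q (xu.2 - theta * xu.1)))%:E).
have mF : measurable_fun setT F.
  apply/measurable_EFinP; apply: measurable_funM; first by apply: measurableT_comp.
  apply: measurable_funM.
    by apply: measurableT_comp => //; exact: measurable_normal_pdf.
  apply: measurableT_comp; first exact: measurable_normal_pdf.
  by apply: measurable_funB => //; apply: measurable_funM.
have F0 xu : 0 <= F xu.
  by rewrite lee_fin !mulr_ge0 ?normal_pdf_ge0.
transitivity (\int[mu]_x \int[mu]_u F (x, u)).
  apply: eq_integral => x _; rewrite inner -ge0_integralZr//; last 3 first.
  - apply: emeasurable_funM; apply/measurable_EFinP => //.
    by apply: measurableT_comp; [exact: measurable_normal_pdf|exact: measurable_funB].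
  - by move=> u _; rewrite mule_ge0// lee_fin// normal_pdf_ge0.
  - by rewrite lee_fin normal_pdf_ge0.
  by apply: eq_integral => u _; rewrite /F /= -!EFinM; congr (_%:E); ring.
rewrite (@fubini_tonelli _ _ _ _ R mu mu F mF F0); apply: eq_integral => u _.
transitivity (\int[mu]_x ((f u)%:E * (normal_pdf 0 p u)%:E * (normal_pdf (theta * u) q x)%:E)).
  apply: eq_integral => x _; rewrite -(normal_pdf_shift (theta * u)%R x qn0) {1}/F [(_, _).1]/= [(_, _).2]/=.
  rewrite (detailed_balance _ _ pn0 qn0 E).
  by rewrite -!EFinM; congr (_%:E); ring.
rewrite ge0_integralZl//; last 3 first.
- by apply/measurable_EFinP; exact: measurable_normal_pdf.
- by move=> x _; rewrite lee_fin normal_pdf_ge0.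
- by rewrite mule_ge0// lee_fin ?normal_pdf_ge0.
by rewrite integral_normal_pdf mule1.
Qed.

(** Only the order of magnitude in the standard deviation matters, so a crude constant is enough. *)
Lemma normal_sixth_moment : exists2 C : R, (0 <= C)%R &
  forall s, (0 < s)%R -> \int[normal_prob 0 s]_x (x ^+ 6)%:E <= (C * s ^+ 6)%:E.
Proof.
have [C [C0 HC]] : exists C : R, (0 <= C)%R /\
    forall v, (0 <= v -> v ^+ 3 * expR (- (v / 8 + v / 8 + v / 8)) <= C)%R.
  (* With v = 8 w and w <= exp w, v^3 <= 512 exp (3 w). *)
  exists 512%R; split; first exact: ler0n.
  move=> v v0; rewrite expRN ler_pdivrMr ?expR_gt0// !expRD.
  have e1 : (v / 8 <= expR (v / 8))%R.
    by apply: le_trans (expR_ge1Dx _); rewrite lerDr.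
  have v8 : (0 <= v / 8)%R by rewrite divr_ge0.
  have -> : (v ^+ 3 = 512 * (v / 8 * (v / 8) * (v / 8)))%R by field.
  move: (v / 8)%R (expR (v / 8)) e1 v8 => w e e1 w0.
  have ww : (w * w <= e * e)%R by apply: ler_pM.
  apply: ler_wpM2l; first exact: ler0n.
  by apply: ler_pM => //; apply: mulr_ge0.
exists (2 * C)%R; first by rewrite mulr_ge0.
move=> s s0; have sn0 : s != 0%R by rewrite gt_eqF.
have s20 : (2 * s != 0)%R by rewrite mulf_neq0// gt_eqF.
have Cs : (0 <= 2 * C * s ^+ 6)%R.
  by apply: mulr_ge0; [apply: mulr_ge0|exact: exprn_even_ge0].
rewrite integral_normal_prob; last 2 first.
- by apply/measurable_EFinP; exact: measurable_funX.
- by move=> x; rewrite lee_fin exprn_even_ge0.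
(* A quarter of the exponent of the density of N(0, s^2) makes twice the density of N(0, 4 s^2);
   the other three quarters absorb x^6. *)
apply: (@le_trans _ _ (\int[mu]_x ((2 * C * s ^+ 6)%:E * (normal_pdf 0 (2 * s) x)%:E))).
  apply: ge0_le_integral => //.
  - by move=> x _; rewrite mule_ge0// lee_fin ?normal_pdf_ge0// exprn_even_ge0.
  - by apply: emeasurable_funM; apply/measurable_EFinP; [exact: measurable_funX|exact: measurable_normal_pdf].
  - by apply: emeasurable_funM => //; apply/measurable_EFinP; exact: measurable_normal_pdf.
  - move=> x _; rewrite -!EFinM lee_fin !normal_pdf0E// normal_peak_scale//.
    have pk := normal_peak_ge0 s.
    pose v := (x ^+ 2 / s ^+ 2)%R.
    have v0 : (0 <= v)%R by rewrite divr_ge0 ?sqr_ge0.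
    have -> : (x ^+ 6 = s ^+ 6 * v ^+ 3)%R by rewrite /v; field.
    have -> : (- x ^+ 2 / ((2 * s) ^+ 2 *+ 2) = - (v / 8))%R by rewrite -(mulr_natr (_ ^+ 2) 2) /v; field.
    have -> : (- x ^+ 2 / (s ^+ 2 *+ 2) = - (v / 8) - (v / 8 + v / 8 + v / 8))%R.
      by rewrite -(mulr_natr (_ ^+ 2) 2) /v; field.
    rewrite expRD; have := HC _ v0.
    set e := expR (- (v / 8)); set e' := expR (- _) => h.
    have e0 : (0 <= e)%R by exact: expR_ge0.
    have -> : (s ^+ 6 * v ^+ 3 * (normal_peak s * (e * e')) =
      (v ^+ 3 * e') * (s ^+ 6 * normal_peak s * e))%R by ring.
    have -> : (2 * C * s ^+ 6 * (normal_peak s / 2 * e) = C * (s ^+ 6 * normal_peak s * e))%R by field.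
    have A0 : (0 <= s ^+ 6 * normal_peak s * e)%R.
      by apply: mulr_ge0 => //; apply: mulr_ge0 => //; exact: exprn_even_ge0.
    exact: ler_wpM2r A0 _ _ h.
rewrite ge0_integralZl//; last 2 first.
- by apply/measurable_EFinP; exact: measurable_normal_pdf.
- by move=> x _; rewrite lee_fin normal_pdf_ge0.
by rewrite integral_normal_pdf mule1.
Qed.

(** Integration by parts on [[-j, j]], with a boundary term that vanishes in the limit. *)
Lemma normal_second_moment s : (0 < s)%R ->
  \int[normal_prob 0 s]_x (x ^+ 2)%:E = (s ^+ 2)%:E.
Proof.
move=> s0; have sn0 : s != 0%R by rewrite gt_eqF.
have [C C0 HC] := normal_sixth_moment.
pose n := normal_pdf 0 s.
have mn : measurable_fun setT n by exact: measurable_normal_pdf.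
have n0 x : (0 <= n x)%R by exact: normal_pdf_ge0.
have cn : continuous n by exact: continuous_normal_pdf.
have m2 : measurable_fun setT (fun x : R => x ^+ 2)%R by exact: measurable_funX.
have m2n : measurable_fun setT (fun x : R => x ^+ 2 * n x)%R by exact: measurable_funM.
rewrite integral_normal_prob; last 2 first.
- exact/measurable_EFinP.
- by move=> x; rewrite lee_fin sqr_ge0.
have i2 : mu.-integrable setT (fun x => (x ^+ 2 * n x)%:E).
  apply/integrableP; split; first exact/measurable_EFinP.
  apply: (@le_lt_trans _ _ (\int[mu]_x ((1 + x ^+ 6) * n x)%:E)).
    apply: ge0_le_integral => //.
    - exact/measurableT_comp/measurable_EFinP.
    - by apply/measurable_EFinP/measurable_funM => //; apply: measurable_funD => //; exact: measurable_funX.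
    - move=> x _; have x2n : (0 <= x ^+ 2 * n x)%R by apply: mulr_ge0; first exact: sqr_ge0.
      rewrite abse_EFin lee_fin (ger0_norm x2n); apply: ler_wpM2r; first exact: n0.
      have x2 := sqr_ge0 x; have -> : (x ^+ 6 = (x ^+ 2) ^+ 3)%R by ring.
      move: (x ^+ 2)%R x2 => v v0; have := sqr_ge0 (v - 1)%R; nra.
  under eq_integral => x _ do rewrite mulrDl mul1r EFinD.
  rewrite ge0_integralD//; last 4 first.
  - by move=> x _; rewrite lee_fin.
  - exact/measurable_EFinP.
  - by move=> x _; rewrite lee_fin mulr_ge0// exprn_even_ge0.
  - by apply/measurable_EFinP/measurable_funM => //; exact: measurable_funX.
  rewrite lte_add_pinfty//; first by rewrite integral_normal_pdf ltry.
  have := HC _ s0; rewrite integral_normal_prob; last 2 first.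
  - by apply/measurable_EFinP; exact: measurable_funX.
  - by move=> x; rewrite lee_fin exprn_even_ge0.
  by move=> /le_lt_trans; apply; rewrite ltry.
have i0 : mu.-integrable setT (fun x => (n x)%:E) by exact: integrable_normal_pdf.
pose g x := (x ^+ 2 * n x - s ^+ 2 * n x)%R.
have ig : mu.-integrable setT (EFin \o g).
  exact: (integrableB measurableT i2 (integrableZl measurableT (s ^+ 2)%R i0)).
suff G0 : \int[mu]_x (g x)%:E = 0.
  have : \int[mu]_x (g x)%:E = \int[mu]_x (x ^+ 2 * n x)%:E - \int[mu]_x ((s ^+ 2)%:E * (n x)%:E).
    by rewrite -integralB//; exact: (integrableZl measurableT (s ^+ 2)%R i0).
  rewrite G0 integralZl// integral_normal_pdf mule1 => /esym/eqP.
  by rewrite sube_eq ?add0e// => [/eqP//|]; exact: integrable_fin_num.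
(* F' = x^2 n - s^2 n, since n' = - (x / s^2) n. *)
pose F x := (- s ^+ 2 * (x * n x))%R.
have dn x : is_derive x 1%R n (- (x / s ^+ 2) * n x)%R.
  have -> : n = (fun x => normal_peak s * expR (- (s ^+ 2 *+ 2)^-1 * (x * x)))%R.
    by apply/funext => z; rewrite /n normal_pdf0E//; congr (_ * expR _)%R; ring.
  have d2 := der_mul (is_derive_id x (1%R : R)) (is_derive_id x (1%R : R)).
  have h := der_scal (normal_peak s) (der_expR (der_scal (- (s ^+ 2 *+ 2)^-1)%R d2)).
  apply: (is_derive_eq h); rewrite -(mulr_natr (s ^+ 2) 2) /=; field.
  by rewrite sn0.
have dF x : is_derive x 1%R F (g x).
  have h := der_scal (- s ^+ 2)%R (der_mul (is_derive_id x (1%R : R)) (dn x)).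
  by apply: (is_derive_eq h); rewrite /g /=; field.
have cg : continuous g.
  move=> x; apply: cvgB; apply: cvgM; try exact: cn; last exact: cvg_cst.
  by under eq_fun do rewrite expr2; apply: cvgM; exact: cvg_id.
have FN j : \int[mu]_(x in `[(- j.+1%:R)%R, j.+1%:R%R]) (g x)%:E = (F j.+1%:R - F (- j.+1%:R))%R%:E.
  rewrite (@continuous_FTC2 R g F (- j.+1%:R)%R j.+1%:R%R)//.
  - by rewrite ltrNl (lt_trans _ (ltr0Sn R j))// oppr_lt0.
  - exact: continuous_itv.
  - have cF := continuous_derive dF; split=> [x _|/=|/=].
    + by case: (dF x).
    + by apply: cvg_at_right_filter; exact: cF.
    + by apply: cvg_at_left_filter; exact: cF.
  - by move=> x _; rewrite derive1E; have [_ ->] := dF x.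
have Fb x : (0 < x -> `|F x| <= 2 * s ^+ 4 * normal_peak s / x)%R.
  move=> x0; rewrite /F !normrM normrN (ger0_norm (sqr_ge0 s)) (gtr0_norm x0) (ger0_norm (n0 x)).
  rewrite /n normal_pdf0E// ler_pdivlMr//.
  have -> : (- x ^+ 2 / (s ^+ 2 *+ 2) = - (x ^+ 2 / (s ^+ 2 *+ 2)))%R by rewrite mulNr.
  set v := (x ^+ 2 / (s ^+ 2 *+ 2))%R.
  have -> : (s ^+ 2 * (x * (normal_peak s * expR (- v))) * x = 2 * s ^+ 4 * normal_peak s * (v * expR (- v)))%R.
    by rewrite /v -(mulr_natr (s ^+ 2) 2); field.
  rewrite ler_piMr//.
    apply: mulr_ge0; last exact: normal_peak_ge0.
    by apply: mulr_ge0 => //; exact: exprn_even_ge0.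
  rewrite expRN ler_pdivrMr ?expR_gt0// mul1r; apply: le_trans (expR_ge1Dx _); by rewrite lerDr.
have FNx x : F (- x)%R = (- F x)%R.
  by rewrite /F /n !normal_pdf0E// sqrrN; ring.
have lim1 : (\int[mu]_(x in `[(- j.+1%:R)%R, j.+1%:R%R]) (g x)%:E) @[j --> \oo] --> (0 : \bar R).
  have -> : (fun j : nat => \int[mu]_(x in `[(- j.+1%:R)%R, j.+1%:R%R]) (g x)%:E) = (fun j => (2 * F j.+1%:R)%R%:E).
    by apply/funext => j; rewrite FN FNx; congr (_%:E); ring.
  apply: cvg_EFin; first exact: nearW.
  apply/cvgr0Pnorm_le => e e0.
  near=> j; rewrite /= normrM ger0_norm//.
  apply: (@le_trans _ _ (2 * (2 * s ^+ 4 * normal_peak s / j.+1%:R))%R).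
    by rewrite ler_pM2l// Fb.
  rewrite [(2 * (_ / _))%R]mulrA ler_pdivrMr ?ltr0n// (mulrC e) -ler_pdivrMr//.
  near: j; apply: filterS (nbhs_infty_ger (2 * (2 * s ^+ 4 * normal_peak s) / e)%R) => j h.
  by rewrite (le_trans h)// ler_nat.
have lim2 : (\int[mu]_(x in `[(- j.+1%:R)%R, j.+1%:R%R]) (g x)%:E) @[j --> \oo] --> \int[mu]_x (g x)%:E.
  under eq_fun => j do rewrite integral_mkcond.
  have [||||| _ _ H3] := @dominated_convergence _ _ _ mu setT measurableT
    (fun j => (EFin \o g) \_ `[(- j.+1%:R)%R, j.+1%:R%R]) (EFin \o g) (abse \o (EFin \o g)).
  - move=> j; apply/(measurable_restrictT _ _).1 => //.
    by apply: measurable_funTS; exact: measurable_int ig.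
  - exact: measurable_int ig.
  - apply: aeW => x _; apply: cvg_near_cst.
    near=> j; rewrite patchE mem_set//= in_itv/= -ler_norml.
    near: j; apply: filterS (nbhs_infty_ger `|x|%R) => j h.
    by rewrite (le_trans h)// ler_nat.
  - exact: integrable_abse.
  - by apply: aeW => x j _; rewrite patchE; case: ifP => _ //; rewrite abse0 abse_ge0.
  exact: H3.
exact: (cvg_unique _ lim2 lim1).
Unshelve. all: by end_near. Qed.

End Gaussian.

(** * A stationary autoregressive chain *)

Section GaussianLaw.
Context {d : measure_display} {T : measurableType d} {R : realType}.
Variable P : probability T R.
Local Open Scope ereal_scope.

Lemma integral_gaussian (Z : T -> R) (v : R) (f : R -> \bar R) :
  measurable_fun setT Z -> gaussian_rv P Z 0 v -> measurable_fun setT f -> (forall x, 0 <= f x) ->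
  \int[P]_w f (Z w) = \int[normal_prob 0 (Num.sqrt v)]_x f x.
Proof.
move=> mZ hZ mf f0.
have mZ' : measurable_fun setT (Z : T -> measurableTypeR R) by exact: mZ.
pose Z' : {RV P >-> measurableTypeR R} := HB.pack (Z : T -> measurableTypeR R)
  (isMeasurableFun.Build _ _ _ _ _ mZ').
transitivity (\int[distribution P Z']_x f x).
  by rewrite (ge0_integral_distribution Z' mf f0).
by apply: eq_measure_integral => A mA _; exact: (hZ _ mA).
Qed.

End GaussianLaw.

Section Chain.
Context {d : measure_display} {T : measurableType d} {R : realType}.
Variable P : probability T R.
Variables (L p : R) (W : R -> {RV P >-> R}) (X0 : {RV P >-> R}).
Hypotheses (L0 : 0 < L) (p0 : 0 < p).
Hypothesis lawW : forall s t, 0 <= s -> s < t -> t <= L -> gaussian_rv P (W t \- W s) 0 (t - s).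
Hypothesis indW : forall s t, 0 <= s -> s < t -> t <= L ->
  independent_systems P (sigma_of_rv (W t \- W s)) (sigma_of_process `[0, s] W).
Hypothesis lawX0 : gaussian_rv P X0 0 (p ^+ 2).
Hypothesis indX0 : independent_systems P (sigma_of_rv X0) (sigma_of_process `[0, L] W).

Definition past_gen (s : R) : set (set T) :=
  [set C | exists A B, [/\ sigma_of_rv X0 A, sigma_of_process `[0, s] W B & C = A `&` B]].

(** The events known at time [s]: the initial value together with the noise up to [s]. *)
Definition past (s : R) := g_sigma_algebraType (past_gen s).

Lemma sigma_of_rv_measurable (X : T -> R) : measurable_fun setT X -> sigma_of_rv X `<=` measurable.
Proof. by move=> mX A [B mB <-]; exact: mX. Qed.

Lemma sigma_of_process_measurable (I : set R) : sigma_of_process I W `<=` measurable.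
Proof.
apply: smallest_sub; first exact: sigma_algebra_measurable.
by move=> A [t It]; exact: sigma_of_rv_measurable.
Qed.

Lemma sigma_of_processS (I J : set R) : I `<=` J -> sigma_of_process I W `<=` sigma_of_process J W.
Proof.
move=> IJ; apply: sub_smallest2r; first exact: smallest_sigma_algebra.
exact: bigcup_subset.
Qed.

Lemma past_gen_measurable s : past_gen s `<=` measurable.
Proof.
move=> _ [A [B [hA hB ->]]]; apply: measurableI.
  exact: (sigma_of_rv_measurable (measurable_funPT X0) hA).
exact: sigma_of_process_measurable hB.
Qed.

Lemma past_measurable s (C : set T) : measurable (C : set (past s)) -> measurable C.
Proof.
by move: C; apply: smallest_sub; [exact: sigma_algebra_measurable|exact: past_gen_measurable].
Qed.

Lemma sigma_of_rvT (X : T -> R) : sigma_of_rv X setT.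
Proof. by exists setT => //; rewrite setTI preimage_setT. Qed.

Lemma sigma_of_processT I : sigma_of_process I W setT.
Proof. 
by have := @measurableT _ (g_sigma_algebraType (\bigcup_(t in I) sigma_of_rv (W t))).
Qed.

Lemma past_gen_setI s : setI_closed (past_gen s).
Proof.
move=> _ _ [A1 [B1 [hA1 hB1 ->]]] [A2 [B2 [hA2 hB2 ->]]].
exists (A1 `&` A2), (B1 `&` B2); split; last by rewrite setIACA.
  move: hA1 hA2 => [C1 mC1 <-] [C2 mC2 <-]; exists (C1 `&` C2); first exact: measurableI.
  by rewrite preimage_setI !setTI.
exact: (@measurableI _ (g_sigma_algebraType (\bigcup_(t in `[0, s]) sigma_of_rv (W t)))).
Qed.

Lemma increment_sigma_of_process s t : 0 <= s -> s < t -> t <= L ->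
  sigma_of_rv (W t \- W s) `<=` sigma_of_process `[0, L] W.
Proof.
move=> s0 st tL _ [B mB <-].
pose S := g_sigma_algebraType (\bigcup_(t in `[0, L]) sigma_of_rv (W t)).
have mW u : 0 <= u <= L -> measurable_fun setT (W u : S -> R).
  move=> uL _ C mC; apply: sub_sigma_algebra; exists u; first by rewrite /= in_itv.
  by exists C.
have : measurable_fun setT ((W t : S -> R) \- (W s : S -> R)).
  by apply: measurable_funB; apply: mW; lra.
by move=> /(_ measurableT B mB).
Qed.

(** The events of the past form a sigma-algebra generated by intersections of an initial event and
    a noise event, for which the product rule follows from the two independence hypotheses; the
    rest is the pi-lambda theorem. *)
Lemma past_independent s t (C D : set T) : 0 <= s -> s < t -> t <= L ->
  measurable (C : set (past s)) -> sigma_of_rv (W t \- W s) D ->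
  P (C `&` D) = (P C * P D)%E.
Proof.
move=> s0 st tL mC sD.
have mD : measurable D.
  by apply: sigma_of_rv_measurable sD; apply: measurable_funB.
suff [] : measurable C /\ P (C `&` D) = (P C * P D)%E by [].
apply: (@dynkin_induction _ (past s) (past_gen s)
  (fun C => measurable (C : set T) /\ P (C `&` D) = (P C * P D)%E)) mC => //.
- exact: past_gen_setI.
- by split => //; rewrite setTI probability_setT mul1e.
- move=> E hE; split; first exact: past_gen_measurable hE.
  case: hE => [A [B [hA hB ->]]].
  have BL : sigma_of_process `[0, L] W B.
    by apply: sigma_of_processS hB => u; rewrite /= !in_itv/=; lra.
  have BDL : sigma_of_process `[0, L] W (B `&` D).
    apply: (@measurableI _ (g_sigma_algebraType (\bigcup_(t in `[0, L]) sigma_of_rv (W t)))) => //.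
    exact: increment_sigma_of_process sD.
  rewrite -setIA (indX0 hA BDL) setIC (indW s0 st tL sD hB).
  by rewrite (indX0 hA BL) muleCA muleC.
- move=> E mE [mE' hE]; split; first exact: measurableC.
  have h1 : P D = (P (E `&` D) + P (~` E `&` D))%E.
    rewrite -measureU//; [|exact: measurableI|by apply: measurableI => //; exact: measurableC|].
      by rewrite -setIUl setUv setTI.
    by rewrite setIACA setICr set0I.
  have fD : P D \is a fin_num by exact: fin_num_measure.
  have fE : P E \is a fin_num by exact: fin_num_measure.
  have fE' : P (E `&` D) \is a fin_num by apply: fin_num_measure; exact: measurableI.
  have fE'' : P (~` E `&` D) \is a fin_num.
    by apply: fin_num_measure; apply: measurableI => //; exact: measurableC.
  rewrite probability_setC//; move: h1 hE.
  rewrite -(fineK fD) -(fineK fE) -(fineK fE') -(fineK fE'').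
  rewrite -EFinD -EFinM => -[h1] [h2]; rewrite -EFinB -EFinM; congr (_%:E).
  by rewrite mulrBl mul1r -h2; lra.
- move=> F mF tF hF; split.
    by apply: bigcupT_measurable => n; case: (hF n).
  have tFD : trivIset setT (fun n => F n `&` D) by apply: trivIset_setIr.
  rewrite setI_bigcupl measure_bigcup//; last by move=> n _; apply: measurableI => //; case: (hF n).
  rewrite measure_bigcup//; last by move=> n _; case: (hF n).
  have fD : P D \is a fin_num by exact: fin_num_measure.
  rewrite muleC -[P D](fineK fD) -nneseriesZl//.
  by apply: eq_eseriesr => n _; rewrite (fineK fD) muleC; case: (hF n).
Qed.

Lemma measurable_past_X0 s : measurable_fun setT (X0 : past s -> R).
Proof.
move=> _ B mB; apply: sub_sigma_algebra; exists (setT `&` X0 @^-1` B), setT; split.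
- by exists B.
- exact: sigma_of_processT.
- by rewrite setIT.
Qed.

Lemma measurable_past_W s u : 0 <= u <= s -> measurable_fun setT (W u : past s -> R).
Proof.
move=> us _ B mB; apply: sub_sigma_algebra; exists setT, (setT `&` W u @^-1` B); split.
- exact: sigma_of_rvT.
- by apply: sub_sigma_algebra; exists u; [rewrite /= in_itv|exists B].
- by rewrite [RHS]setTI.
Qed.

Lemma measurable_past_T s (f : T -> R) : measurable_fun setT (f : past s -> R) -> measurable_fun setT f.
Proof. by move=> mf _ B mB; apply: (@past_measurable s); exact: mf. Qed.

(** Independence as a Fubini formula: given the past, an increment of the noise is integrated
    against its Gaussian law. *)
Lemma integral_past_increment s t (F : past s * R -> \bar R) : 0 <= s -> s < t -> t <= L ->
  measurable_fun setT F -> (forall x, 0 <= F x)%E ->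
  (\int[P]_w F (w, W t w - W s w)%R =
   \int[P]_w \int[normal_prob 0 (Num.sqrt (t - s))]_z F (w, z))%E.
Proof.
move=> s0 st tL mF F0.
set nu := normal_prob 0 (Num.sqrt (t - s)).
have mid : measurable_fun setT (id : T -> past s).
  by move=> _ C mC; rewrite setTI; exact: past_measurable mC.
have mZ : measurable_fun setT (W t \- W s) by apply: measurable_funB.
have mVZ : measurable_fun setT (fun w : T => (w : past s, (W t w - W s w) : measurableTypeR R)).
  exact: measurable_fun_pair.
pose V : {RV P >-> past s} := HB.pack (id : T -> past s) (isMeasurableFun.Build _ _ _ _ _ mid).
pose VZ : {RV P >-> (past s * measurableTypeR R)%type} := HB.pack (fun w : T => (w : past s, (W t w - W s w) : measurableTypeR R))
  (isMeasurableFun.Build _ _ _ _ _ mVZ).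
have prodE A : measurable A -> (distribution P V \x nu)%E A = distribution P VZ A.
  apply: product_measure_unique => B D mB mD.
  rewrite /distribution /pushforward /=.
  have <- := lawW s0 st tL mD; rewrite /pushforward.
  have sD : sigma_of_rv (W t \- W s) ((W t \- W s) @^-1` D) by exists D => //; rewrite setTI.
  exact: (past_independent s0 st tL mB sD).
transitivity (\int[distribution P VZ]_x F x)%E.
  by rewrite (ge0_integral_distribution VZ mF F0).
transitivity (\int[(distribution P V \x nu)%E]_x F x)%E.
  by apply: eq_measure_integral => A mA _; exact/esym/prodE.
rewrite fubini_tonelli1// (ge0_integral_distribution V)//.
  exact: measurable_fun_fubini_tonelli_F.
by move=> x; exact: integral_ge0.
Qed.

Section Discrete.
Variables (N : nat) (theta sigma : R).
Hypotheses (N0 : (0 < N)%N) (sigma0 : 0 < sigma).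

Definition node (k : nat) : R := k%:R * L / N%:R.

Hypothesis balance : (sigma * Num.sqrt (L / N%:R)) ^+ 2 = p ^+ 2 * (1 - theta ^+ 2).

Fixpoint chain (k : nat) (w : T) : R :=
  if k is k'.+1 then theta * chain k' w + sigma * (W (node k) w - W (node k') w)
  else X0 w.

Lemma NR0 : 0 < N%:R :> R. Proof. by rewrite ltr0n. Qed.

Lemma node_ge0 k : 0 <= node k.
Proof. by rewrite /node divr_ge0 ?mulr_ge0// ltW. Qed.

Lemma node_le k : (k <= N)%N -> node k <= L.
Proof. by move=> kN; rewrite /node ler_pdivrMr ?NR0// mulrC ler_pM2l// ler_nat. Qed.

Lemma nodeS k : node k.+1 - node k = L / N%:R.
Proof. by rewrite /node -natr1; lra. Qed.

Lemma node_lt k : node k < node k.+1.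
Proof. by rewrite -subr_gt0 nodeS divr_gt0// NR0. Qed.

Lemma node_mono j k : (j <= k)%N -> node j <= node k.
Proof. by move=> jk; rewrite /node ler_pM2r ?invr_gt0 ?NR0// ler_pM2r// ler_nat. Qed.

Lemma measurable_chain_past j k : (j <= k)%N -> measurable_fun setT (chain j : past (node k) -> R).
Proof.
elim: j => [|j IH] jk; first exact: measurable_past_X0.
have mW i : (i <= k)%N -> measurable_fun setT (W (node i) : past (node k) -> R).
  by move=> ik; apply: measurable_past_W; rewrite node_ge0 node_mono.
apply: (@measurable_funD _ (past (node k)) R setT (fun w => theta * chain j w)
  (fun w => sigma * (W (node j.+1) w - W (node j) w))).
  by apply: measurable_funM => //; apply: IH; exact: ltnW.
by apply: measurable_funM => //; apply: measurable_funB; apply: mW => //; exact: ltnW.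
Qed.

Local Notation nu := (normal_prob 0 (Num.sqrt (L / N%:R))).

Definition transition (f : R -> R) (x : R) : R :=
  fine (\int[nu]_z (f (theta * x + sigma * z))%:E)%E.

(** Values in the unit interval make every product of these functions integrable. *)
Definition unit_fun (f : R -> R) := measurable_fun setT f /\ forall x, 0 <= f x <= 1.

Lemma transitionE f x : unit_fun f ->
  (transition f x)%:E = (\int[nu]_z (f (theta * x + sigma * z))%:E)%E /\ 0 <= transition f x <= 1.
Proof.
move=> [mf f01].
have m1 : measurable_fun setT (fun z : R => (f (theta * x + sigma * z))%:E).
  by apply/measurable_EFinP; apply: measurableT_comp => //; apply: measurable_funD => //; apply: measurable_funM.
have h0 : (0 <= \int[nu]_z (f (theta * x + sigma * z))%:E)%E.
  by apply: integral_ge0 => z _; rewrite lee_fin; case/andP: (f01 (theta * x + sigma * z)).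
have h1 : (\int[nu]_z (f (theta * x + sigma * z))%:E <= 1)%E.
  apply: (@le_trans _ _ (\int[nu]_z 1)%E).
    apply: ge0_le_integral => //.
    + by move=> z _; rewrite lee_fin; case/andP: (f01 (theta * x + sigma * z)).
    + by move=> z _; rewrite lee_fin; case/andP: (f01 (theta * x + sigma * z)).
  by rewrite integral_cst// mul1e; exact: probability_le1.
have fin : (\int[nu]_z (f (theta * x + sigma * z))%:E)%E \is a fin_num.
  by rewrite ge0_fin_numE// (le_lt_trans h1)// ltry.
by rewrite /transition fineK//; split => //; rewrite -!lee_fin fineK// h0 h1.
Qed.

Lemma unit_transition f : unit_fun f -> unit_fun (transition f).
Proof.
move=> uf; split; last by move=> x; have [] := transitionE x uf.
apply/measurable_EFinP.
rewrite (_ : EFin \o transition f = fun x => (\int[nu]_z (f (theta * x + sigma * z))%:E)%E); last first.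
  by apply/funext => x /=; have [] := transitionE x uf.
apply: measurable_kernel; first by case: uf.
by move=> x; case: uf => _ /(_ x)/andP[].
Qed.

Lemma integral_chain_step k (Y : T -> R) (f : R -> R) : (k < N)%N ->
  measurable_fun setT (Y : past (node k) -> R) -> (forall w, 0 <= Y w) -> unit_fun f ->
  (\int[P]_w (Y w * f (chain k.+1 w))%:E = \int[P]_w (Y w * transition f (chain k w))%:E)%E.
Proof.
move=> kN mY Y0 [mf f01].
pose F (wz : past (node k) * R) : \bar R :=
  ((Y wz.1)%:E * (f (theta * chain k wz.1 + sigma * wz.2))%:E)%E.
have mF : measurable_fun setT F.
  apply: emeasurable_funM; apply/measurable_EFinP; first exact: measurableT_comp.
  apply: measurableT_comp => //; apply: measurable_funD; apply: measurable_funM => //.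
  by apply: measurableT_comp => //; exact: measurable_chain_past.
have F0 x : (0 <= F x)%E.
  by rewrite mule_ge0// lee_fin; case/andP: (f01 (theta * chain k x.1 + sigma * x.2)).
have := integral_past_increment (node_ge0 k) (node_lt k) (node_le kN) mF F0.
rewrite nodeS /F /= => H.
transitivity (\int[P]_w ((Y w)%:E * (f (theta * chain k w + sigma * (W (node k.+1) w - W (node k) w)))%:E))%E.
  by apply: eq_integral => w _.
rewrite H; apply: eq_integral => w _.
rewrite EFinM (transitionE _ (conj mf f01)).1 ge0_integralZl//.
- by apply/measurable_EFinP; apply: measurableT_comp => //; apply: measurable_funD => //; apply: measurable_funM.
- by move=> z _; rewrite lee_fin; case/andP: (f01 (theta * chain k w + sigma * z)).
- by rewrite lee_fin.
Qed.

Lemma integral_X0 f : unit_fun f -> (\int[P]_w (f (X0 w))%:E = \int[normal_prob 0 p]_x (f x)%:E)%E.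
Proof.
move=> [mf f01]; have mX : measurable_fun setT X0 by [].
have mf' : measurable_fun setT (EFin \o f) by exact/measurable_EFinP.
have f0 x : (0 <= (EFin \o f) x)%E by rewrite lee_fin; case/andP: (f01 x).
by rewrite (integral_gaussian mX lawX0 mf' f0) sqrtr_sqr (gtr0_norm p0).
Qed.

Lemma chain_law f k : unit_fun f -> (k <= N)%N ->
  (\int[P]_w (f (chain k w))%:E = \int[P]_w (f (chain 0 w))%:E)%E.
Proof.
elim: k f => [//|k IH] f uf kN.
have h := @integral_chain_step k (fun=> 1) f kN (@measurable_cst _ _ _ _ _ _) (fun=> ler01) uf.
transitivity (\int[P]_w (1 * f (chain k.+1 w))%:E)%E.
  by apply: eq_integral => w _; rewrite mul1r.
rewrite h; transitivity (\int[P]_w (transition f (chain k w))%:E)%E.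
  by apply: eq_integral => w _; rewrite mul1r.
rewrite IH//; [|exact: unit_transition|exact: ltnW].
rewrite (integral_X0 (unit_transition uf)) (integral_X0 uf).
case: uf => mf f01.
have f0 x : 0 <= f x by case/andP: (f01 x).
rewrite -(@gaussian_invariance R p (Num.sqrt (L / N%:R)) sigma theta f p0 _ sigma0 balance mf f0); last first.
  by rewrite sqrtr_gt0 divr_gt0// NR0.
by apply: eq_integral => x _; have [] := transitionE x (conj mf f01).
Qed.

(** Induction on the length: the last factor is integrated out by the transition operator, at both
    positions of the chain alike, which reduces the statement to a single marginal. *)
Lemma chain_stationary m (g : nat -> R -> R) k : (forall j, unit_fun (g j)) -> (k + m <= N)%N ->
  (\int[P]_w (\prod_(j < m.+1) g j (chain (k + j) w))%:E =
   \int[P]_w (\prod_(j < m.+1) g j (chain j w))%:E)%E.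
Proof.
elim: m g k => [|m IH] g k ug kmN.
  transitivity (\int[P]_w (g 0%N (chain k w))%:E)%E.
    by apply: eq_integral => w _; rewrite big_ord1 addn0.
  transitivity (\int[P]_w (g 0%N (chain 0 w))%:E)%E.
    by apply: chain_law => //; rewrite addn0 in kmN.
  by apply: eq_integral => w _; rewrite big_ord1.
(* Integrating out the last step merges the last two factors into one. *)
pose g' j := if (j == m)%N then (fun x => g m x * transition (g m.+1) x) else g j.
have ug' j : unit_fun (g' j).
  rewrite /g'; case: ifP => // _.
  have [m1 h1] := ug m; have [m2 h2] := unit_transition (ug m.+1).
  split; first exact: measurable_funM.
  move=> x; case/andP: (h1 x) => a0 a1; case/andP: (h2 x) => b0 b1.
  by rewrite mulr_ge0//= mulr_ile1.
have step k' : (k' + m.+1 <= N)%N ->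
   (\int[P]_w (\prod_(j < m.+2) g j (chain (k' + j) w))%:E =
    \int[P]_w (\prod_(j < m.+1) g' j (chain (k' + j) w))%:E)%E.
  move=> k'N.
  pose Y w := \prod_(j < m.+1) g j (chain (k' + j) w).
  transitivity (\int[P]_w (Y w * g m.+1 (chain (k' + m).+1 w))%:E)%E.
    by apply: eq_integral => w _; rewrite big_ord_recr /= addnS.
  rewrite integral_chain_step//; last 3 first.
  - by rewrite -addnS.
  - rewrite /Y.
    apply: (@measurable_prod _ (past (node (k' + m))) R setT _ (index_enum 'I_m.+1) (fun (j : 'I_m.+1) w => g j (chain (k' + j) w))) => j _.
    apply: measurableT_comp; first by case: (ug j).
    by apply: measurable_chain_past; rewrite leq_add2l -ltnS.
  - by move=> w; apply: prodr_ge0 => j _; case: (ug j) => _ /(_ (chain (k' + j) w))/andP[].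
  apply: eq_integral => w _; congr (_%:E).
  rewrite /Y [LHS]mulrC !big_ord_recr /= /g' eqxx mulrC -mulrA; congr (_ * _).
  by apply: eq_bigr => j _; rewrite ltn_eqF.
rewrite step// (IH g' k ug'); last by apply: leq_trans kmN; rewrite addnS leqnSn.
have := step 0%N; rewrite add0n => -> //.
exact: leq_trans (leq_addl _ _) kmN.
Qed.

End Discrete.
End Chain.

(** * Everywhere continuous versions of the paths *)

Section Paths.
Context {R : realType}.
Implicit Types (L : R) (f g : R -> R).

(** Extending a path by its end values makes it continuous on the line. *)
Lemma within_continuous_clamp L f : 0 <= L -> {within `[0, L], continuous f} ->
  continuous (fun t : R => f (clamp 0 L t)).
Proof.
move=> L0 /subspace_continuousP cf t.
have ct : `[0, L]%classic (clamp 0 L t) by rewrite /= in_itv/=; exact: clamp_itv.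
apply: (cvg_comp _ _ _ (cf _ ct)).
move=> U /= hU; have := @continuous_clamp _ 0 L t _ hU; rewrite /= => h.
near=> s; have : `[0, L]%classic (clamp 0 L s) by rewrite /= in_itv/=; exact: clamp_itv.
by near: s; exact: h.
Unshelve. all: by end_near. Qed.

(** The drift is an integral of an integrable function and the noise is continuous, so the equation
    itself gives the continuity of the path. *)
Lemma ou_path_continuous L (a r x0 : R) f g : 0 < L ->
  lebesgue_measure.-integrable `[0, L] (fun s => (f s)%:E) ->
  {within `[0, L], continuous g} ->
  (forall y, 0 <= y <= L ->
     f y = x0 - a * (\int[lebesgue_measure]_(s in `[0, y]) f s) + r * (g y - g 0)) ->
  {within `[0, L], continuous f}.
Proof.
move=> L0 intf cg hf.
have c1 : {within `[0, L], continuous (fun x => \int[lebesgue_measure]_(s in `[0, x]) f s)}.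
  exact: (parameterized_integral_continuous (ltW L0) intf).
pose F y : R := x0 - a * (\int[lebesgue_measure]_(s in `[0, y]) f s) + r * (g y - g 0).
have cF : {within `[0, L], continuous F}.
  move=> y; apply: cvgD.
    by apply: cvgB; [exact: cvg_cst|apply: cvgM; [exact: cvg_cst|exact: c1]].
  by apply: cvgM; [exact: cvg_cst|apply: cvgB; [exact: cg|exact: cvg_cst]].
apply: (subspace_eq_continuous _ cF) => y.
rewrite inE /= in_itv/= => yL; exact/esym/hf.
Qed.

End Paths.

Section Modification.
Context {d : measure_display} {T : measurableType d} {R : realType}.
Variable P : probability T R.
Variables (L a r : R) (W : R -> {RV P >-> R}) (X0 : {RV P >-> R}) (X : R -> {RV P >-> R}).
Hypothesis L0 : 0 < L.

(** What remains of the hypotheses on the process and its noise once null sets are removed. *)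
Definition regular_ou (Y V : R -> T -> R) : Prop :=
  [/\ (forall t, measurable_fun setT (Y t)), (forall t, measurable_fun setT (V t)),
      (forall w, continuous (Y^~ w)), (forall w, continuous (V^~ w)) &
      (forall w, V 0 w = 0 /\ forall y, 0 <= y <= L ->
         Y y w = Y 0 w - a * prim (Y^~ w) y + r * V y w)].

(** The exceptional paths lie in a measurable null set and are replaced by 0 there. *)
Lemma regular_modification : wiener_process L W -> ou_solution L a r W X0 X ->
  exists Y V, [/\ regular_ou Y V, forall t w, Y t w = Y (clamp 0 L t) w,
    {ae P, forall w, Y 0 w = X0 w /\ forall t, 0 <= t <= L -> Y t w = X t w /\ V t w = W t w} &
    {ae P, forall w, {within `[0, L], continuous (fun y => X y w)}}].
Proof.
move=> [W00 _ _ cW] hX.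
pose good w := [/\ W 0 w = 0, {within `[0, L], continuous (fun t => W t w)},
  {within `[0, L], continuous (fun t => X t w)}, X 0 w = X0 w &
  forall y, 0 <= y <= L ->
   X y w = X0 w - a * (\int[lebesgue_measure]_(s in `[0, y]) X s w) + r * (W y w - W 0 w)].
have aegood : {ae P, forall w, good w}.
  near=> w.
  have w0 : W 0 w = 0 by near: w; exact: W00.
  have cw : {within `[0, L], continuous (fun t => W t w)} by near: w; exact: cW.
  have [x0 ix hx] : [/\ X 0 w = X0 w,
    lebesgue_measure.-integrable `[0, L] (fun s => (X s w)%:E) &
        forall y, 0 <= y <= L ->
          X y w = X0 w - a * (\int[lebesgue_measure]_(s in `[0, y]) X s w)
                  + r * (W y w - W 0 w)] by near: w; exact: hX.
  by split => //; exact: (ou_path_continuous L0 ix cw hx).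
have [N [mN N0 subN]] := aegood.
have NP w : ~ N w -> good w by move=> Nw; apply: contrapT => ng; exact: Nw (subN _ ng).
(* The indicator removes the bad paths and the clamp extends the good ones by constants. *)
pose chi : T -> R := \1_(~` N).
have mchi : measurable_fun setT chi by apply: measurable_indic; exact: measurableC.
have chi0 w : N w -> chi w = 0 by move=> Nw; rewrite /chi indicE memNset//; exact.
have chi1 w : ~ N w -> chi w = 1 by move=> Nw; rewrite /chi indicE mem_set.
exists (fun t w => chi w * X (clamp 0 L t) w), (fun t w => chi w * W (clamp 0 L t) w).
have cX w : continuous (fun t : R => chi w * X (clamp 0 L t) w).
  have [Nw|Nw] := pselect (N w).
    by rewrite chi0// => t; under eq_fun do rewrite mul0r; exact: cvg_cst.
  have [_ _ h _ _] := NP w Nw.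
  by move=> t; apply: cvgM; [exact: cvg_cst|exact: (within_continuous_clamp (ltW L0) h)].
have cW' w : continuous (fun t : R => chi w * W (clamp 0 L t) w).
  have [Nw|Nw] := pselect (N w).
    by rewrite chi0// => t; under eq_fun do rewrite mul0r; exact: cvg_cst.
  have [_ h _ _ _] := NP w Nw.
  by move=> t; apply: cvgM; [exact: cvg_cst|exact: (within_continuous_clamp (ltW L0) h)].
have in0 : 0 <= (0 : R) <= L by rewrite lexx ltW.
split.
- split => //.
  + by move=> t; apply: measurable_funM.
  + by move=> t; apply: measurable_funM.
  + move=> w; have [Nw|Nw] := pselect (N w).
      rewrite chi0//; split; first by rewrite mul0r.
      move=> y /andP[y0 yL].
      rewrite !mul0r mulr0 addr0 sub0r.
      have -> : prim (fun t => 0 * X (clamp 0 L t) w) y = 0.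
        rewrite (_ : (fun t => _) = fun=> 0); last by apply/funext => t; rewrite mul0r.
        apply: (@prim_unique _ (fun=> 0) (fun=> 0)) => //.
        - exact: cst_continuous.
        - by move=> x; exact: cvg_cst.
      by rewrite (mulr0 a) oppr0.
    have [w0 _ cx x0 hx] := NP w Nw; rewrite chi1//; split.
      by rewrite mul1r clamp_id// w0.
    move=> y yL; rewrite !mul1r !clamp_id// hx// w0 subr0 x0; congr (_ - a * _ + _).
    case/andP: yL => y0 yL.
    rewrite -Rintegral_prim//; last by have := cX w; rewrite chi1.
    apply: eq_Rintegral => s; rewrite inE /= in_itv/= => /andP[s0 sy].
    by rewrite mul1r clamp_id// s0 (le_trans sy).
- by move=> t w; rewrite [clamp 0 L (clamp 0 L t)]clamp_id// clamp_itv// ltW.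
- exists N; split => // w /= h; apply: contrapT => Nw; apply: h.
  have [_ _ _ x0 _] := NP w Nw.
  by rewrite chi1// mul1r clamp_id//; split => // t tL; rewrite !mul1r clamp_id.
- by apply: filterS aegood => w [].
Unshelve. all: by end_near. Qed.

End Modification.

(** * Convergence of the chain to the path *)

Section Euler.
Context {R : realType}.
Implicit Types (f g b : R -> R) (s h omega B y t : R).

Variables (a r L : R) (f g : R -> R).
Hypotheses (a0 : 0 < a) (r0 : 0 < r) (L0 : 0 < L).
Hypotheses (cf : continuous f) (cg : continuous g) (g0 : g 0 = 0).
Hypothesis ou : forall y, 0 <= y <= L -> f y = f 0 - a * prim f y + r * g y.

(** The difference [f - r * g] is differentiable although the path is not. Shifted by the frozen noise
    [r * g s], it decays at the exact rate of the equation, up to the oscillation of the noise. *)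
Lemma ou_step s h omega : 0 <= s -> 0 <= h -> s + h <= L ->
  (forall u, s <= u <= s + h -> `|g u - g s| <= omega) ->
  `|f (s + h) - r * g (s + h) + r * g s - expR (- (a * h)) * (f s - r * g s + r * g s)|
    <= r * omega * (1 - expR (- (a * h))).
Proof.
move=> s0 h0 shL gom; pose Y u := f u - r * g u; rewrite -/(Y _) -/(Y s).
have om0 : 0 <= omega by apply: le_trans (gom s _); rewrite ?normr_ge0// lexx lerDl.
pose Y' u := f 0 - a * prim f u.
have YE (u : R) : 0 <= u <= L -> Y u = Y' u.
  by move=> uL; rewrite /Y ou// /Y'; lra.
have dY (u : R) : is_derive u 1 Y' (- a * f u).
  have h1 := der_sub (der_cst (f 0) u) (der_scal a (is_derive_prim u (@cf))).
  by apply: (is_derive_eq h1); rewrite sub0r mulNr.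
have cY : continuous Y' by move=> u; apply: is_derive_continuous (dY u).
have dE (u : R) : is_derive u 1 (fun u => expR (a * u)) (a * expR (a * u)).
  by have h1 := der_expR (der_lin a u); apply: (is_derive_eq h1); rewrite mulrC.
(* Z' = - a exp (a u) r (g u - g s). *)
pose Z u := expR (a * u) * (Y' u + r * g s).
have dZ (u : R) : s < u < s + h -> is_derive u 1 Z (- (a * expR (a * u)) * (r * (g u - g s))).
  move=> ush; have h1 := der_mul (dE u) (der_add (dY u) (der_cst (r * g s) u)); apply: (is_derive_eq h1).
  have -> : Y' u = f u - r * g u by rewrite -YE//; lra.
  by ring.
have dG (u : R) : is_derive u 1 (fun u => (r * omega) * expR (a * u)) ((r * omega) * (a * expR (a * u))).
  exact: der_scal.
have cont (F F' : R -> R) : (forall u : R, is_derive u 1 F (F' u)) -> {within `[s, s + h], continuous F}.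
  by move=> h1; apply: continuous_itv; exact: continuous_derive h1.
have ssh : s <= s + h by rewrite lerDl.
have := @norm_derive_comparison _ _ _ _ _ s (s + h) ssh dZ (fun u _ => dG u) _ (cont _ _ dG) _.
move=> h1.
have {}h1 : `|Z (s + h) - Z s| <= r * omega * expR (a * (s + h)) - r * omega * expR (a * s).
  apply: h1.
  - apply: continuous_itv => u; apply: cvgM; first exact: is_derive_continuous (dE u).
    by apply: cvgD; [exact: cY|exact: cvg_cst].
  - move=> u ush; rewrite normrM normrN normrM (gtr0_norm a0) (gtr0_norm (expR_gt0 _)).
    rewrite normrM (gtr0_norm r0) [X in _ <= X]mulrC.
    apply: ler_pM => //; [by apply: mulr_ge0; [exact: ltW|exact: expR_ge0]|by apply: mulr_ge0 => //; exact: ltW|].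
    by rewrite ler_pM2l// gom//; lra.
rewrite YE; last by lra.
rewrite YE; last by lra.
rewrite -(ler_pM2l (expR_gt0 (a * (s + h)))).
rewrite -[X in X * `|_|](gtr0_norm (expR_gt0 _)) -normrM.
have eE : expR (a * (s + h)) * expR (- (a * h)) = expR (a * s).
  by rewrite -expRD; congr expR; ring.
have -> : expR (a * (s + h)) * (Y' (s + h) + r * g s - expR (- (a * h)) * (Y' s + r * g s)) = Z (s + h) - Z s.
  by rewrite /Z -eE; ring.
apply: (le_trans h1); rewrite -eE le_eqVlt; apply/orP; left; apply/eqP; ring.
Qed.

(** A single step over the whole of [[0, y]], with the noise frozen at its initial value 0. *)
Lemma ou_path_le B y : (forall y, 0 <= y <= L -> `|g y| <= B) -> 0 <= y <= L ->
  `|f y| <= `|f 0| + 2 * r * B.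
Proof.
move=> gB yL; have /andP[y0 yL'] := yL.
have h : `|f y - r * g y - expR (- (a * y)) * f 0| <= r * B * (1 - expR (- (a * y))).
  have := @ou_step 0 y B (lexx 0) y0; rewrite add0r g0 mulr0 !addr0 subr0; apply => //.
  by move=> u /andP[u0 uy]; rewrite subr0 gB// u0 (le_trans uy).
have e0 := expR_ge0 (- (a * y)).
have e1 : expR (- (a * y)) <= 1 by rewrite -[leRHS]expR0 ler_expR oppr_le0 mulr_ge0// ltW.
have B0 : 0 <= B := le_trans (normr_ge0 _) (gB y yL).
have rB0 : 0 <= r * B by rewrite mulr_ge0// ltW.
have h1 : r * `|g y| <= r * B by rewrite ler_pM2l// gB.
have h2 : expR (- (a * y)) * `|f 0| <= `|f 0| by rewrite ler_piMl.
have h3 : r * B * (1 - expR (- (a * y))) <= r * B by rewrite ler_piMr// gerBl.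
have -> : f y = (f y - r * g y - expR (- (a * y)) * f 0) + r * g y + expR (- (a * y)) * f 0 by ring.
apply: (le_trans (ler_normD _ _)); apply: (le_trans (lerD (ler_normD _ _) (lexx _))).
by rewrite !normrM (gtr0_norm r0) (ger0_norm e0); lra.
Qed.

Definition theta (N : nat) : R := expR (- (a * (L / N%:R))).
(** The noise coefficient for which the chain with factor [theta] has the stationary variance of the
    process; it differs from [r] by a term of the order of the mesh. *)
Definition sigma (N : nat) : R :=
  r * Num.sqrt ((1 - expR (- (2 * a * (L / N%:R)))) / (2 * a * (L / N%:R))).

Lemma theta_bounds N : 0 <= theta N <= 1.
Proof.
rewrite expR_ge0/= /theta -[X in _ <= X]expR0 ler_expR oppr_le0.
by apply: mulr_ge0; [exact: ltW|rewrite divr_ge0// ltW].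
Qed.

(** Both bounds come from [1 + x <= exp x]. *)
Lemma quotient_bounds (x : R) : 0 < x -> 1 - x <= (1 - expR (- x)) / x <= 1.
Proof.
move=> x0; have h1 := expR_ge1Dx (- x); have h2 := expR_ge1Dx x.
have e0 := expR_gt0 (- x).
rewrite ler_pdivlMr// ler_pdivrMr// mul1r; apply/andP; split; last by lra.
have : expR x * expR (- x) = 1 by rewrite -expRD subrr expR0.
have : (1 + x) * expR (- x) <= expR x * expR (- x) by rewrite ler_pM2r.
by nra.
Qed.

Lemma mesh_gt0 N : (0 < N)%N -> 0 < 2 * a * (L / N%:R).
Proof. by move=> N0; apply: mulr_gt0; [rewrite mulr_gt0|rewrite divr_gt0// ltr0n]. Qed.

Lemma sigma_gt0 N : (0 < N)%N -> 0 < sigma N.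
Proof.
move=> N0; have m0 := mesh_gt0 N0; rewrite /sigma mulr_gt0// sqrtr_gt0 divr_gt0// subr_gt0.
by rewrite -[X in _ < X]expR0 ltr_expR oppr_lt0.
Qed.

Lemma sigma_le N : (0 < N)%N -> `|r - sigma N| <= r * (2 * a * L / N%:R).
Proof.
move=> N0; have m0 := mesh_gt0 N0; rewrite /sigma.
set x := 2 * a * (L / N%:R) in m0 *; have /andP[q1 q2] := quotient_bounds m0.
set q := (1 - _) / x in q1 q2 *.
rewrite -[X in `|X - _|]mulr1 -mulrBr normrM (gtr0_norm r0) ler_pM2l//.
rewrite (_ : 2 * a * L / N%:R = x); last by rewrite /x mulrA.
have [q0|q0] := leP 0 q; last by rewrite ler0_sqrtr ?(ltW q0)// subr0 normr1; lra.
have s0 := sqrtr_ge0 q; have sq := sqr_sqrtr q0.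
by rewrite ler_norml; apply/andP; split; nra.
Qed.

Lemma sigma_balance N p : (0 < N)%N -> p ^+ 2 = r ^+ 2 / (2 * a) ->
  (sigma N * Num.sqrt (L / N%:R)) ^+ 2 = p ^+ 2 * (1 - theta N ^+ 2).
Proof.
move=> N0 ->; have m0 := mesh_gt0 N0; rewrite /sigma !exprMn.
have /andP[q1 q2] := quotient_bounds m0.
have h0 : 0 < L / N%:R by rewrite divr_gt0// ltr0n.
have -> : theta N ^+ 2 = expR (- (2 * a * (L / N%:R))).
  by rewrite /theta -expRM_natl; congr expR; rewrite -mulr_natl; ring.
rewrite !sqr_sqrtr ?(ltW h0)//.
  by set e := expR _; set h := L / _ in m0 h0 *; field; rewrite !gt_eqF.
rewrite divr_ge0 ?(ltW m0)// subr_ge0 -[X in _ <= X]expR0 ler_expR oppr_le0 ltW//.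
Qed.

(** The recursion of [chain] with coefficients [theta] and [sigma], along a single noise path. *)
Fixpoint path_chain (N : nat) (k : nat) : R :=
  if k is k'.+1 then theta N * path_chain N k' + sigma N * (g (node L N k) - g (node L N k'))
  else f 0.

(** Once the noise is subtracted, the path and the chain obey nearly the same contracting recursion.
    The error of a step is proportional to [1 - theta], so errors do not accumulate over the [N]
    steps. *)
Lemma path_chain_error N B omega k : (0 < N)%N -> (k <= N)%N ->
  (forall y, 0 <= y <= L -> `|g y| <= B) ->
  (forall s u, 0 <= s <= L -> 0 <= u <= L -> `|s - u| <= L / N%:R -> `|g u - g s| <= omega) ->
  `|f (node L N k) - path_chain N k| <= 2 * `|r - sigma N| * B + r * omega.
Proof.
move=> N0 kN gB gom; pose Y u := f u - r * g u.
(* y and f - r g obey the same recursion up to the error of one step. *)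
pose y j := path_chain N j - sigma N * g (node L N j).
set rs := `|r - sigma N|; have rs0 : 0 <= rs by exact: normr_ge0.
have B0 : 0 <= B by apply: le_trans (gB 0 _); rewrite ?normr_ge0 ?lexx ?ltW.
have om0 : 0 <= omega.
  by apply: le_trans (gom 0 0 _ _ _); rewrite ?normr_ge0 ?subrr ?normr0 ?lexx ?(ltW L0)// divr_ge0// ltW.
have nodeL j : (j <= N)%N -> 0 <= node L N j <= L.
  by move=> jN; rewrite (node_ge0 L0)//= (node_le L0).
have e j : (j <= N)%N -> `|Y (node L N j) - y j| <= rs * B + r * omega.
  elim: j => [_|j IH jN].
    rewrite /Y /y /= /node !mul0r g0 !mulr0 subrr normr0.
    by apply: addr_ge0; apply: mulr_ge0 => //; exact: ltW.
  have {}IH := IH (ltnW jN).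
  have yS : y j.+1 = theta N * y j - (1 - theta N) * (sigma N * g (node L N j)).
    by rewrite /y /=; ring.
  have nS : node L N j.+1 = node L N j + L / N%:R by rewrite -(nodeS L N j); lra.
  have h0 : 0 <= L / N%:R by rewrite divr_ge0// ltW.
  have /andP[n0 nL] := nodeL j (ltnW jN); have /andP[n0' nL'] := nodeL _ jN.
  have stp : `|Y (node L N j.+1) + r * g (node L N j) -
     theta N * (Y (node L N j) + r * g (node L N j))| <= r * omega * (1 - theta N).
    rewrite nS; apply: ou_step => //; first by rewrite -nS.
    move=> u /andP[su ush]; apply: gom; first by rewrite n0.
      by rewrite (le_trans n0 su)/= (le_trans ush)// -nS.
    by rewrite ler0_norm ?subr_le0//; lra.
  have /andP[th0 th1] := theta_bounds N.
  have hg := gB _ (nodeL j (ltnW jN)).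
  rewrite yS.
  set A := Y (node L N j.+1) in stp *; set Bj := Y (node L N j) in stp IH *.
  set gj := g _ in stp hg *.
  have -> : A - (theta N * y j - (1 - theta N) * (sigma N * gj)) =
     (A + r * gj - theta N * (Bj + r * gj)) + theta N * (Bj - y j)
       + (1 - theta N) * ((sigma N - r) * gj) by ring.
  have h2 : `|theta N * (Bj - y j)| <= theta N * (rs * B + r * omega).
    by rewrite normrM (ger0_norm th0) ler_wpM2l.
  have h3 : `|(1 - theta N) * ((sigma N - r) * gj)| <= (1 - theta N) * (rs * B).
    rewrite normrM ger0_norm ?subr_ge0// ler_wpM2l ?subr_ge0//.
    by rewrite normrM distrC ler_wpM2l.
  apply: (le_trans (ler_normD _ _)); apply: (le_trans (lerD (ler_normD _ _) h3)).
  apply: (le_trans (lerD (lerD stp h2) (lexx _))).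
  by rewrite le_eqVlt; apply/orP; left; apply/eqP; ring.
have {}e := e k kN; have hg := gB _ (nodeL k kN).
have -> : f (node L N k) - path_chain N k = (Y (node L N k) - y k) + (r - sigma N) * g (node L N k).
  by rewrite /Y /y; ring.
apply: (le_trans (ler_normD _ _)); apply: (le_trans (lerD e (lexx _))).
rewrite normrM -/rs; have : rs * `|g (node L N k)| <= rs * B by rewrite ler_wpM2l.
by lra.
Qed.

Lemma path_chain_cvg (k : nat -> nat) t : 0 <= t <= L ->
  (forall N, (k N.+1 <= N.+1)%N) -> (node L N.+1 (k N.+1)) @[N --> \oo] --> t ->
  (path_chain N.+1 (k N.+1)) @[N --> \oo] --> f t.
Proof.
move=> tL kN kt.
have [B B0 gB] := @continuous_bounded R g 0 L (@cg).
suff H : (f (node L N.+1 (k N.+1)) - path_chain N.+1 (k N.+1)) @[N --> \oo] --> (0 : R).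
  have h1 := cvg_comp _ _ kt (@cf t).
  have h : (f (node L N.+1 (k N.+1)) - (f (node L N.+1 (k N.+1)) - path_chain N.+1 (k N.+1)))
      @[N --> \oo] --> f t - 0 := cvgB h1 H.
  rewrite subr0 in h; rewrite (_ : (fun N : nat => path_chain N.+1 (k N.+1)) =
    (fun N => f (node L N.+1 (k N.+1)) - (f (node L N.+1 (k N.+1)) - path_chain N.+1 (k N.+1)))); first exact: h.
  by apply/funext => N; rewrite opprB addrC subrK.
have invN : (N.+1%:R^-1 : R) @[N --> \oo] --> 0 by exact: cvg_harmonic.
apply/cvgrPdist_le => e e0.
have e1 : 0 < e / (2 * r) by rewrite divr_gt0// mulr_gt0.
have [eta eta0 heta] := @uniform_continuity _ g 0 L _ (@cg) e1.
near=> N; rewrite sub0r normrN.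
have N0 : (0 < N.+1)%N by [].
have hN : L / N.+1%:R < eta.
  near: N; have h : (L * N.+1%:R^-1 : R) @[N --> \oo] --> L * 0 by apply: cvgM => //; exact: cvg_cst.
  by rewrite mulr0 in h; move/cvgrPdist_lt : h => /(_ _ eta0); apply: filterS => N; rewrite sub0r normrN => /(le_lt_trans (ler_norm _)).
apply: (@le_trans _ _ (2 * (r * (2 * a * L / N.+1%:R)) * B + r * (e / (2 * r)))).
  apply: (le_trans (@path_chain_error N.+1 B (e / (2 * r)) _ N0 (kN N) gB _)).
    move=> s u sL uL su; rewrite distrC; apply/ltW/heta => //; exact: le_lt_trans hN.
  by rewrite lerD2r ler_wpM2r// ler_pM2l// sigma_le.
have -> : r * (e / (2 * r)) = e / 2 by field; rewrite gt_eqF.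
rewrite [X in _ <= X](splitr e) lerD2r.
near: N; have h : ((2 * r * 2 * a * L * B) * N.+1%:R^-1 : R) @[N --> \oo] --> (2 * r * 2 * a * L * B) * 0.
  by apply: cvgM => //; exact: cvg_cst.
have e2 : 0 < e / 2 by rewrite divr_gt0.
rewrite mulr0 in h; move/cvgrPdist_le : h => /(_ _ e2); apply: filterS => N; rewrite sub0r normrN.
by move/(le_trans (ler_norm _)); apply: le_trans; rewrite le_eqVlt; apply/orP; left; apply/eqP; ring.
Unshelve. all: by end_near. Qed.

End Euler.

(** * Laws of random tuples *)

Section TupleLaw.
Context {d : measure_display} {T : measurableType d} {R : realType}.
Variable P : probability T R.
Implicit Types (f : R -> R) (A : set R).

(** The pointwise limits through which the equality of expectations passes from continuous functions
    to indicators. *)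
Definition approximable f := exists phi : nat -> R -> R,
  [/\ (forall m, continuous (phi m)), (forall m x, 0 <= phi m x <= 1) &
      forall x, (phi m x) @[m --> \oo] --> f x].

Lemma approximableM f1 f2 : approximable f1 -> approximable f2 ->
  approximable (fun x => f1 x * f2 x).
Proof.
move=> [phi1 [c1 b1 l1]] [phi2 [c2 b2 l2]].
exists (fun m x => phi1 m x * phi2 m x); split.
- by move=> m x; apply: cvgM; [exact: c1|exact: c2].
- move=> m x; case/andP: (b1 m x) => p0 p1; case/andP: (b2 m x) => q0 q1.
  by rewrite mulr_ge0//= mulr_ile1.
- by move=> x; apply: cvgM; [exact: l1|exact: l2].
Qed.

Lemma approximable_ray (c : R) : approximable \1_(`]c, +oo[).
Proof.
exists (fun m x => Num.max 0 (Num.min 1 (m%:R * (x - c)))); split.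
- move=> m x; apply: (@continuous_max _ _ (cst 0) (fun x => Num.min 1 (m%:R * (x - c)))); first exact: cvg_cst.
  apply: (@continuous_min _ _ (cst 1) (fun x => m%:R * (x - c))); first exact: cvg_cst.
  by apply: cvgM; [exact: cvg_cst|apply: cvgB; [exact: cvg_id|exact: cvg_cst]].
- by move=> m x; rewrite le_max lexx/= ge_max ler01/= ge_min lexx.
- move=> x; rewrite indicE; have [xc|cx] := leP x c.
    rewrite memNset/=; last by rewrite in_itv/= andbT; apply/negP; rewrite -leNgt.
    rewrite (_ : (fun m => _) = cst 0); first exact: cvg_cst.
    apply/funext => m; apply/max_idPl; rewrite ge_min; apply/orP; right.
    by rewrite mulr_ge0_le0// subr_le0.
  rewrite mem_set/=; last by rewrite in_itv/= andbT.
  apply: cvg_near_cst.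
  have xc0 : 0 < x - c by rewrite subr_gt0.
  near=> m; rewrite (min_idPl _) ?(max_idPr _)//.
  rewrite -ler_pdivrMr// div1r ltW//.
  by near: m; exact: nbhs_infty_gtr.
Unshelve. all: by end_near. Qed.

Lemma approximable1 : approximable (fun=> 1).
Proof.
exists (fun _ _ => 1); split => [m x|m x|x]; [exact: cvg_cst|by rewrite ler01 lexx|exact: cvg_cst].
Qed.

Lemma prod_cvg n (u : nat -> 'I_n -> R) (l : 'I_n -> R) :
  (forall i, u m i @[m --> \oo] --> l i) -> \prod_i u m i @[m --> \oo] --> \prod_i l i.
Proof.
move=> ul; elim: (index_enum _) => [|i s IH].
  by rewrite big_nil (_ : (fun m => _) = cst 1); [exact: cvg_cst|apply/funext => m; rewrite big_nil].
rewrite big_cons (_ : (fun m => _) = (fun m => u m i * \prod_(j <- s) u m j)).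
  by apply: cvgM; [exact: ul|exact: IH].
by apply/funext => m; rewrite big_cons.
Qed.

Lemma expect_prod_approximable n (U V : 'I_n -> T -> R) :
  (forall i, measurable_fun setT (U i)) -> (forall i, measurable_fun setT (V i)) ->
  (forall f : 'I_n -> R -> R, (forall i, continuous (f i)) -> (forall i x, 0 <= f i x <= 1) ->
     expect P (fun w => \prod_i f i (U i w)) = expect P (fun w => \prod_i f i (V i w))) ->
  forall f : 'I_n -> R -> R, (forall i, approximable (f i)) ->
     expect P (fun w => \prod_i f i (U i w)) = expect P (fun w => \prod_i f i (V i w)).
Proof.
move=> mU mV H f af.
have /choice [phi hphi] i : exists phi : nat -> R -> R,
  [/\ (forall m, continuous (phi m)), (forall m x, 0 <= phi m x <= 1) &
      forall x, (phi m x) @[m --> \oo] --> f i x] := af i.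
have cv (Z : 'I_n -> T -> R) : (forall i, measurable_fun setT (Z i)) ->
  (expect P (fun w => \prod_i phi i m (Z i w))) @[m --> \oo] --> expect P (fun w => \prod_i f i (Z i w)).
  move=> mZ.
  have [||||_ //] := @expect_cvg _ _ _ P (fun m w => \prod_i phi i m (Z i w)) (fun w => \prod_i f i (Z i w)) (fun=> 1).
  - move=> m; apply: (@measurable_prod _ T R setT _ (index_enum 'I_n) (fun i w => phi i m (Z i w))) => i _.
    apply: measurableT_comp => //; apply: continuous_measurable_fun.
    by case: (hphi i).
  - by move=> w; apply: prod_cvg => i; case: (hphi i).
  - exact: integ_cst.
  - move=> m w; rewrite ger0_norm; last by apply: prodr_ge0 => i _; case: (hphi i) => _ /(_ m (Z i w))/andP[].
    by apply: prodr_ile1 => i _; case: (hphi i) => _ /(_ m (Z i w)).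
apply: (@cvg_unique _ (@Rhausdorff R) _ _ _ _ (cv _ mU)).
have e : (fun m => expect P (fun w => \prod_i phi i m (U i w))) = (fun m => expect P (fun w => \prod_i phi i m (V i w))).
  by apply/funext => m; apply: (H (fun i => phi i m)) => [i|i x]; case: (hphi i).
by rewrite e; exact: cv.
Qed.

Lemma measurable_tuple_fun n (Z : 'I_n -> T -> R) : (forall i, measurable_fun setT (Z i)) ->
  measurable_fun setT (fun w => [tuple Z i w | i < n] : n.-tuple R).
Proof.
move=> mZ; apply/measurable_fun_tnthP => i.
by rewrite (_ : _ \o _ = Z i)//; apply/funext => w /=; rewrite tnth_mktuple.
Qed.

(** The boxes with approximable sides are stable under intersection and generate the product
    sigma-algebra, as they include the half-lines in each coordinate. *)
Lemma tuple_law n (U V : 'I_n -> T -> R) :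
  (forall i, measurable_fun setT (U i)) -> (forall i, measurable_fun setT (V i)) ->
  (forall f : 'I_n -> R -> R, (forall i, continuous (f i)) -> (forall i x, 0 <= f i x <= 1) ->
     expect P (fun w => \prod_i f i (U i w)) = expect P (fun w => \prod_i f i (V i w))) ->
  forall B : set (n.-tuple R), measurable B ->
    P [set w | B [tuple U i w | i < n]] = P [set w | B [tuple V i w | i < n]].
Proof.
move=> mU mV H.
have mtup := @measurable_tuple_fun n.
pose box (A : 'I_n -> set R) : set (n.-tuple R) := [set x | forall i, A i (tnth x i)].
pose G : set (set (n.-tuple R)) := [set C | exists A : 'I_n -> set R,
  [/\ forall i, measurable (A i), forall i, approximable \1_(A i) & C = box A]].
have mbox (A : 'I_n -> set R) : (forall i, measurable (A i)) -> measurable (box A).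
  move=> mA; rewrite (_ : box A = \bigcap_(i in [set: 'I_n]) ((@tnth n R)^~ i @^-1` A i)).
    apply: fin_bigcap_measurable => // i _.
    by rewrite -[X in measurable X]setTI; exact: (@measurable_tnth _ R n i).
  by apply/seteqP; split => x /= h i; [move=> _; exact: h|exact: h].
have Pbox (Z : 'I_n -> T -> R) (A : 'I_n -> set R) : (forall i, measurable_fun setT (Z i)) -> (forall i, measurable (A i)) ->
   P [set w | box A [tuple Z i w | i < n]] = (expect P (fun w => \prod_i \1_(A i) (Z i w)))%:E.
  move=> mZ mA; rewrite expectE.
    set S := [set w | _].
    have mS : measurable S by have := mtup Z mZ measurableT _ (mbox A mA); rewrite setTI.
    rewrite -(setIT S) -integral_indic//; apply: eq_integral => w _; congr (_%:E).
    rewrite indicE; have [/set_mem wS|/negP wS] := boolP (w \in S).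
      by rewrite big1// => i _; rewrite indicE mem_set//; have := wS i; rewrite tnth_mktuple.
    apply/esym/eqP; rewrite prodf_seq_eq0; apply/hasP.
    have /existsNP [i hi] : ~ forall i, A i (Z i w).
      by move=> h; apply: wS; apply/mem_set => i; rewrite tnth_mktuple.
    by exists i; rewrite ?mem_index_enum//= indicE memNset.
  apply: (@integ_le _ _ _ P _ (fun=> 1)).
  - apply: (@measurable_prod _ T R setT _ (index_enum 'I_n) (fun i w => \1_(A i) (Z i w))) => i _.
    by apply: measurableT_comp => //; exact: measurable_indic.
  - move=> w; rewrite ger0_norm; last by apply: prodr_ge0 => i _; rewrite indicE.
    by apply: prodr_ile1 => i _; rewrite indicE ler0n lern1 leq_b1.
  - exact: integ_cst.
have GE : @measurable _ (n.-tuple R) = <<s G >>.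
  apply/seteqP; split.
    apply: smallest_sub; first exact: smallest_sigma_algebra.
    rewrite -bigcup_seq => C [i /= _] [A mA <-].
    rewrite setTI.
    have eA := congr1 (fun S => S A) (RGenOInfty.measurableE R).
    have : <<s @RGenOInfty.G R >> A by exact: (eq_ind _ id mA _ eA).
    pose D : set (set R) := [set A | <<s G >> ((@tnth n R)^~ i @^-1` A)].
    suff : <<s @RGenOInfty.G R >> `<=` D by exact.
    apply: smallest_sub.
      split.
      - by rewrite /D /= preimage_set0; exact: sigma_algebra0.
      - by move=> A' hA'; rewrite /D /= setTD preimage_setC; exact: (sigma_algebraC hA').
      - by move=> F hF; rewrite /D /= preimage_bigcup; exact: sigma_algebra_bigcup.
    move=> A' [x ->]; rewrite /D /=; apply: sub_sigma_algebra.
    exists (fun j => if j == i then `]x, +oo[%classic else setT); split.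
    + by move=> j; case: ifP.
    + move=> j; case: ifP => _; first exact: approximable_ray.
      by rewrite indicT; exact: approximable1.
    + apply/seteqP; split => t /= ht; last by have := ht i; rewrite eqxx.
      by move=> j; case: eqP => // ->.
  apply: smallest_sub; first exact: sigma_algebra_measurable.
  by move=> C [A [mA _ ->]]; exact: mbox.
move=> B mB.
have mpre (Z : 'I_n -> T -> R) (C : set (n.-tuple R)) : (forall i, measurable_fun setT (Z i)) -> measurable C ->
   measurable [set w | C [tuple Z i w | i < n]].
  by move=> mZ mC; have := mtup Z mZ measurableT _ mC; rewrite setTI.
apply: (@dynkin_induction _ (n.-tuple R) G
  (fun B => P [set w | B [tuple U i w | i < n]] = P [set w | B [tuple V i w | i < n]])) => //.
- move=> _ _ [A1 [m1 a1 ->]] [A2 [m2 a2 ->]].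
  exists (fun i => A1 i `&` A2 i); split.
  + by move=> i; exact: measurableI.
  + by move=> i; rewrite indicI; exact: approximableM.
  + by apply/seteqP; split => x /=; [move=> [h1 h2] i|move=> h; split => i; case: (h i)].
- move=> _ [A [mA aA ->]]; rewrite !Pbox//; congr (_%:E).
  by apply: (@expect_prod_approximable n U V mU mV H (fun i => \1_(A i))).
- move=> S mS hS.
  have e (Z : 'I_n -> T -> R) : [set w | (~` S) [tuple Z i w | i < n]] = ~` [set w | S [tuple Z i w | i < n]] by [].
  by rewrite !e !probability_setC ?hS//; exact: mpre.
- move=> F mF tF hF.
  have e (Z : 'I_n -> T -> R) : [set w | (\bigcup_k F k) [tuple Z i w | i < n]] = \bigcup_k [set w | F k [tuple Z i w | i < n]].
    by apply/seteqP; split => w /= [k ? ?]; exists k.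
  have t (Z : 'I_n -> T -> R) : trivIset setT (fun k => [set w | F k [tuple Z i w | i < n]]).
    apply/trivIsetP => i j _ _ ij; have /trivIsetP/(_ i j I I ij) h := tF.
    apply/seteqP; split => // w [h1 h2].
    by have : (F i `&` F j) [tuple Z i w | i < n] by []; rewrite h.
  rewrite !e measure_bigcup//; last by move=> k _; exact: mpre.
  rewrite [RHS]measure_bigcup//; last by move=> k _; exact: mpre.
  by apply: eq_eseriesr => k _; exact: hF.
- by rewrite -GE.
Qed.

Lemma tuple_law_expect n (U V : 'I_n -> T -> R) (F : n.-tuple R -> R) :
  (forall i, measurable_fun setT (U i)) -> (forall i, measurable_fun setT (V i)) ->
  (forall B : set (n.-tuple R), measurable B ->
    P [set w | B [tuple U i w | i < n]] = P [set w | B [tuple V i w | i < n]]) ->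
  measurable_fun setT F ->
  integ P (fun w => F [tuple U i w | i < n]) -> integ P (fun w => F [tuple V i w | i < n]) ->
  expect P (fun w => F [tuple U i w | i < n]) = expect P (fun w => F [tuple V i w | i < n]).
Proof.
move=> mU mV H mF iU iV.
pose TU : {RV P >-> n.-tuple R} := HB.pack (fun w => [tuple U i w | i < n] : n.-tuple R)
  (isMeasurableFun.Build _ _ _ _ _ (measurable_tuple_fun mU)).
pose TV : {RV P >-> n.-tuple R} := HB.pack (fun w => [tuple V i w | i < n] : n.-tuple R)
  (isMeasurableFun.Build _ _ _ _ _ (measurable_tuple_fun mV)).
have mF' : measurable_fun setT (EFin \o F) by exact/measurable_EFinP.
rewrite /expect /Rintegral; congr fine.
have := @integral_distribution _ _ _ _ _ P TU (EFin \o F) mF' iU.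
have := @integral_distribution _ _ _ _ _ P TV (EFin \o F) mF' iV.
rewrite /comp /= => <- <-; apply: eq_measure_integral => A mA _; exact: H.
Qed.

End TupleLaw.

(** * Stationarity of the process *)

Section Stationarity.
Context {d : measure_display} {T : measurableType d} {R : realType}.
Variable P : probability T R.
Variables (a r L p : R) (W : R -> {RV P >-> R}) (X0 : {RV P >-> R}) (Y V : R -> T -> R).
Hypotheses (a0 : 0 < a) (r0 : 0 < r) (L0 : 0 < L) (p0 : 0 < p).
Hypothesis p2E : p ^+ 2 = r ^+ 2 / (2 * a).
Hypothesis lawW : forall s t, 0 <= s -> s < t -> t <= L -> gaussian_rv P (W t \- W s) 0 (t - s).
Hypothesis indW : forall s t, 0 <= s -> s < t -> t <= L ->
  independent_systems P (sigma_of_rv (W t \- W s)) (sigma_of_process `[0, s] W).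
Hypothesis lawX0 : gaussian_rv P X0 0 (p ^+ 2).
Hypothesis indX0 : independent_systems P (sigma_of_rv X0) (sigma_of_process `[0, L] W).
Hypothesis regYV : regular_ou L a r Y V.
Hypothesis aeYV : {ae P, forall w, Y 0 w = X0 w /\ forall t, 0 <= t <= L -> V t w = W t w}.

Let pchain N k w := path_chain a r L (Y^~ w) (V^~ w) N k.

Lemma measurable_pchain N k : measurable_fun setT (pchain N k).
Proof.
have [mY mV _ _ _] := regYV.
elim: k => [|k IH]; first exact: mY.
apply: (@measurable_funD _ _ _ setT (fun w => theta a L N * pchain N k w)
  (fun w => sigma a r L N * (V (node L N k.+1) w - V (node L N k) w))).
  exact: measurable_funM.
by apply: measurable_funM => //; exact: measurable_funB.
Qed.

Lemma ae_pchain_chain N : (0 < N)%N -> {ae P, forall w, forall k, (k <= N)%N ->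
  pchain N k w = chain L W X0 N (theta a L N) (sigma a r L N) k w}.
Proof.
move=> N0; apply: filterS aeYV => w [y0 vw]; elim=> [_|k IH kN]; first exact: y0.
rewrite /pchain /= -/(pchain N k w) IH; last exact: ltnW.
by rewrite !vw// (node_ge0 L0) (node_le L0)// ltnW.
Qed.

Lemma pchain_stationary N m (g : nat -> R -> R) k : (0 < N)%N ->
  (forall j, unit_fun (g j)) -> (k + m <= N)%N ->
  expect P (fun w => \prod_(j < m.+1) g j (pchain N (k + j) w)) =
  expect P (fun w => \prod_(j < m.+1) g j (pchain N j w)).
Proof.
move=> N0 ug kmN.
have toC k' : (k' + m <= N)%N -> expect P (fun w => \prod_(j < m.+1) g j (pchain N (k' + j) w)) =
   fine (\int[P]_w (\prod_(j < m.+1) g j (chain L W X0 N (theta a L N) (sigma a r L N) (k' + j) w))%:E)%E.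
  move=> k'N; rewrite /expect /Rintegral; congr fine; apply: integral_ae_eq_fun.
  apply: filterS (ae_pchain_chain N0) => w h; congr (_%:E).
  apply: eq_bigr => j _; rewrite h//; apply: leq_trans k'N; rewrite leq_add2l.
  by rewrite -ltnS.
have h0 : (0 + m <= N)%N by apply: leq_trans kmN; rewrite leq_add2r.
rewrite (toC _ kmN); have -> := toC 0%N h0; congr fine.
have H := @chain_stationary _ _ _ P L p W X0 L0 p0 lawW indW lawX0 indX0 N (theta a L N)
  (sigma a r L N) N0 (sigma_gt0 a0 r0 L0 N0).
by have -> := H (@sigma_balance R a r L a0 L0 N p N0 p2E) m g k ug kmN.
Qed.

Definition last_node (N : nat) (t : R) : nat := Num.truncn (t * N%:R / L).

Lemma last_node_itv N t : (0 < N)%N -> 0 <= t -> (last_node N t)%:R <= t * N%:R / L < (last_node N t).+1%:R.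
Proof.
by move=> N0 t0; apply: truncn_itv; rewrite divr_ge0 ?mulr_ge0// ltW.
Qed.

Lemma node_last_node N t : (0 < N)%N -> 0 <= t -> t - L / N%:R <= node L N (last_node N t) <= t.
Proof.
move=> N0 t0; have /andP[h1 h2] := last_node_itv N0 t0.
have NR : 0 < N%:R :> R by rewrite ltr0n.
have LN : 0 < L / N%:R by rewrite divr_gt0.
rewrite -(ler_pM2r LN) in h1; rewrite -(ltr_pM2r LN) -natr1 in h2.
have e1 : t * N%:R / L * (L / N%:R) = t by field; rewrite !gt_eqF.
have e2 : (last_node N t)%:R * (L / N%:R) = node L N (last_node N t) by rewrite /node mulrA.
rewrite mulrDl mul1r e1 e2 in h2; rewrite e1 e2 in h1.
by rewrite h1 andbT; lra.
Qed.

Lemma last_node_addn N t h : (0 < N)%N -> 0 <= t -> 0 <= h -> t + h <= L -> (last_node N h + last_node N t <= N)%N.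
Proof.
move=> N0 t0 h0 thL; rewrite -(ler_nat R) natrD.
have /andP[h1 _] := last_node_itv N0 t0; have /andP[h2 _] := last_node_itv N0 h0.
apply: (le_trans (lerD h2 h1)); rewrite -!mulrDl ler_pdivrMr//.
by rewrite mulrC ler_pM2l ?ltr0n// addrC.
Qed.

Lemma node_add N j k : node L N (j + k) = node L N j + node L N k.
Proof. by rewrite /node natrD; ring. Qed.

Lemma node_last_node_cvg t : 0 <= t -> node L N.+1 (last_node N.+1 t) @[N --> \oo] --> t.
Proof.
move=> t0.
have invN : (N.+1%:R^-1 : R) @[N --> \oo] --> 0 by exact: cvg_harmonic.
have h : (t - L * N.+1%:R^-1 : R) @[N --> \oo] --> t - L * 0.
  by apply: cvgB; [exact: cvg_cst|apply: cvgM => //; exact: cvg_cst].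
rewrite mulr0 subr0 in h.
apply: (squeeze_cvgr _ h (@cvg_cst _ _ _ _ _)).
by near=> N; exact: node_last_node.
Unshelve. all: by end_near. Qed.

(** The times are rounded to nodes and the shift to a number of steps; the chain is shift
    invariant, and the limit of a fine mesh gives the process. *)
Lemma regular_stationary_pos n (t : 'I_n -> R) (h : R) (f : 'I_n -> R -> R) :
  (forall i, 0 <= t i <= L) -> (forall i, 0 <= t i + h <= L) -> 0 <= h ->
  (forall i, continuous (f i)) -> (forall i x, 0 <= f i x <= 1) ->
  expect P (fun w => \prod_i f i (Y (t i + h) w)) = expect P (fun w => \prod_i f i (Y (t i) w)).
Proof.
move=> tL thL h0 cf f01.
have [mY mV cY cV ou] := regYV.
have mf i : measurable_fun setT (f i) by apply: continuous_measurable_fun; exact: cf.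
have grp N s : (0 < N)%N -> (forall i, (s + last_node N (t i) <= N)%N) -> (s <= N)%N ->
   expect P (fun w => \prod_i f i (pchain N (s + last_node N (t i)) w)) =
   expect P (fun w => \prod_i f i (pchain N (last_node N (t i)) w)).
  move=> N0 sN s_N.
  (* Several times may share a node; their factors are then multiplied. *)
  pose g j x := \prod_(i | last_node N (t i) == j) f i x.
  have ug j : unit_fun (g j).
    split; last first.
      move=> x; apply/andP; split.
        by apply: prodr_ge0 => i _; case/andP: (f01 i x).
      by apply: prodr_ile1 => i _; exact: f01.
    rewrite /g; under eq_fun do rewrite big_mkcond.
    apply: (@measurable_prod _ R R setT _ (index_enum 'I_n) (fun i x => if last_node N (t i) == j then f i x else 1)) => i _.
    by case: (last_node N (t i) == j) => //; exact: measurable_cst.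
  have gi i : (last_node N (t i) < (N - s).+1)%N by rewrite ltnS -(leq_add2l s) subnKC.
  have e s' w : \prod_i f i (pchain N (s' + last_node N (t i)) w) =
      \prod_(j < (N - s).+1) g j (pchain N (s' + j) w).
    rewrite (partition_big (fun i => inord (last_node N (t i)) : 'I_(N - s).+1) xpredT)//=.
    apply: eq_bigr => j _; apply: eq_big => [i|i /eqP <-].
      by rewrite -val_eqE /= inordK.
    by rewrite inordK.
  transitivity (expect P (fun w => \prod_(j < (N - s).+1) g j (pchain N (s + j) w))).
    by apply: eq_Rintegral => w _; exact: e.
  rewrite pchain_stationary ?subnKC//.
  by apply: eq_Rintegral => w _; have := e 0%N w => <-.
have cv (k : nat -> 'I_n -> nat) (u : 'I_n -> R) : (forall i, 0 <= u i <= L) ->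
    (forall N i, (k N.+1 i <= N.+1)%N) -> (forall i, node L N.+1 (k N.+1 i) @[N --> \oo] --> u i) ->
    expect P (fun w => \prod_i f i (pchain N.+1 (k N.+1 i) w)) @[N --> \oo] --> expect P (fun w => \prod_i f i (Y (u i) w)).
  move=> uL kN ku.
  have [||||_ //] := @expect_cvg _ _ _ P (fun N w => \prod_i f i (pchain N.+1 (k N.+1 i) w)) (fun w => \prod_i f i (Y (u i) w)) (fun=> 1).
  - move=> N; apply: (@measurable_prod _ T R setT _ (index_enum 'I_n) (fun i w => f i (pchain N.+1 (k N.+1 i) w))) => i _.
    by apply: measurableT_comp => //; exact: measurable_pchain.
  - move=> w; apply: prod_cvg => i; have [v0 ouw] := ou w.
    have h1 := @path_chain_cvg R a r L (Y^~ w) (V^~ w) a0 r0 L0 (cY w) (cV w) v0 ouw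
      (fun N => k N i) (u i) (uL i) (fun N => kN N i) (ku i).
    exact: (cvg_comp _ _ h1 (cf i (Y (u i) w))).
  - exact: integ_cst.
  - move=> N w; rewrite ger0_norm; last by apply: prodr_ge0 => i _; case/andP: (f01 i (pchain N.+1 (k N.+1 i) w)).
    by apply: prodr_ile1 => i _; exact: f01.
case: n t f tL thL cf f01 mf grp cv => [|n] t f tL thL cf f01 mf grp cv.
  by apply: eq_Rintegral => w _; rewrite !big_ord0.
have t0 i : 0 <= t i by case/andP: (tL i).
have gN N i : (last_node N.+1 h + last_node N.+1 (t i) <= N.+1)%N.
  by apply: last_node_addn => //; case/andP: (thL i).
have c1 := cv (fun N i => (last_node N h + last_node N (t i))%N) (fun i => t i + h) thL gN _.
have c2 := cv (fun N i => last_node N (t i)) t tL _ _.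
apply: (@cvg_unique _ (@Rhausdorff R) _ _ _ _ (c1 _)).
  move=> i; rewrite (_ : (fun N => _) = (fun N => node L N.+1 (last_node N.+1 h) + node L N.+1 (last_node N.+1 (t i)))).
    by rewrite addrC; apply: cvgD; exact: node_last_node_cvg.
  by apply/funext => N; rewrite node_add.
rewrite (_ : (fun N => expect P _) = (fun N => expect P (fun w => \prod_i f i (pchain N.+1 (last_node N.+1 (t i)) w)))).
  apply: c2 => [N i|i]; last exact: node_last_node_cvg.
  by apply: leq_trans (gN N i); exact: leq_addl.
apply/funext => N; apply: grp => // .
by apply: leq_trans (gN N ord0); exact: leq_addr.
Qed.

(** A negative shift is a positive one seen from the shifted times. *)
Lemma regular_stationary n (t : 'I_n -> R) (h : R) :
  (forall i, 0 <= t i <= L) -> (forall i, 0 <= t i + h <= L) ->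
  forall B : set (n.-tuple R), measurable B ->
    P [set w | B [tuple Y (t i + h) w | i < n]] = P [set w | B [tuple Y (t i) w | i < n]].
Proof.
move=> tL thL; have [mY _ _ _ _] := regYV.
apply: tuple_law => // f cf f01.
have [h0|h0] := leP 0 h; first exact: regular_stationary_pos.
have hh i : t i + h - h = t i by lra.
have tL' i : 0 <= t i + h - h <= L by rewrite hh.
rewrite -(@regular_stationary_pos n (fun i => t i + h) (- h) f thL tL')//; last by lra.
by apply: eq_Rintegral => w _; apply: eq_bigr => i _; rewrite hh.
Qed.

End Stationarity.

(** * Chaining for the supremum of a path *)

Section SupNorm.
Context {R : realType}.
Variable L : R.
Hypothesis L0 : 0 < L.
Implicit Types (b : R -> R) (y : R).

Definition sup_abs b : R := sup [set `|b y| | y in `[0, L]].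

Lemma sup_abs_ge b y : continuous b -> 0 <= y <= L -> `|b y| <= sup_abs b.
Proof.
move=> cb yL; apply: ub_le_sup; last by exists y => //; rewrite /= in_itv.
have [M _ hM] := @continuous_bounded R b 0 L cb.
by exists M => _ [z + <-]; rewrite /= in_itv => /hM.
Qed.

Lemma sup_abs_le b (B : R) : (forall y, 0 <= y <= L -> `|b y| <= B) -> sup_abs b <= B.
Proof.
move=> bB; apply: ge_sup; first by exists `|b 0|, 0 => //; rewrite /= in_itv/= lexx ltW.
by move=> _ [z + <-]; rewrite /= in_itv => /bB.
Qed.

Lemma sup_abs_ge0 b : continuous b -> 0 <= sup_abs b.
Proof.
have h0 : 0 <= (0 : R) <= L by rewrite lexx ltW.
by move=> cb; apply: le_trans (sup_abs_ge cb h0); exact: normr_ge0.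
Qed.

Lemma sup_abs_lipschitz b1 b2 (e : R) : continuous b1 -> continuous b2 ->
  (forall y, 0 <= y <= L -> `|b1 y - b2 y| <= e) -> `|sup_abs b1 - sup_abs b2| <= e.
Proof.
move=> c1 c2 h; rewrite ler_norml; apply/andP; split.
  rewrite lerBrDr addrC lerBlDr; apply: sup_abs_le => y yL.
  have := sup_abs_ge c1 yL; have := h y yL; have := ler_distD 0 (b2 y) (b1 y).
  have := ler_normD (b2 y - b1 y) (b1 y); rewrite subrK distrC; lra.
rewrite lerBlDr; apply: sup_abs_le => y yL.
have := sup_abs_ge c2 yL; have := h y yL.
have := ler_normD (b1 y - b2 y) (b2 y); rewrite subrK; lra.
Qed.

(** Each dyadic point is reached from 0 by one increment per level, whose bounds form a geometric
    series; dyadic points are dense. *)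
Lemma chaining b (A beta : R) : continuous b -> b 0 = 0 -> 0 < beta < 1 -> 0 <= A ->
  (forall m k, (k < 2 ^ m)%N ->
     `|b (node L (2 ^ m) k.+1) - b (node L (2 ^ m) k)| <= A * beta ^+ m) ->
  sup_abs b <= A / (1 - beta).
Proof.
move=> cb b0 /andP[be0 be1] A0 hb.
have be1' : 0 < 1 - beta by lra.
set B := A / (1 - beta); have B0 : 0 <= B by rewrite divr_ge0// ltW.
have BE : B * (1 - beta) = A by rewrite /B divfK// gt_eqF.
have bm m : 0 <= beta ^+ m <= 1 by rewrite exprn_ge0 ?exprn_ile1// ltW.
have dy M k : (k <= 2 ^ M)%N -> `|b (node L (2 ^ M) k)| <= B * (1 - beta ^+ M.+1).
  elim: M k => [|M IH] k kM.
    case: k kM => [_|[_|//]].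
      by rewrite /node !mul0r b0 normr0 expr1 BE.
    have := hb 0%N 0%N isT; rewrite expr0 expr1 BE mulr1.
    by rewrite [node _ _ 0]/node !mul0r b0 subr0.
  have dbl j : node L (2 ^ M.+1) j.*2 = node L (2 ^ M) j.
    rewrite /node expnS natrM -muln2 natrM; field.
    by rewrite pnatr_eq0 -lt0n expn_gt0.
  have kE := odd_double_half k.
  have k2 : (k./2 <= 2 ^ M)%N.
    by rewrite -leq_double -(mul2n (2 ^ M)) -expnS; apply: leq_trans kM; rewrite -[X in (_ <= X)%N]kE leq_addl.
  have /andP[p0 p1] := bm M.+1; have hk := IH _ k2.
  (* A point of level M + 1 is a point of level M or its right neighbour at level M + 1. *)
  case: (odd k) kE => /= kE; last first.
    rewrite -kE add0n dbl; apply: (le_trans hk); apply: ler_wpM2l => //.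
    by rewrite lerD2l lerN2 exprS ger_pMl ?ltW// exprn_gt0.
  have kM' : (k./2.*2 < 2 ^ M.+1)%N by rewrite -add1n kE.
  have kS : k./2.*2.+1 = k by rewrite -add1n.
  have := hb M.+1 k./2.*2 kM'; rewrite dbl kS => h1.
  have := ler_normD (b (node L (2 ^ M.+1) k) - b (node L (2 ^ M) k./2)) (b (node L (2 ^ M) k./2)).
  rewrite subrK => /le_trans; apply; apply: (le_trans (lerD h1 hk)).
  rewrite -BE [beta ^+ M.+2]exprS le_eqVlt; apply/orP; left; apply/eqP; ring.
apply: sup_abs_le => y /andP[y0 yL].
have cn : (`|b (node L (2 ^ M) (last_node L (2 ^ M) y))| @[M --> \oo] --> `|b y|).
  have h : node L (2 ^ M) (last_node L (2 ^ M) y) @[M --> \oo] --> y.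
    have := @cvg_div_exp2 R L => hL.
    have h : (y - L / 2 ^+ M) @[M --> \oo] --> y - 0 by apply: cvgB; [exact: cvg_cst|exact: hL].
    rewrite subr0 in h; apply: (squeeze_cvgr _ h (@cvg_cst _ _ _ _ _)).
    near=> M; have := @node_last_node R L L0 (2 ^ M) y _ y0; rewrite natrX; apply.
    by rewrite expn_gt0.
  by apply: cvg_norm; exact: (cvg_comp _ _ h (cb y)).
rewrite -(cvg_lim (@Rhausdorff R) cn); apply: limr_le; first by apply/cvg_ex; exists `|b y|.
near=> M.
have gM : (last_node L (2 ^ M) y <= 2 ^ M)%N.
  have := @last_node_addn R L L0 (2 ^ M) y 0; rewrite addr0 => /(_ _ y0 (lexx _) yL) h.
  by apply: leq_trans (h _); rewrite ?leq_addl ?expn_gt0.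
apply: (le_trans (dy M _ gM)).
rewrite -[X in _ <= X]mulr1 ler_wpM2l// lerBlDr lerDl; by case/andP: (bm M.+1).
Unshelve. all: by end_near. Qed.

End SupNorm.

Section Moments.
Context {d : measure_display} {T : measurableType d} {R : realType}.
Variable P : probability T R.

Lemma integ_ge0_le (f : T -> R) (B : R) : measurable_fun setT f -> (forall w, 0 <= f w) ->
  (\int[P]_w (f w)%:E <= B%:E)%E -> integ P f /\ expect P f <= B.
Proof.
move=> mf f0 fB.
have i : integ P f.
  apply/integrableP; split; first exact/measurable_EFinP.
  apply: le_lt_trans (ltry B); apply: le_trans fB; rewrite le_eqVlt; apply/orP; left; apply/eqP.
  by apply: eq_integral => w _ /=; rewrite ger0_norm.
by split => //; rewrite -lee_fin expectE.
Qed.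

Lemma sum_geometric_le (q B : R) : 0 <= q < 1 -> 0 <= B ->
  (\sum_(m <oo) (B * q ^+ m)%:E <= (B / (1 - q))%:E)%E.
Proof.
move=> /andP[q0 q1] B0; apply: lime_le.
  by apply: is_cvg_nneseries => n _ _; rewrite lee_fin mulr_ge0// exprn_ge0.
near=> n; rewrite sumEFin lee_fin -mulr_sumr ler_wpM2l//.
rewrite -[X in _ <= X]mul1r ler_pdivlMr ?subr_gt0//.
rewrite mulrC big_mkord -opprB mulNr -subrX1 opprB lerBlDr lerDl; exact: exprn_ge0.
Unshelve. all: by end_near. Qed.

Variables (L C : R) (V : R -> T -> R).
Hypotheses (L0 : 0 < L) (C0 : 0 <= C).
Hypothesis mV : forall t, measurable_fun setT (V t).
Hypothesis cV : forall w, continuous (V^~ w).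
Hypothesis V0 : forall w, V 0 w = 0.
Hypothesis incr : forall s t, 0 <= s -> s < t -> t <= L ->
  (\int[P]_w ((V t w - V s w) ^+ 6)%:E <= (C * (t - s) ^+ 3)%:E)%E.

(** The sum over all dyadic levels of the weighted sixth powers of the increments dominates the sixth
    power of the supremum, and has finite expectation term by term. *)
Lemma integ_sup_abs6 : integ P (fun w => sup_abs L (V^~ w) ^+ 6).
Proof.
(* Level m has 2^m increments with sixth moments of order 2^(-3 m), so the sums with weights
   beta^(-6 m) are summable when 4 beta^6 > 1. *)
pose beta : R := 4 / 5.
have be : 0 < beta < 1 by rewrite /beta; lra.
have /andP[be0 be1] := be.
have be6 : 1 < 4 * beta ^+ 6.
  have -> : beta ^+ 6 = (beta * beta) * (beta * beta) * (beta * beta) by ring.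
  by rewrite /beta; lra.
pose q := (4 * beta ^+ 6)^-1.
have q01 : 0 <= q < 1.
  have h : 0 < 4 * beta ^+ 6 by lra.
  by rewrite /q invr_ge0 (ltW h)/= invf_lt1.
pose dlt m k w := V (node L (2 ^ m) k.+1) w - V (node L (2 ^ m) k) w.
pose Km m w : R := \sum_(k < 2 ^ m) (beta ^+ m)^-1 ^+ 6 * dlt m k w ^+ 6.
have even6 (x : R) : 0 <= x ^+ 6 by rewrite exprn_even_ge0.
have Km0 m w : 0 <= Km m w by apply: sumr_ge0 => k _; apply: mulr_ge0; exact: even6.
have N0 m : (0 < 2 ^ m)%N by rewrite expn_gt0.
have idlt m (k : 'I_(2 ^ m)) : integ P (fun w => dlt m k w ^+ 6) /\
    expect P (fun w => dlt m k w ^+ 6) <= C * (L / 2 ^+ m) ^+ 3.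
  apply: integ_ge0_le => //.
    by apply: measurable_funX; apply: measurable_funB.
  have := incr (node_ge0 L0 (2 ^ m) k) (node_lt L0 (N0 m) k) (node_le L0 (N0 m) (ltn_ord k)).
  by rewrite nodeS natrX.
have iKm m : integ P (Km m) /\ expect P (Km m) <= C * L ^+ 3 * q ^+ m.
  have [h1 h2] := @expect_sum _ _ _ P _ (index_enum 'I_(2 ^ m))
     (fun (k : 'I_(2 ^ m)) w => (beta ^+ m)^-1 ^+ 6 * dlt m k w ^+ 6) (fun k => integZ _ (idlt m k).1).
  split => //; rewrite [expect P _]h2.
  apply: (@le_trans _ _ (\sum_(k < 2 ^ m) (beta ^+ m)^-1 ^+ 6 * (C * (L / 2 ^+ m) ^+ 3))).
    apply: ler_sum => k _; rewrite expectZ; last by case: (idlt m k).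
    by apply: ler_wpM2l; [exact: even6|case: (idlt m k)].
  rewrite sumr_const card_ord -[X in X <= _]mulr_natl natrX.
  have b0 : beta ^+ m != 0 by rewrite expf_neq0// gt_eqF.
  have t0 : (2 : R) ^+ m != 0 by rewrite expf_neq0// pnatr_eq0.
  have -> : q ^+ m = ((2 ^+ m) * (2 ^+ m) * (beta ^+ m) ^+ 6)^-1.
    have e4 : (4 : R) ^+ m = 2 ^+ m * 2 ^+ m by rewrite -exprMn; congr (_ ^+ m); lra.
    have eb : (beta ^+ 6) ^+ m = (beta ^+ m) ^+ 6 by rewrite -!exprM mulnC.
    by rewrite /q exprVn exprMn e4 eb.
  by rewrite le_eqVlt; apply/orP; left; apply/eqP; field; rewrite b0 t0.
pose K w := (\sum_(m <oo) (Km m w)%:E)%E.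
have K0 w : (0 <= K w)%E by apply: nneseries_ge0 => m _ _; rewrite lee_fin.
have mKm m : measurable_fun setT (EFin \o Km m) by case: (iKm m) => /measurable_int.
have intK : (\int[P]_w K w <= (C * L ^+ 3 / (1 - q))%:E)%E.
  rewrite /K integral_nneseries//; last by move=> m w _; rewrite lee_fin.
  apply: le_trans (sum_geometric_le q01 _); last by rewrite mulr_ge0// exprn_ge0// ltW.
  apply: lee_nneseries => m _.
    by move=> _; apply: integral_ge0 => w _; rewrite lee_fin.
  by case: (iKm m) => h1 h2; rewrite -expectE// lee_fin.
have mK : measurable_fun setT K.
  apply: (@ge0_emeasurable_sum _ _ _ setT (fun m w => (Km m w)%:E) xpredT).
    by move=> m w _ _; rewrite lee_fin.
  by move=> m _; exact: mKm.
have be1' : 0 < 1 - beta by lra.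
have mS : measurable_fun setT (fun w => sup_abs L (V^~ w)).
  apply: (@measurable_functional R L L0 d T V mV cV (sup_abs L) 1) => b1 b2 e c1 c2 h.
  by rewrite mul1r; apply: sup_abs_lipschitz.
have bnd w : (((1 - beta) ^+ 6 * sup_abs L (V^~ w) ^+ 6)%:E <= K w)%E.
  have : (0 <= K w)%E by [].
  case e : (K w) => [k| |]; [|by move=> _; exact: leey|by []].
  rewrite !lee_fin => k0.
  (* A^6 bounds every weighted sixth power, so A beta^m bounds the increments of level m. *)
  pose A := k `^ (6%:R^-1).
  have A0 : 0 <= A by exact: powR_ge0.
  have A6 : A ^+ 6 = k by rewrite -powR_mulrn// -powRrM mulVf ?powRr1// pnatr_eq0.
  have hA m j : (j < 2 ^ m)%N -> `|V (node L (2 ^ m) j.+1) w - V (node L (2 ^ m) j) w| <= A * beta ^+ m.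
    move=> jm; have bm0 : 0 < beta ^+ m by rewrite exprn_gt0.
    rewrite -(@ler_pXn2r _ 6) ?nnegrE//; last by rewrite mulr_ge0// ltW.
    rewrite -normrX ger0_norm ?even6// exprMn A6 -/(dlt m j w).
    have : (beta ^+ m)^-1 ^+ 6 * dlt m j w ^+ 6 <= k.
      rewrite -lee_fin -e; apply: (@le_trans _ _ (Km m w)%:E).
        rewrite lee_fin /Km (bigD1 (Ordinal jm))//= lerDl.
        by apply: sumr_ge0 => i _; apply: mulr_ge0; exact: even6.
      apply: le_trans (nneseries_lim_ge m.+1 _); last by move=> n _ _; rewrite lee_fin.
      rewrite big_nat_recr//= leeDr//; apply: sume_ge0 => i _; by rewrite lee_fin.
    by rewrite exprVn mulrC ler_pdivrMr// exprn_gt0.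
  have := chaining L0 (@cV w) (V0 w) be A0 hA.
  rewrite ler_pdivlMr// => h; rewrite -A6 -exprMn mulrC.
  by apply: lerXn2r => //; rewrite nnegrE// mulr_ge0//; [exact: sup_abs_ge0|exact: ltW].
have i : integ P (fun w => (1 - beta) ^+ 6 * sup_abs L (V^~ w) ^+ 6).
  have [|||//] := @integ_ge0_le (fun w => (1 - beta) ^+ 6 * sup_abs L (V^~ w) ^+ 6) (C * L ^+ 3 / (1 - q)).
  - by apply: measurable_funM => //; exact: measurable_funX.
  - by move=> w; apply: mulr_ge0; exact: even6.
  - apply: le_trans intK; apply: ge0_le_integral => //.
    + by move=> w _; rewrite lee_fin; apply: mulr_ge0; exact: even6.
    + by apply/measurable_EFinP; apply: measurable_funM => //; exact: measurable_funX.
have := integZ ((1 - beta) ^+ 6)^-1 i.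
rewrite (_ : (fun w => _) = fun w => sup_abs L (V^~ w) ^+ 6)//.
by apply/funext => w; rewrite mulKf// expf_neq0// gt_eqF.
Qed.

End Moments.

(** * Moments of Gaussian variables *)

Section GaussianMoments.
Context {d : measure_display} {T : measurableType d} {R : realType}.
Variable P : probability T R.
Local Open Scope ereal_scope.

(** The density is even and Lebesgue measure is invariant under reflection. *)
Lemma normal_symmetric (s : R) (f : R -> \bar R) : s != 0%R ->
  measurable_fun setT f -> (forall x, 0 <= f x) ->
  \int[normal_prob 0 s]_x f (- x)%R = \int[normal_prob 0 s]_x f x.
Proof.
move=> s0 mf f0.
have mfN : measurable_fun setT (fun x : R => f (- x)%R).
  by apply: (measurableT_comp mf); exact: oppr_measurable.
rewrite !integral_normal_prob//.
have mn : measurable_fun setT (fun x : R => (normal_pdf 0 s x)%:E).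
  by apply/measurable_EFinP; exact: measurable_normal_pdf.
pose g x := f x * (normal_pdf 0 s x)%:E.
have mg : measurable_fun setT g by exact: emeasurable_funM.
have g0 x : 0 <= g x by rewrite mule_ge0// lee_fin normal_pdf_ge0.
transitivity (\int[lebesgue_measure]_x g (- x)%R).
  by apply: eq_integral => x _; rewrite /g !normal_pdf0E// sqrrN.
rewrite [RHS](eq_measure_integral (pushforward lebesgue_measure (-%R : R -> measurableTypeR R))).
  by rewrite ge0_integral_pushforward// => x _; exact: g0.
by move=> A mA _; exact/esym/lebesgue_measureN.
Qed.

(** If the common integral is infinite, the real value of the difference is 0 by convention, as it
    is by cancellation in the finite case. *)
Lemma expect_eq0 (f : T -> R) :
  \int[P]_w (Num.max (f w) 0)%:E = \int[P]_w (Num.max (- f w) 0)%:E -> expect P f = 0%R.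
Proof.
move=> h; rewrite /expect /Rintegral integralE.
have -> : \int[P]_w ((EFin \o f)^\+ w) = \int[P]_w (Num.max (f w) 0)%:E.
  by apply: eq_integral => w _; rewrite funeposE /= EFin_max.
have -> : \int[P]_w ((EFin \o f)^\- w) = \int[P]_w (Num.max (f w) 0)%:E.
  by rewrite h; apply: eq_integral => w _; rewrite funenegE /= EFin_max.
set A := \int[P]_w _; have : 0 <= A by apply: integral_ge0 => w _; rewrite lee_fin le_max lexx orbT.
by case: A => [x| |]//= _; rewrite subrr.
Qed.

Lemma measurable_pos (f : R -> R) : measurable_fun setT f ->
  measurable_fun setT (fun x => (Num.max (f x) 0)%:E).
Proof. by move=> mf; apply/measurable_EFinP; apply: measurable_maxr. Qed.

Variables (Z : T -> R) (v : R).
Hypotheses (mZ : measurable_fun setT Z) (v0 : (0 < v)%R) (hZ : gaussian_rv P Z 0 v).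

Let sv0 : Num.sqrt v != 0%R. Proof. by rewrite gt_eqF// sqrtr_gt0. Qed.

Lemma gaussian_centered : expect P Z = 0%R.
Proof.
apply: expect_eq0.
have pos0 (x : R) : 0 <= (Num.max x 0)%:E by rewrite lee_fin le_max lexx orbT.
have neg0 (x : R) : 0 <= (Num.max (- x)%R 0)%:E by rewrite lee_fin le_max lexx orbT.
have mp : measurable_fun setT (fun x : R => (Num.max x 0)%:E) by exact: measurable_pos.
have mn : measurable_fun setT (fun x : R => (Num.max (- x)%R 0)%:E).
  by apply: measurable_pos; exact: oppr_measurable.
rewrite (integral_gaussian mZ hZ mp pos0) (integral_gaussian mZ hZ mn neg0).
by rewrite (normal_symmetric sv0 mp pos0).
Qed.

Lemma gaussian_variance : \int[P]_w (Z w ^+ 2)%:E = v%:E.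
Proof.
have m2 : measurable_fun setT (fun x : R => (x ^+ 2)%:E) by apply/measurable_EFinP; exact: measurable_funX.
have p2 (x : R) : 0 <= (x ^+ 2)%:E by rewrite lee_fin sqr_ge0.
by rewrite (integral_gaussian mZ hZ m2 p2) normal_second_moment ?sqrtr_gt0// sqr_sqrtr// ltW.
Qed.

Lemma integ_gaussian2 : integ P (fun w => Z w ^+ 2)%R /\ expect P (fun w => Z w ^+ 2)%R = v.
Proof.
have m2 : measurable_fun setT (fun w => Z w ^+ 2)%R by exact: measurable_funX.
have [|i _] := @integ_ge0_le _ _ _ P (fun w => Z w ^+ 2)%R v m2 (fun w => sqr_ge0 (Z w)).
  by rewrite gaussian_variance.
by split => //; apply: EFin_inj; rewrite expectE// gaussian_variance.
Qed.

End GaussianMoments.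

Section GaussianSixth.
Context {R : realType}.

Lemma gaussian_sixth : exists2 C : R, 0 <= C & forall d (T : measurableType d) (P : probability T R)
  (Z : T -> R) (v : R), measurable_fun setT Z -> 0 < v -> gaussian_rv P Z 0 v ->
  (\int[P]_w (Z w ^+ 6)%:E <= (C * v ^+ 3)%:E)%E.
Proof.
have [C C0 hC] := @normal_sixth_moment R; exists C => // d T P Z v mZ v0 hZ.
have m6 : measurable_fun setT (fun x : R => (x ^+ 6)%:E) by apply/measurable_EFinP; exact: measurable_funX.
have p6 (x : R) : (0 <= (x ^+ 6)%:E)%E by rewrite lee_fin exprn_even_ge0.
rewrite (integral_gaussian mZ hZ m6 p6).
have s0 : 0 < Num.sqrt v by rewrite sqrtr_gt0.
have := hC _ s0; rewrite (_ : Num.sqrt v ^+ 6 = v ^+ 3)//.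
by rewrite (exprM _ 2 3) sqr_sqrtr// ltW.
Qed.

End GaussianSixth.

Section Orthogonality.
Context {d : measure_display} {T : measurableType d} {R : realType}.
Variable P : probability T R.
Variables (L : R) (W : R -> {RV P >-> R}) (X0 : {RV P >-> R}).
Hypothesis L0 : 0 < L.
Hypothesis lawW : forall s t, 0 <= s -> s < t -> t <= L -> gaussian_rv P (W t \- W s) 0 (t - s).
Hypothesis indW : forall s t, 0 <= s -> s < t -> t <= L ->
  independent_systems P (sigma_of_rv (W t \- W s)) (sigma_of_process `[0, s] W).
Hypothesis indX0 : independent_systems P (sigma_of_rv X0) (sigma_of_process `[0, L] W).

(** Given the past, the increment has a symmetric law. *)
Lemma initial_orthogonal t : 0 < t <= L -> expect P (fun w => X0 w * (W t w - W 0 w)) = 0.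
Proof.
move=> /andP[t0 tL]; apply: expect_eq0.
have mX : measurable_fun setT (X0 : past W X0 0 -> R) by exact: measurable_past_X0.
pose F (b : bool) (wz : past W X0 0 * R) : \bar R :=
  (Num.max ((-1) ^+ b * (X0 wz.1 * wz.2)) 0)%:E.
have mF b : measurable_fun setT (F b).
  apply/measurable_EFinP; apply: measurable_maxr => //; apply: measurable_funM => //.
  by apply: measurable_funM => //; exact: measurableT_comp.
have F0 b x : (0 <= F b x)%E by rewrite lee_fin le_max lexx orbT.
have H b := integral_past_increment lawW indW indX0 (lexx 0) t0 tL (mF b) (F0 b).
have := H false; have := H true; rewrite /F /= expr0 expr1 => h1 h0.
under eq_integral do rewrite -[X0 _ * _]mul1r.
under [RHS]eq_integral do rewrite -mulN1r.
rewrite h0 h1; apply: eq_integral => w _.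
rewrite -(@normal_symmetric R _ (fun z => (Num.max (-1 * (X0 w * z)) 0)%:E)); last 3 first.
- by rewrite gt_eqF// sqrtr_gt0 subr0.
- by apply: measurable_pos; apply: measurable_funM => //; exact: measurable_funM.
- by move=> z; rewrite lee_fin le_max lexx orbT.
by apply: eq_integral => z _; rewrite mulrN mulrNN.
Qed.

End Orthogonality.

(** * Exchange of expectation and primitive *)

Section Riemann.
Context {R : realType}.
Implicit Types (f : R -> R) (y : R).

Definition riemann f y (N : nat) : R := \sum_(k < N.+1) y / N.+1%:R * f (node y N.+1 k).

Lemma riemann_cvg f y : 0 <= y -> continuous f -> riemann f y N @[N --> \oo] --> prim f y.
Proof.
move=> y0 cf; apply/cvgrPdist_le => e e0.
have y1 : 0 < y + 1 by lra.
have e1 : 0 < e / (y + 1) by rewrite divr_gt0.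
have [eta eta0 heta] := @uniform_continuity _ f 0 y _ (@cf) e1.
near=> N.
have NR : 0 < N.+1%:R :> R by rewrite ltr0n.
have hN : y / N.+1%:R < eta.
  near: N; have h : (y * N.+1%:R^-1 : R) @[N --> \oo] --> y * 0.
    by apply: cvgM; [exact: cvg_cst|exact: cvg_harmonic].
  by rewrite mulr0 in h; move/cvgrPdist_lt : h => /(_ _ eta0); apply: filterS => N; rewrite sub0r normrN => /(le_lt_trans (ler_norm _)).
set h := y / N.+1%:R in hN; have h0 : 0 <= h by rewrite divr_ge0// ltW.
have nodeE k : node y N.+1 k = k%:R * h by rewrite /node /h mulrA.
have tel : prim f y = \sum_(k < N.+1) (prim f (node y N.+1 k.+1) - prim f (node y N.+1 k)).
  rewrite -(big_mkord xpredT (fun k => prim f (node y N.+1 k.+1) - prim f (node y N.+1 k))) telescope_sumr//.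
  rewrite [node y N.+1 0]/node !mul0r prim0// subr0 /node; congr prim.
  by rewrite [N.+1%:R * y]mulrC mulfK// gt_eqF.
rewrite tel -sumrB.
apply: (le_trans (ler_norm_sum _ _ _)).
apply: (@le_trans _ _ (\sum_(k < N.+1) e / (y + 1) * h)).
  apply: ler_sum => k _.
  have tk : node y N.+1 k <= node y N.+1 k.+1 by rewrite !nodeE -natr1 mulrDl mul1r lerDl.
  have tk0 : 0 <= node y N.+1 k by rewrite nodeE mulr_ge0.
  have tkh : node y N.+1 k.+1 - node y N.+1 k = h by rewrite !nodeE -natr1; ring.
  have tky : node y N.+1 k.+1 <= y.
    by rewrite /node ler_pdivrMr// mulrC ler_wpM2l// ler_nat.
  set s := node y N.+1 k in tk tk0 tkh *; set t := node y N.+1 k.+1 in tk tkh tky *.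
  have dF u : s < u < t -> is_derive u 1 (fun u : R => prim f u - f s * u) (f u - f s).
    by move=> _; apply: der_sub; [exact: is_derive_prim|exact: der_lin].
  have dG u : s < u < t -> is_derive u 1 (fun u : R => e / (y + 1) * u) (e / (y + 1)).
    by move=> _; exact: der_lin.
  have cF : {within `[s, t], continuous (fun u : R => prim f u - f s * u)}.
    apply: continuous_itv => u; apply: cvgB; first exact: continuous_prim.
    by apply: cvgM; [exact: cvg_cst|exact: cvg_id].
  have cG : {within `[s, t], continuous (fun u : R => e / (y + 1) * u)}.
    by apply: continuous_itv => u; apply: cvgM; [exact: cvg_cst|exact: cvg_id].
  have := @norm_derive_comparison R _ _ _ _ s t tk dF dG cF cG.
  have -> : prim f t - f s * t - (prim f s - f s * s) = prim f t - prim f s - h * f s.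
    by rewrite -tkh; ring.
  rewrite -mulrBr tkh; apply => u /andP[su ut]; apply/ltW/heta; last first.
    by rewrite ger0_norm; lra.
  by apply/andP; split; lra.
rewrite sumr_const card_ord -[X in X <= _]mulr_natl /h.
have -> : N.+1%:R * (e / (y + 1) * (y / N.+1%:R)) = e * (y / (y + 1)) by field; rewrite !gt_eqF.
by rewrite ler_piMr ?(ltW e0)// ler_pdivrMr// mul1r lerDl.
Unshelve. all: by end_near. Qed.

Lemma riemann_le f y (B : R) N : 0 <= y -> (forall u, `|f u| <= B) -> `|riemann f y N| <= y * B.
Proof.
move=> y0 fB; have NR : 0 < N.+1%:R :> R by rewrite ltr0n.
have h0 : 0 <= y / N.+1%:R by rewrite divr_ge0// ltW.
apply: (le_trans (ler_norm_sum _ _ _)).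
apply: (@le_trans _ _ (\sum_(k < N.+1) y / N.+1%:R * B)).
  by apply: ler_sum => k _; rewrite normrM (ger0_norm h0) ler_wpM2l.
rewrite sumr_const card_ord -[X in X <= _]mulr_natl mulrA [N.+1%:R * _]mulrC.
by rewrite divfK// gt_eqF.
Qed.

Lemma primZ f y (c : R) : 0 <= y -> continuous f -> prim (fun u => c * f u) y = c * prim f y.
Proof.
move=> y0 cf; apply: (@prim_unique _ _ (fun u => c * prim f u)) => //.
- by rewrite prim0// mulr0.
- by move=> u; apply: cvgM; [exact: cvg_cst|exact: cf].
- by apply: continuous_itv => u; apply: cvgM; [exact: cvg_cst|exact: continuous_prim].
- by move=> u _; apply: der_scal; exact: is_derive_prim.
Qed.

Lemma prim_shift f s t : 0 <= s <= t -> continuous f ->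
  prim (fun u => f (s + u)) (t - s) = prim f t - prim f s.
Proof.
move=> /andP[s0 st] cf.
have dsh (u : R) : is_derive u 1 (fun u : R => prim f (s + u) - prim f s) (f (s + u)).
  have h1 : is_derive u 1 (fun u : R => s + u) (0 + 1) by exact: (der_add (der_cst s u) (is_derive_id u (1 : R))).
  have h2 := @is_derive1_comp _ _ _ _ _ _ (is_derive_prim (s + u) (@cf)) h1.
  have h3 := der_sub h2 (der_cst (prim f s) u).
  by apply: (is_derive_eq h3); rewrite subr0 add0r mulr1.
have := @prim_unique R (fun u => f (s + u)) (fun u => prim f (s + u) - prim f s) (t - s).
rewrite [s + (t - s)]addrC subrK => -> //.
- by rewrite subr_ge0.
- by rewrite addr0 subrr.
- move=> u; apply: (cvg_comp (fun u => s + u) f); last exact: cf.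
  by apply: cvgD; [exact: cvg_cst|exact: cvg_id].
- by apply: continuous_itv; exact: (continuous_derive dsh).
Qed.

End Riemann.

Section Swap.
Context {d : measure_display} {T : measurableType d} {R : realType}.
Variable P : probability T R.
Variables (Z : R -> T -> R) (M : T -> R).
Hypothesis mZ : forall u, measurable_fun setT (Z u).
Hypothesis cZ : forall w, continuous (Z^~ w).
Hypothesis iM : integ P M.
Hypothesis ZM : forall u w, `|Z u w| <= M w.

Lemma integ_dominated u : integ P (Z u).
Proof. exact: integ_le iM. Qed.

(** Dominated convergence along sequences of times. *)
Lemma continuous_expect : continuous (fun u => expect P (Z u)).
Proof.
move=> u; apply/continuous_withinNx/cvgr_dnbhsP => v [_ vu].
have [|||_ //] := @expect_cvg _ _ _ P (fun n => Z (v n)) (Z u) M _ _ iM _.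
- by move=> n; exact: mZ.
- by move=> w; exact: (cvg_comp _ _ vu (@cZ w u)).
- by move=> n w; exact: ZM.
Qed.

Lemma measurable_prim y : 0 <= y -> measurable_fun setT (fun w => prim (Z^~ w) y).
Proof.
move=> y0; apply: (@measurable_fun_cvg _ _ _ _ (fun N w => riemann (Z^~ w) y N)).
  move=> N; apply: (@measurable_sum _ T R setT _ (index_enum 'I_N.+1) (fun k w => y / N.+1%:R * Z (node y N.+1 k) w)) => k.
  by apply: measurable_funM.
by move=> w _; apply: riemann_cvg => //; exact: (@cZ w).
Qed.

(** The primitive of a path is a limit of Riemann sums, for which the exchange is linearity; the
    domination is uniform in time. *)
Lemma expect_prim y : 0 <= y ->
  integ P (fun w => prim (Z^~ w) y) /\
  expect P (fun w => prim (Z^~ w) y) = prim (fun u => expect P (Z u)) y.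
Proof.
move=> y0.
have [|||i cv] := @expect_cvg _ _ _ P (fun N w => riemann (Z^~ w) y N) (fun w => prim (Z^~ w) y) (fun w => y * M w) _ _ (integZ y iM) _.
- move=> N; apply: (@measurable_sum _ T R setT _ (index_enum 'I_N.+1) (fun k w => y / N.+1%:R * Z (node y N.+1 k) w)) => k.
  by apply: measurable_funM.
- by move=> w; apply: riemann_cvg => //; exact: (@cZ w).
- by move=> N w; apply: riemann_le.
split => //; apply: (@cvg_unique _ (@Rhausdorff R) _ _ _ _ cv).
rewrite (_ : (fun N => _) = (fun N => riemann (fun u => expect P (Z u)) y N)).
  by apply: riemann_cvg => //; exact: continuous_expect.
apply/funext => N; rewrite /riemann.
have [_ ->] := @expect_sum _ _ _ P _ (index_enum 'I_N.+1) (fun (k : 'I_N.+1) w => y / N.+1%:R * Z (node y N.+1 k) w)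
   (fun k => integZ _ (integ_dominated (node y N.+1 k))).
by apply: eq_bigr => k _; rewrite expectZ//; exact: integ_dominated.
Qed.

End Swap.

(** * The expected enhancement *)

Section SecondMoments.
Context {d : measure_display} {T : measurableType d} {R : realType}.
Variable P : probability T R.

(** The variance of the integral over an interval of length [y] of a stationary process with
    covariance [rho * exp (- a * |s - t|)]. *)
Definition prim_variance (a rho y : R) : R := 2 * rho * (y / a + (expR (- (a * y)) - 1) / a ^+ 2).

Lemma prim_bounded (f : R -> R) (B y : R) : continuous f -> 0 <= y -> (forall u, `|f u| <= B) ->
  `|prim f y| <= B * y.
Proof.
move=> cf y0 fB; apply: (@norm_prim_le R y f B y cf (fun u _ => fB u)).
by rewrite y0 lexx.
Qed.

Variables (Z : R -> T -> R) (M : T -> R) (a rho l : R).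
Hypotheses (a0 : 0 < a) (l0 : 0 <= l).
Hypothesis mZ : forall u, measurable_fun setT (Z u).
Hypothesis cZ : forall w, continuous (Z^~ w).
Hypothesis iM2 : integ P (fun w => M w ^+ 2).
Hypothesis ZM : forall u w, `|Z u w| <= M w.
Hypothesis covZ : forall u v, 0 <= u <= v -> v <= l ->
  expect P (fun w => Z u w * Z v w) = rho * expR (- (a * (v - u))).

Let M0 w : 0 <= M w. Proof. exact: le_trans (normr_ge0 _) (ZM 0 w). Qed.

(** Only times before [z] enter, so the covariance is a smooth function there. *)
Lemma expect_mul_prim z : 0 <= z <= l ->
  expect P (fun w => Z z w * prim (Z^~ w) z) = rho * (1 - expR (- (a * z))) / a.
Proof.
move=> /andP[z0 zl].
have mQ u : measurable_fun setT (fun w => Z z w * Z u w) by exact: measurable_funM.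
have cQ w : continuous (fun u : R => Z z w * Z u w).
  by move=> u; apply: cvgM; [exact: cvg_cst|exact: cZ].
have QM u w : `|Z z w * Z u w| <= M w ^+ 2 by rewrite normrM expr2 ler_pM.
have [_ e] := @expect_prim _ _ _ P (fun u w => Z z w * Z u w) _ mQ cQ iM2 QM z z0.
transitivity (expect P (fun w => prim (fun u => Z z w * Z u w) z)).
  by apply: eq_Rintegral => w _; rewrite primZ//; exact: (@cZ w).
rewrite e.
have dF (u : R) : is_derive u 1 (fun u : R => rho / a * expR (a * u - a * z) - rho / a * expR (- (a * z)))
    (rho * expR (- (a * (z - u)))).
  have h := der_sub (der_scal (rho / a) (der_expR (der_sub (der_lin a u) (der_cst (a * z) u))))
     (der_cst (rho / a * expR (- (a * z))) u).
  apply: (is_derive_eq h); rewrite !subr0.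
  have -> : - (a * (z - u)) = a * u - a * z by ring.
  by field; rewrite gt_eqF.
transitivity (rho / a * expR (a * z - a * z) - rho / a * expR (- (a * z))); last first.
  by rewrite subrr expR0; field; rewrite gt_eqF.
apply: (@prim_unique R (fun u => expect P (fun w => Z z w * Z u w))
  (fun u : R => rho / a * expR (a * u - a * z) - rho / a * expR (- (a * z))) z z0).
- by rewrite mulr0 sub0r subrr.
- exact: (@continuous_expect _ _ _ P (fun u w => Z z w * Z u w) _ mQ cQ iM2 QM).
- exact: continuous_itv (continuous_derive dF).
- move=> u /andP[u0 uz].
  rewrite (_ : expect P _ = rho * expR (- (a * (z - u)))); first exact: dF.
  rewrite -covZ//; last by rewrite ltW//= ltW.
  by apply: eq_Rintegral => w _; rewrite mulrC.
Qed.

(** The square of a primitive is the primitive of twice the product, path by path; its expectation is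
    known from [expect_mul_prim]. *)
Lemma expect_prim_sqr : integ P (fun w => prim (Z^~ w) l ^+ 2) /\
  expect P (fun w => prim (Z^~ w) l ^+ 2) = prim_variance a rho l.
Proof.
(* The clamp keeps the process dominated at all times. *)
pose Q u w : R := 2 * (Z u w * prim (Z^~ w) (clamp 0 l u)).
have cl u : 0 <= clamp 0 l u <= l by exact: clamp_itv.
have mp u : measurable_fun setT (fun w => prim (Z^~ w) (clamp 0 l u)).
  by apply: measurable_prim => //; case/andP: (cl u).
have mQ u : measurable_fun setT (Q u) by do 2!apply: measurable_funM => //.
have cQ w : continuous (Q^~ w).
  move=> u; apply: cvgM; first exact: cvg_cst.
  apply: cvgM; first exact: cZ.
  apply: (cvg_comp (clamp 0 l) (prim (Z^~ w))); first exact: continuous_clamp.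
  exact: (@continuous_prim _ _ (@cZ w)).
have QM u w : `|Q u w| <= 2 * l * M w ^+ 2.
  rewrite /Q normrM ger0_norm// normrM -mulrA ler_pM2l//.
  have -> : l * M w ^+ 2 = M w * (M w * l) by ring.
  apply: ler_pM => //; case/andP: (cl u) => c0 c1.
  apply: (le_trans (prim_bounded (@cZ w) c0 (ZM^~ w))).
  by rewrite ler_wpM2l.
have iM' : integ P (fun w => 2 * l * M w ^+ 2) by exact: integZ.
have [i e] := @expect_prim _ _ _ P Q _ mQ cQ iM' QM l l0.
have sq w : prim (Z^~ w) l ^+ 2 = prim (Q^~ w) l.
  apply/esym; apply: (@prim_unique R (Q^~ w) (fun u => prim (Z^~ w) u ^+ 2) l l0).
  - by rewrite prim0 ?expr0n//; exact: (@cZ w).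
  - exact: cQ.
  - apply: continuous_itv => u; under eq_fun do rewrite expr2.
    by apply: cvgM; exact: (@continuous_prim _ _ (@cZ w)).
  - move=> u /andP[u0 ul].
    rewrite /Q clamp_id; last by rewrite ltW//= ltW.
    have dp := is_derive_prim u (@cZ w).
    have h := der_mul dp dp.
    rewrite (_ : (fun u => prim (Z^~ w) u ^+ 2) = (fun u => prim (Z^~ w) u * prim (Z^~ w) u)); last first.
      by apply/funext => v; rewrite expr2.
    by apply: (is_derive_eq h); ring.
split; first by rewrite (_ : (fun w => _) = (fun w => prim (Q^~ w) l))//; apply/funext.
transitivity (expect P (fun w => prim (Q^~ w) l)); first by apply: eq_Rintegral => w _.
rewrite e.
have dF (y : R) : is_derive y 1 (fun y : R => 2 * rho / a ^+ 2 * (a * y + expR (- a * y) - 1))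
   (2 * (rho * (1 - expR (- (a * y))) / a)).
  have h := der_scal (2 * rho / a ^+ 2) (der_sub (der_add (der_lin a y) (der_expR (der_lin (- a) y))) (der_cst 1 y)).
  by apply: (is_derive_eq h); rewrite (mulNr a y); field; rewrite gt_eqF.
transitivity (2 * rho / a ^+ 2 * (a * l + expR (- a * l) - 1)); last first.
  by rewrite /prim_variance mulNr; field; rewrite gt_eqF.
apply: (@prim_unique R (fun u => expect P (Q u)) (fun y : R => 2 * rho / a ^+ 2 * (a * y + expR (- a * y) - 1)) l l0).
- by rewrite !mulr0 expR0 add0r subrr mulr0.
- exact: (@continuous_expect _ _ _ P Q _ mQ cQ iM' QM).
- exact: continuous_itv (continuous_derive dF).
- move=> u /andP[u0 ul].
  rewrite (_ : expect P _ = 2 * (rho * (1 - expR (- (a * u))) / a)); first exact: dF.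
  have ul' : 0 <= u <= l by rewrite ltW//= ltW.
  rewrite -expect_mul_prim// -expectZ; first by apply: eq_Rintegral => w _; rewrite /Q clamp_id.
  have := integZ (2^-1) (@integ_dominated _ _ _ P Q _ mQ iM' QM u).
  rewrite (_ : (fun w => _) = (fun w => Z u w * prim (Z^~ w) u))//.
  by apply/funext => w; rewrite /Q mulKf// clamp_id.
Qed.

End SecondMoments.

Section MeanKappa.
Context {d : measure_display} {T : measurableType d} {R : realType}.
Variable P : probability T R.
Variables (Z : R -> T -> R) (M : T -> R) (a r L : R).
Hypotheses (a0 : 0 < a) (r0 : 0 < r) (L0 : 0 < L).
Hypothesis mZ : forall u, measurable_fun setT (Z u).
Hypothesis cZ : forall w, continuous (Z^~ w).
Hypothesis iM : integ P M.
Hypothesis iM2 : integ P (fun w => M w ^+ 2).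
Hypothesis ZM : forall u w, `|Z u w| <= M w.
Let rho := r ^+ 2 / (2 * a).
Hypothesis covZ : forall u v, 0 <= u <= v -> v <= L ->
  expect P (fun w => Z u w * Z v w) = rho * expR (- (a * (v - u))).
Hypothesis meanZ : forall u, 0 <= u <= L -> expect P (Z u) = 0.

Let V := prim_variance a rho.
Let pr y w := prim (Z^~ w) y.

Lemma expect_mean : integ P (fun w => mean L (Z^~ w)) /\ expect P (fun w => mean L (Z^~ w)) = 0.
Proof.
have [i e] := @expect_prim _ _ _ P Z M mZ cZ iM ZM L (ltW L0).
have E : (fun w => mean L (Z^~ w)) = (fun w => L^-1 * prim (Z^~ w) L).
  by apply/funext => w; rewrite /mean mulrC.
rewrite E; split; first exact: integZ.
rewrite expectZ// e (_ : prim _ L = 0) ?mulr0//.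
apply: (@prim_unique R (fun u => expect P (Z u)) (fun=> 0) L (ltW L0)) => //.
- exact: (@continuous_expect _ _ _ P Z M mZ cZ iM ZM).
- by apply: continuous_itv => u; exact: cvg_cst.
- by move=> u /andP[u0 uL]; rewrite meanZ ?(ltW u0) ?(ltW uL)//; exact: der_cst.
Qed.

Lemma expect_prim_diff s t : 0 <= s <= t -> t <= L ->
  integ P (fun w => (pr t w - pr s w) ^+ 2) /\ expect P (fun w => (pr t w - pr s w) ^+ 2) = V (t - s).
Proof.
move=> /andP[s0 st] tL.
have mZ' u : measurable_fun setT (Z (s + u)) by [].
have cZ' w : continuous (fun u => Z (s + u) w).
  move=> u; apply: (cvg_comp (fun u => s + u) (Z^~ w)); last exact: cZ.
  by apply: cvgD; [exact: cvg_cst|exact: cvg_id].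
have ts : 0 <= t - s by rewrite subr_ge0.
have cov' u v : 0 <= u <= v -> v <= t - s ->
    expect P (fun w => Z (s + u) w * Z (s + v) w) = rho * expR (- (a * (v - u))).
  move=> /andP[u0 uv] vts; rewrite covZ.
  - by congr (_ * expR (- (a * _))); ring.
  - by rewrite lerD2l uv andbT addr_ge0.
  - lra.
have := @expect_prim_sqr _ _ _ P (fun u => Z (s + u)) M a rho (t - s) a0 ts mZ' cZ' iM2 (fun u => ZM (s + u)) cov'.
rewrite (_ : (fun w => prim (fun u => Z (s + u) w) (t - s) ^+ 2) = (fun w => (pr t w - pr s w) ^+ 2))//.
by apply/funext => w; rewrite (@prim_shift R (Z^~ w)) ?s0//; exact: (@cZ w).
Qed.

(** Polarisation: the product of the integrals over [[0, y]] and [[0, L]] is written with the squares of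
    both and of their difference, the integral over [[y, L]], whose variance is known by stationarity. *)
Lemma expect_fluct2 y : 0 <= y <= L -> expect P (fun w => fluct L (Z^~ w) y ^+ 2) =
  (y / L) ^+ 2 * V L - y / L * (V y + V L - V (L - y)) + V y.
Proof.
move=> /andP[y0 yL].
have pr0 w : pr 0 w = 0 by apply: prim0; exact: (@cZ w).
have sq t : 0 <= t <= L -> integ P (fun w => pr t w ^+ 2) /\ expect P (fun w => pr t w ^+ 2) = V t.
  move=> /andP[t0 tL].
  have := @expect_prim_diff 0 t; rewrite lexx t0 subr0 => /(_ isT tL).
  by rewrite (_ : (fun w => (pr t w - pr 0 w) ^+ 2) = (fun w => pr t w ^+ 2))//; apply/funext => w; rewrite pr0 subr0.
have [i1 e1] := sq y (introT andP (conj y0 yL)).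
have [i2 e2] := sq L (introT andP (conj (ltW L0) (lexx L))).
have [i3 e3] := expect_prim_diff (introT andP (conj y0 yL)) (lexx L).
have iS := integB (integD i1 i2) i3.
transitivity (expect P (fun w => (y / L) ^+ 2 * pr L w ^+ 2 -
    y / L * (pr y w ^+ 2 + pr L w ^+ 2 - (pr L w - pr y w) ^+ 2) + pr y w ^+ 2)).
  apply: eq_Rintegral => w _; rewrite /fluct /mean -/(pr y w) -/(pr L w).
  by field; rewrite gt_eqF.
rewrite (expectD (integB (integZ _ i2) (integZ _ iS)) i1) (expectB (integZ _ i2) (integZ _ iS)).
by rewrite (expectZ _ i2) (expectZ _ iS) (expectB (integD i1 i2) i3) (expectD i1 i2) e1 e2 e3.
Qed.

(** The variance of [fluct] is integrated over the channel by an explicit antiderivative. *)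
Lemma expect_kappa : integ P (fun w => kappa L (Z^~ w)) /\ expect P (fun w => kappa L (Z^~ w)) = ou_enh a r L.
Proof.
pose Q y w := fluct L (Z^~ w) (clamp 0 L y) ^+ 2.
have cl u : 0 <= clamp 0 L u <= L by apply: clamp_itv; exact: ltW.
have mpr y : 0 <= y -> measurable_fun setT (pr y).
  by move=> y0; exact: (@measurable_prim _ _ _ Z mZ cZ).
have mQ y : measurable_fun setT (Q y).
  apply: measurable_funX; apply: measurable_funB; last by apply: mpr; case/andP: (cl y).
  by apply: measurable_funM => //; apply: measurable_funM => //; apply: mpr; exact: ltW.
have cQ w : continuous (Q^~ w).
  move=> y; apply: (cvg_comp (clamp 0 L) (fun y => fluct L (Z^~ w) y ^+ 2)); first exact: continuous_clamp.
  exact: (@continuous_fluct2 R L (Z^~ w) (@cZ w)).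
have QM u w : `|Q u w| <= 4 * L ^+ 2 * M w ^+ 2.
  have := @fluct2_le R L (M w) (Z^~ w) L0 (@cZ w) (fun u _ => ZM u w) _ (cl u).
  by rewrite mulrAC.
have iM' : integ P (fun w => 4 * L ^+ 2 * M w ^+ 2) by exact: integZ.
have [i e] := @expect_prim _ _ _ P Q _ mQ cQ iM' QM L (ltW L0).
have kE : (fun w => kappa L (Z^~ w)) = (fun w => L^-1 * prim (Q^~ w) L).
  apply/funext => w; rewrite /kappa /mean mulrC; congr (_ * _).
  apply: eq_prim; [exact: ltW|exact: (@continuous_fluct2 R L (Z^~ w) (@cZ w))|exact: cQ|].
  by move=> y /andP[y0 yL]; rewrite /Q clamp_id// ltW//= ltW.
rewrite kE; split; first exact: integZ.
rewrite expectZ// e.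
pose E := expR (- (a * L)).
(* F is an antiderivative of phi. *)
pose F (y : R) : R := V L / (3 * L ^+ 2) * (y * y * y)
  - 2 * rho / L * (2 / (3 * a) * (y * y * y) + (E - 1) / (2 * a ^+ 2) * (y * y)
       + a ^- 2 * (- a^-1 * (y * expR (- a * y)) - a ^- 2 * expR (- a * y))
       - E / a ^+ 2 * (a^-1 * (y * expR (a * y)) - a ^- 2 * expR (a * y)))
  + 2 * rho * ((2 * a)^-1 * (y * y) - a ^- 3 * expR (- a * y) - a ^- 2 * y).
pose phi (y : R) : R := (y / L) ^+ 2 * V L - y / L * (V y + V L - V (L - y)) + V y.
have dF (y : R) : is_derive y 1 F (phi y).
  have y1 := is_derive_id y (1 : R); have y2 := der_mul y1 y1; have y3 := der_mul y2 y1.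
  have ep := der_expR (der_lin a y); have em := der_expR (der_lin (- a) y).
  have h1 := der_scal (V L / (3 * L ^+ 2)) y3.
  have h2 := der_scal (2 * rho / L) (der_sub (der_add (der_add (der_scal (2 / (3 * a)) y3)
    (der_scal ((E - 1) / (2 * a ^+ 2)) y2))
    (der_scal (a ^- 2) (der_sub (der_scal (- a^-1) (der_mul y1 em)) (der_scal (a ^- 2) em))))
    (der_scal (E / a ^+ 2) (der_sub (der_scal a^-1 (der_mul y1 ep)) (der_scal (a ^- 2) ep)))).
  have h3 := der_scal (2 * rho) (der_sub (der_sub (der_scal (2 * a)^-1 y2) (der_scal (a ^- 3) em)) (der_scal (a ^- 2) y1)).
  apply: (is_derive_eq (der_add (der_sub h1 h2) h3)).
  rewrite /phi /V /prim_variance.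
  have -> : expR (- (a * (L - y))) = E * expR (a * y) by rewrite -expRD; congr expR; ring.
  rewrite -/E /= (_ : - a * y = - (a * y)) ?mulNr//; set e1 := expR (- (a * y)); set e2 := expR (a * y).
  by field; rewrite !gt_eqF.
have -> : prim (fun u => expect P (Q u)) L = F L - F 0.
  apply: (@prim_unique R (fun u => expect P (Q u)) (fun y => F y - F 0) L (ltW L0)).
  - by rewrite subrr.
  - exact: (@continuous_expect _ _ _ P Q _ mQ cQ iM' QM).
  - by apply: continuous_itv => y; apply: cvgB; [exact: (continuous_derive dF)|exact: cvg_cst].
  - move=> y /andP[y0 yL]; have yL' : 0 <= y <= L by rewrite ltW//= ltW.
    rewrite (_ : expect P _ = phi y).
      have h := der_sub (dF y) (der_cst (F 0) y).
      by apply: (is_derive_eq h); rewrite subr0.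
    rewrite /phi -expect_fluct2//; apply: eq_Rintegral => w _.
    by rewrite /Q clamp_id.
have EE : expR (a * L) = E^-1 by rewrite /E expRN invrK.
(* What remains is an identity of rational functions of a, r, L and E. *)
rewrite /F /V /prim_variance /ou_enh /rho !mulr0 !mul0r !expR0 !mulNr -/E EE.
have E0 : E != 0 by rewrite gt_eqF// expR_gt0.
clearbody E; field.
by rewrite E0 !gt_eqF.
Qed.

End MeanKappa.

(** * Moments and covariance of the process *)

Section OUMoments.
Context {d : measure_display} {T : measurableType d} {R : realType}.
Variable P : probability T R.
Variables (a r L : R) (W : R -> {RV P >-> R}) (X0 : {RV P >-> R}) (Y V : R -> T -> R).
Hypotheses (a0 : 0 < a) (r0 : 0 < r) (L0 : 0 < L).
Let rho := r ^+ 2 / (2 * a).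
Hypothesis W0 : {ae P, forall w, W 0 w = 0}.
Hypothesis lawW : forall s t, 0 <= s -> s < t -> t <= L -> gaussian_rv P (W t \- W s) 0 (t - s).
Hypothesis indW : forall s t, 0 <= s -> s < t -> t <= L ->
  independent_systems P (sigma_of_rv (W t \- W s)) (sigma_of_process `[0, s] W).
Hypothesis lawX0 : gaussian_rv P X0 0 rho.
Hypothesis indX0 : independent_systems P (sigma_of_rv X0) (sigma_of_process `[0, L] W).
Hypothesis regYV : regular_ou L a r Y V.
Hypothesis clampY : forall t w, Y t w = Y (clamp 0 L t) w.
Hypothesis aeYV : {ae P, forall w, Y 0 w = X0 w /\ forall t, 0 <= t <= L -> V t w = W t w}.

Let M w := sup_abs L (Y^~ w).

Let rho0 : 0 < rho. Proof. by rewrite /rho divr_gt0 ?mulr_gt0// exprn_gt0. Qed.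

Lemma expect_ae (f g : T -> R) : {ae P, forall w, f w = g w} -> expect P f = expect P g.
Proof.
move=> fg; rewrite /expect /Rintegral; congr fine; apply: integral_ae_eq_fun.
by apply: filterS fg => w ->.
Qed.

(** The law of [X0] enters through its standard deviation, the square root of [rho]. *)
Lemma stationary_YY n (t : 'I_n -> R) (h : R) :
  (forall i, 0 <= t i <= L) -> (forall i, 0 <= t i + h <= L) ->
  forall B : set (n.-tuple R), measurable B ->
    P [set w | B [tuple Y (t i + h) w | i < n]] = P [set w | B [tuple Y (t i) w | i < n]].
Proof.
have p2 : Num.sqrt rho ^+ 2 = rho by rewrite sqr_sqrtr// ltW.
have p0 : 0 < Num.sqrt rho by rewrite sqrtr_gt0.
have lawX0' : gaussian_rv P X0 0 (Num.sqrt rho ^+ 2) by rewrite p2.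
exact: (@regular_stationary _ _ _ P a r L (Num.sqrt rho) W X0 Y V a0 r0 L0 p0 p2 lawW indW lawX0' indX0 regYV aeYV).
Qed.

Lemma norm_le_sup u w : `|Y u w| <= M w.
Proof.
have [_ _ cY _ _] := regYV.
by rewrite clampY; apply: sup_abs_ge; [exact: cY|apply: clamp_itv; exact: ltW].
Qed.

Lemma sup_ge0 w : 0 <= M w.
Proof. exact: le_trans (normr_ge0 _) (norm_le_sup 0 w). Qed.

Lemma measurable_sup : measurable_fun setT M.
Proof.
have [mY _ cY _ _] := regYV.
apply: (@measurable_functional R L L0 d T Y mY cY (sup_abs L) 1) => b1 b2 e c1 c2 h.
by rewrite mul1r; apply: sup_abs_lipschitz.
Qed.

Lemma integ_supV6 : integ P (fun w => sup_abs L (V^~ w) ^+ 6).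
Proof.
have [_ mV _ cV ou] := regYV.
have [C C0 hC] := @gaussian_sixth R.
apply: (@integ_sup_abs6 _ _ _ P L C V L0 C0 mV cV) => [w|s t s0 st tL]; first by have [] := ou w.
have mW : measurable_fun setT (W t \- W s) by exact: measurable_funB.
have ts : 0 < t - s by rewrite subr_gt0.
apply: le_trans (hC d T P (W t \- W s) (t - s) mW ts (lawW s0 st tL)).
rewrite (_ : (\int[P]_w ((V t w - V s w) ^+ 6)%:E = \int[P]_w (((W t \- W s) w) ^+ 6)%:E)%E)//.
apply: integral_ae_eq_fun; apply: filterS aeYV => w [_ vw].
by rewrite !vw//; [rewrite s0/=; lra|lra].
Qed.

(** The supremum is at most the initial value plus a multiple of the supremum of the noise. *)
Lemma integ_sup6 : integ P (fun w => M w ^+ 6).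
Proof.
have [mY mV cY cV ou] := regYV.
have [C C0 hC] := @gaussian_sixth R.
have i0 : integ P (fun w => Y 0 w ^+ 6).
  have m6 : measurable_fun setT (fun w => Y 0 w ^+ 6) by exact: measurable_funX.
  have [||//] := @integ_ge0_le _ _ _ P (fun w => Y 0 w ^+ 6) (C * rho ^+ 3) m6.
    by move=> w; rewrite exprn_even_ge0.
  have mX : measurable_fun setT X0 by [].
  apply: le_trans (hC d T P X0 rho mX rho0 lawX0).
  rewrite (_ : (\int[P]_w (Y 0 w ^+ 6)%:E = \int[P]_w (X0 w ^+ 6)%:E)%E)//.
  by apply: integral_ae_eq_fun; apply: filterS aeYV => w [-> _].
apply: (integ_le _ _ (integZ (2 ^+ 6) (integD i0 (integZ ((2 * r) ^+ 6) integ_supV6)))).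
  by apply: measurable_funX; exact: measurable_sup.
move=> w; rewrite ger0_norm ?exprn_even_ge0//.
set x := `|Y 0 w|; set y := 2 * r * sup_abs L (V^~ w).
have y0 : 0 <= y by apply: mulr_ge0; [rewrite mulr_ge0// ltW|apply: sup_abs_ge0 => //; exact: cV].
have x0 : 0 <= x by exact: normr_ge0.
have Mxy : M w <= x + y.
  apply: sup_abs_le => // u uL; have [v0 ouw] := ou w.
  apply: (@ou_path_le R a r L (Y^~ w) (V^~ w) a0 r0 (cY w) v0 ouw) => // u' u'L.
  by apply: sup_abs_ge => //; exact: cV.
have -> : Y 0 w ^+ 6 = x ^+ 6 by rewrite /x -normrX ger0_norm// exprn_even_ge0.
rewrite -exprMn -/y.
have Mm : M w <= 2 * Num.max x y.
  apply: (le_trans Mxy); rewrite mulr2n mulrDl mul1r lerD// le_max lexx ?orbT//.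
apply: (@le_trans _ _ ((2 * Num.max x y) ^+ 6)).
  by apply: lerXn2r; rewrite ?nnegrE ?sup_ge0// mulr_ge0// le_max x0.
rewrite exprMn ler_wpM2l ?exprn_even_ge0//.
by rewrite /Num.max; case: ifP => _; rewrite ?lerDr ?lerDl exprn_even_ge0.
Qed.

Lemma integ_sup k : (k <= 6)%N -> integ P (fun w => M w ^+ k).
Proof.
move=> k6; apply: (integ_le _ _ (integD (integ_cst P 1) integ_sup6)).
  by apply: measurable_funX; exact: measurable_sup.
move=> w; rewrite ger0_norm ?exprn_ge0 ?sup_ge0//.
have [M1|M1] := leP (M w) 1.
  by apply: (@le_trans _ _ 1); [exact: exprn_ile1 (sup_ge0 w) M1|rewrite lerDl exprn_even_ge0].
by apply: (@le_trans _ _ (M w ^+ 6)); [rewrite ler_weXn2l// ltW|rewrite lerDr].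
Qed.

Lemma integ_sup1 : integ P M.
Proof. by have := @integ_sup 1 isT. Qed.

Lemma expect_Y_eq0 u : 0 <= u <= L -> expect P (Y u) = 0.
Proof.
move=> uL; have [mY _ _ _ _] := regYV.
have iY t : integ P (Y t) by apply: (integ_le _ _ integ_sup1) => // w; exact: norm_le_sup.
have z0 : 0 <= (0 : R) <= L by rewrite lexx ltW.
have u0 : 0 <= 0 + u <= L by rewrite add0r.
have mX : measurable_fun setT X0 by [].
rewrite -(gaussian_centered mX rho0 lawX0).
have <- : expect P (Y 0) = expect P X0 by apply: expect_ae; apply: filterS aeYV => w [].
have := @tuple_law_expect _ _ _ P 1 (fun=> Y (0 + u)) (fun=> Y 0) (fun x => tnth x ord0)
  (fun i => mY _) (fun i => mY _) (@stationary_YY 1 (fun=> 0) u (fun=> z0) (fun=> u0)) (measurable_tnth ord0).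
have E s : (fun w => tnth [tuple Y s w | i < 1] ord0) = Y s.
  by apply/funext => w; rewrite tnth_mktuple.
by rewrite !E add0r; apply; exact: iY.
Qed.

Lemma integ_YY s t : integ P (fun w => Y s w * Y t w).
Proof.
have [mY _ _ _ _] := regYV.
apply: (integ_le _ _ (@integ_sup 2 isT)); first exact: measurable_funM.
by move=> w; rewrite normrM expr2; apply: ler_pM => //; exact: norm_le_sup.
Qed.

Lemma covariance_shift u v : 0 <= u <= v -> v <= L ->
  expect P (fun w => Y u w * Y v w) = expect P (fun w => Y 0 w * Y (v - u) w).
Proof.
move=> /andP[u0 uv] vL; have [mY _ _ _ _] := regYV.
pose t (i : 'I_2) : R := if i == ord0 then 0 else v - u.
have tL i : 0 <= t i <= L by rewrite /t; case: ifP => _; lra.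
have thL i : 0 <= t i + u <= L by rewrite /t; case: ifP => _; lra.
pose F (x : 2.-tuple R) := tnth x ord0 * tnth x ord_max.
have mF : measurable_fun setT F by apply: measurable_funM; exact: measurable_tnth.
have t0 : t ord0 = 0 by [].
have t1 : t ord_max = v - u by [].
have := @tuple_law_expect _ _ _ P 2 (fun i => Y (t i + u)) (fun i => Y (t i)) F
  (fun i => mY _) (fun i => mY _) (@stationary_YY 2 t u tL thL) mF.
have FE (s : 'I_2 -> R) w : F [tuple Y (s i) w | i < 2] = Y (s ord0) w * Y (s ord_max) w.
  by rewrite /F !tnth_mktuple.
have E1 : (fun w => F [tuple Y (t i + u) w | i < 2]) = (fun w => Y u w * Y v w).
  by apply/funext => w; rewrite (FE (fun i => t i + u)) t0 t1 add0r subrK.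
have E2 : (fun w => F [tuple Y (t i) w | i < 2]) = (fun w => Y 0 w * Y (v - u) w).
  by apply/funext => w; rewrite FE t0 t1.
by rewrite E1 E2; apply; exact: integ_YY.
Qed.

Lemma expect_Y0V t : 0 <= t <= L -> expect P (fun w => Y 0 w * V t w) = 0.
Proof.
move=> /andP[t0 tL]; have [_ _ _ _ ou] := regYV.
have [t00|tn0] := eqVneq t 0.
  rewrite -[RHS](expect_cst P 0); apply: eq_Rintegral => w _.
  by have [v0 _] := ou w; rewrite t00 v0 mulr0.
have tpos : 0 < t <= L by rewrite lt_neqAle eq_sym tn0 t0.
transitivity (expect P (fun w => X0 w * (W t w - W 0 w))); last exact: initial_orthogonal tpos.
apply: expect_ae.
apply: filterS2 W0 aeYV => w w0 [-> vw].
by rewrite vw ?t0// w0 subr0.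
Qed.

(** Multiplying the equation by [Y 0] and taking expectations removes the noise and leaves a linear
    differential equation for the covariance. *)
Lemma covariance0 t : 0 <= t <= L -> expect P (fun w => Y 0 w * Y t w) = rho * expR (- (a * t)).
Proof.
move=> tL; have [mY mV cY cV ou] := regYV.
pose Q u w := Y 0 w * Y u w.
have mQ u : measurable_fun setT (Q u) by exact: measurable_funM.
have cQ w : continuous (Q^~ w).
  by move=> u; apply: cvgM; [exact: cvg_cst|exact: cY].
have QM u w : `|Q u w| <= M w ^+ 2.
  by rewrite normrM expr2; apply: ler_pM => //; exact: norm_le_sup.
have iM2 := @integ_sup 2 isT.
pose C u := expect P (Q u).
have cC : continuous C := @continuous_expect _ _ _ P Q _ mQ cQ iM2 QM.
have C0 : C 0 = rho.
  have mX : measurable_fun setT X0 by [].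
  have [_ <-] := integ_gaussian2 mX rho0 lawX0.
  by apply: expect_ae; apply: filterS aeYV => w [e _]; rewrite /Q e expr2.
have eqC u : 0 <= u <= L -> C u = rho - a * prim C u.
  move=> uL; have /andP[u0 _] := uL.
  have [ip ep] := @expect_prim _ _ _ P Q _ mQ cQ iM2 QM u u0.
  have iV : integ P (fun w => Y 0 w * V u w).
    have h := integZ r^-1 (integD (integB (integ_YY 0 u) (integ_YY 0 0)) (integZ a ip)).
    rewrite (_ : (fun w => _) = (fun w => r^-1 * (Q u w - Q 0 w + a * prim (Q^~ w) u)))//.
    apply/funext => w; have [_ ouw] := ou w.
    rewrite /Q (primZ _ u0 (cY w)).
    by rewrite (ouw u uL); field; rewrite gt_eqF.
  have -> : C u = expect P (fun w => Q 0 w - a * prim (Q^~ w) u + r * (Y 0 w * V u w)).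
    apply: eq_Rintegral => w _; have [_ ouw] := ou w.
    rewrite /Q (primZ _ u0 (cY w)).
    by rewrite (ouw u uL); ring.
  rewrite (expectD (integB (integ_YY 0 0) (integZ a ip)) (integZ r iV)) (expectB (integ_YY 0 0) (integZ a ip)).
  by rewrite (expectZ a ip) (expectZ r iV) expect_Y0V// ep -C0 mulr0 addr0.
have /andP[t0 tL'] := tL.
have dp (u : R) : is_derive u 1 (prim C) (C u) by exact: is_derive_prim.
have dE (u : R) : is_derive u 1 (fun u : R => expR (a * u)) (a * expR (a * u)).
  by have h := der_expR (der_lin a u); apply: (is_derive_eq h); rewrite mulrC.
(* On [0, t] the function exp (a u) (rho - a prim C u) is constant, and the second factor is C. *)
have dG (u : R) := der_mul (dE u) (der_sub (der_cst rho u) (der_scal a (dp u))).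
pose G u := expR (a * u) * (rho - a * prim C u).
have dG0 (u : R) : 0 < u < t -> is_derive u 1 G 0.
  move=> /andP[u0 ut]; apply: (is_derive_eq (dG u)).
  by rewrite eqC; [ring|lra].
have cG : {within `[0, t], continuous G} := continuous_itv (continuous_derive dG).
have cc : {within `[0, t], continuous (fun=> 0 : R)}.
  by apply: continuous_itv => u; exact: cvg_cst.
have := @norm_derive_comparison R G (fun=> 0) (fun=> 0) (fun=> 0) 0 t t0 dG0 (fun u _ => der_cst 0 u) cG cc.
rewrite subrr => h.
have {}h : `|G t - G 0| <= 0 by apply: h => u _; rewrite normr0.
move: h; rewrite normr_le0 subr_eq0 => /eqP.
rewrite /G prim0// !mulr0 expR0 mul1r subr0 -eqC// => h.
by rewrite -[LHS]/(C t) -h mulrC mulrA -expRD addNr expR0 mul1r.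
Qed.

Lemma covariance u v : 0 <= u <= v -> v <= L ->
  expect P (fun w => Y u w * Y v w) = rho * expR (- (a * (v - u))).
Proof.
move=> /andP[u0 uv] vL; rewrite covariance_shift ?u0// covariance0//; lra.
Qed.

End OUMoments.

(** * The averaged front speed *)

Section Transfer.
Context {d : measure_display} {T : measurableType d} {R : realType}.
Variable P : probability T R.

Lemma probability_ae (A B : set T) : measurable A -> measurable B ->
  {ae P, forall w, A w <-> B w} -> P A = P B.
Proof.
move=> mA mB AB; rewrite -[A]setIT -[B]setIT -!integral_indic//.
apply: integral_ae_eq_fun; apply: filterS AB => w ab; congr (_%:E).
by rewrite !indicE; congr (_%:R); congr nat_of_bool; apply/idP/idP; rewrite !inE => /ab.
Qed.

(** On a continuous path the supremum is finite, so its extended real value is the real one. *)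
Lemma sup_normE L (X : R -> {RV P >-> R}) (b : R -> R) w : 0 < L -> continuous b ->
  (forall y, 0 <= y <= L -> b y = X y w) -> sup_norm L X w = (sup_abs L b)%:E.
Proof.
move=> L0 cb bX; rewrite /sup_norm /sup_abs -ereal_sup_EFin.
- rewrite image_comp; congr ereal_sup.
  apply: eq_imagel => y; rewrite /= in_itv/= => yL.
  by rewrite bX.
- have [m _ hm] := @continuous_bounded R b 0 L cb.
  by exists m => _ [z + <-]; rewrite /= in_itv => /hm.
- by exists `|b 0|, 0 => //; rewrite /= in_itv/= lexx ltW.
Qed.

End Transfer.

Theorem corollary2p1 (R : realType) (d : measure_display)
    (T : measurableType d) (P : probability T R) (a r L : R)
    (W : R -> {RV P >-> R}) (X0 : {RV P >-> R}) (X : R -> {RV P >-> R}) :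
  0 < a -> 0 < r -> 0 < L ->
  wiener_process L W ->
  gaussian_rv P X0 0 (r ^+ 2 / (2 * a)) ->
  independent_systems P (sigma_of_rv X0) (sigma_of_process `[0, L] W) ->
  ou_solution L a r W X0 X ->
  let c (delta : R) (w : T) : R := kpp_speed L (fun y => X y w) delta in
  [/\ stationary_on L X,
      {ae P, forall w, {within `[0, L], continuous (fun y => X y w)}},
      ae_integrable P (fun w => sup_norm L X w ^+ 6)%E
        /\ (\int[P]_w (sup_norm L X w ^+ 6) < +oo)%E,
      (forall delta, 0 <= delta -> ae_integrable P (fun w => (c delta w)%:E)) &
      ((fun delta : R => fine 'E_P[c delta])
        = (fun delta : R => kpp_c0 + kpp_c0 * delta ^+ 2 / 2 * ou_enh a r L)
          +O_ (0^'+) (fun delta : R => delta ^+ 3))].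
Proof.
move=> a0 r0 L0 hW lawX0 indX0 hX c.
have [W0 lawW indW _] := hW.
have [Y [V [regYV clampY aeYV aeX]]] := regular_modification L0 hW hX.
have aeV : {ae P, forall w, Y 0 w = X0 w /\ forall t, 0 <= t <= L -> V t w = W t w}.
  by apply: filterS aeYV => w [y0 h]; split => // t /h[].
have aeYX : {ae P, forall w, forall t, 0 <= t <= L -> Y t w = X t w}.
  by apply: filterS aeYV => w [_ h] t /h[].
have [mY mV cY cV ou] := regYV.
pose M w := sup_abs L (Y^~ w).
have YM u w : `|Y u w| <= M w by exact: (norm_le_sup L0 regYV clampY).
have iM k : (k <= 6)%N -> integ P (fun w => M w ^+ k).
  exact: (integ_sup a0 r0 L0 lawW lawX0 regYV clampY aeV).
have iM1 : integ P M by exact: (integ_sup1 a0 r0 L0 lawW lawX0 regYV clampY aeV).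
pose cs delta w := kpp_speed L (Y^~ w) delta.
have mcs delta : 0 <= delta -> measurable_fun setT (cs delta).
  move=> delta0; apply: (@measurable_functional R L L0 d T Y mY cY (fun b => kpp_speed L b delta) delta).
  by move=> b1 b2 e c1 c2 h; exact: speed_lipschitz.
have ics delta : 0 <= delta -> integ P (cs delta).
  move=> delta0; apply: (integ_le (mcs _ delta0) _ (integD (integ_cst P 2) (integZ delta iM1))) => w.
  have := @speed_dist2 R L (M w) (Y^~ w) delta L0 (cY w) (fun y _ => YM y w) delta0.
  have := ler_normD (cs delta w - 2) 2; rewrite subrK normr_nat -/(cs delta w); lra.
have ccs delta : {ae P, forall w, (c delta w)%:E = (cs delta w)%:E}.
  apply: filterS aeYX => w h; congr (_%:E); apply: eq_kpp_speed => y yL.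
  by rewrite h//; lra.
have aesup : {ae P, forall w, (sup_norm L X w ^+ 6)%E = (M w ^+ 6)%:E}.
  by apply: filterS aeYX => w h; rewrite (@sup_normE _ _ _ P L X (Y^~ w) w L0 (cY w) h) -EFin_expe.
split.
- move=> n t h tL thL B mB.
  have mset (Z : R -> T -> R) (s : 'I_n -> R) : (forall u, measurable_fun setT (Z u)) ->
      measurable [set w | B [tuple Z (s i) w | i < n]].
    move=> mZ; have mZ' := measurable_tuple_fun (fun i => mZ (s i)).
    by have := mZ' measurableT B mB; rewrite setTI.
  have mXX u : measurable_fun setT (X u : T -> R) by [].
  have tr s : (forall i, 0 <= s i <= L) ->
      P [set w | B [tuple X (s i) w | i < n]] = P [set w | B [tuple Y (s i) w | i < n]].
    move=> sL; apply: probability_ae; [exact: (mset (fun u => X u))|exact: mset|].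
    apply: filterS aeYX => w hw /=.
    suff -> : [tuple X (s i) w | i < n] = [tuple Y (s i) w | i < n] by [].
    by apply: eq_from_tnth => i; rewrite !tnth_mktuple hw.
  rewrite (tr (fun i => t i + h) thL) (tr t tL).
  exact: (stationary_YY a0 r0 L0 lawW indW lawX0 indX0 regYV aeV tL thL mB).
- exact: aeX.
- split; first by exists (fun w => (M w ^+ 6)%:E) => //; exact: iM.
  rewrite (integral_ae_eq_fun aesup).
  by have /integral_fune_lt_pinfty := iM 6%N isT; apply.
- by move=> delta delta0; exists (fun w => (cs delta w)%:E) => //; exact: ics.
- apply/eqaddOP.
  have iM3 := iM 3%N isT.
  have iM2 := iM 2%N isT.
  have cov := covariance a0 r0 L0 W0 lawW indW lawX0 indX0 regYV clampY aeV.
  have mean0 := expect_Y_eq0 a0 r0 L0 lawW indW lawX0 indX0 regYV clampY aeV.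
  have [im em] := @expect_mean _ _ _ P Y M L L0 mY cY iM1 YM mean0.
  have [ik ek] := @expect_kappa _ _ _ P Y M a r L a0 L0 mY cY iM2 YM cov.
  pose K := speed_const L * expect P (fun w => M w ^+ 3).
  have bound delta : 0 <= delta ->
      `|expect P (cs delta) - (2 + delta ^+ 2 * ou_enh a r L)| <= K * delta ^+ 3.
    move=> delta0.
    pose ap w := 2 + delta * mean L (Y^~ w) + delta ^+ 2 * kappa L (Y^~ w).
    have iap1 := integD (integ_cst P 2) (integZ delta im).
    have iap : integ P ap := integD iap1 (integZ (delta ^+ 2) ik).
    have eap : expect P ap = 2 + delta ^+ 2 * ou_enh a r L.
      rewrite (expectD iap1 (integZ (delta ^+ 2) ik)) (expectD (integ_cst P 2) (integZ delta im)).
      by rewrite (expectZ _ im) (expectZ _ ik) em ek mulr0 addr0 expect_cst.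
    rewrite -eap -(expectB (ics _ delta0) iap).
    have -> : K * delta ^+ 3 = expect P (fun w => speed_const L * delta ^+ 3 * M w ^+ 3).
      by rewrite expectZ// /K; ring.
    apply: expect_norm_le.
    - by apply: measurable_funB; [exact: mcs|exact: integ_measurable iap].
    - exact: integZ.
    - move=> w; rewrite -mulrA -exprMn.
      exact: (@speed_expansion R L (M w) (Y^~ w) delta L0 (cY w) (fun y _ => YM y w) delta0).
  have fE delta : fine 'E_P[c delta] = expect P (cs delta).
    rewrite unlock /expect /Rintegral; congr fine; exact: integral_ae_eq_fun.
  near=> k; near=> delta.
  have delta0 : 0 <= delta by [].
  rewrite -[X in `|X|]/(fine 'E_P[c delta] - (kpp_c0 + kpp_c0 * delta ^+ 2 / 2 * ou_enh a r L)).
  rewrite fE kpp_c0E.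
  have -> : 2 * delta ^+ 2 / 2 * ou_enh a r L = delta ^+ 2 * ou_enh a r L by field.
  apply: (le_trans (bound _ delta0)).
  rewrite [X in _ <= _ * X]ger0_norm ?exprn_ge0//; apply: ler_wpM2r; first exact: exprn_ge0.
  by near: k; exact: nbhs_pinfty_ge.
Unshelve. all: by end_near. Qed.
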